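(* Consider the fairness-first system described in the context, with i.i.d. server service times distributed as $V$ and independent Poisson arrivals of rate $\lambda_c$ for each cold symbol. Under the low traffic assumption, hot data download implements an $M/G/1$ queue whose service time $S$ is distributed as $$\Pr\{S>s\}=C(s)\bigl[\alpha(s)(1-\rho)+\rho\bigr]^m,$$ where $$m=\log_2(t+1),\qquad \rho=\lambda_cE[V],$$ $$\alpha(s)=1-\Pr\{V\le s\}\int_0^s e^{-\lambda_c v}\Pr\{V=v\}\,dv,$$ $$C(s)=\Pr\{V>s\}\bigl(1-\Pr\{V\le s\}^2\bigr)^{t-m},$$ and $\Pr\{V=v\}$ denotes the probability density of $V$ at $v$.
   Context: A data set consisting of one hot symbol and $k-1$ cold symbols is stored using a binary $[2^k-1,k]$ simplex code: each nonzero binary linear combination of the $k$ symbols is stored on its own server. For the hot symbol there is one systematic server and $t=2^{k-1}-1$ disjoint recovery groups of two servers each; exactly $\log_2(t+1)=k-1$ of these groups contain a cold data server (the systematic server of a cold symbol), one in each such group. Fairness-first system. Hot data requests arrive as a Poisson process of rate $\lambda$, and requests for each cold symbol arrive as independent Poisson processes of rate $\lambda_c$. Each request (hot or cold) is assigned to the systematic server of the symbol it asks for, where requests are served one at a time in FIFO order. As soon as a hot data request moves into service at its systematic server, a redundant copy of it is launched at each of its recovery groups that is idle at that moment (both servers start serving it); no copy is launched at non-idle groups. A redundant copy at a recovery group completes when both servers of the group finish serving it. If a cold data request arrives at a cold data server busy with a redundant hot data copy, that redundant copy is immediately removed from the system, so cold data requests are unaffected by hot ones and each cold data server is, for cold requests,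 an $M/G/1$ queue (assumed stable, $\rho<1$). For a group with a cold data server, a redundant copy completes only if the cold data server finishes serving it before a cold request arrives there. A hot data request completes as soon as its copy at the systematic server or one of its redundant copies at a recovery group completes, and its outstanding copies are then removed immediately. Service times at all servers are i.i.d., distributed as $V$. Low traffic assumption: hot data requests do not wait in queue and go straight into service, i.e. each hot data request completes service before the next one arrives; under this assumption each arriving hot data request independently sees time averages of the system state (PASTA), so that the service times of subsequent hot data requests are i.i.d. (a recovery group with a cold data server is found idle when its cold data server is not busy with a cold request). *)

(* Defs.v *)
(* MathComp world, with MathComp-Analysis. *)
From HB Require Import structures.
From mathcomp Require Import all_boot all_order all_algebra.
From mathcomp Require Import all_classical all_reals all_analysis.

Set Implicit Arguments.
Unset Strict Implicit.
Unset Printing Implicit Defensive.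

Import Order.TTheory GRing.Theory Num.Theory.
Import numFieldNormedType.Exports.

Local Open Scope classical_set_scope.
Local Open Scope ring_scope.

Section independence.
Context d (Omega : measurableType d) (R : realType) (P : probability Omega R).

Definition mutually_independent (I : eqType) (F : I -> set_system Omega) :=
  forall (s : seq I) (A : I -> set Omega), uniq s ->
    (forall i, i \in s -> F i (A i)) ->
    P (\bigcap_(i in [set` s]) A i) = (\prod_(i <- s) P (A i))%E.

Definition sigma_of (X : Omega -> R) : set_system Omega :=
  preimage_set_system setT X measurable.

End independence.

Section queues.
Context d (Omega : measurableType d) (R : realType) (P : probability Omega R).
Implicit Types A B D : nat -> Omega -> R.

Definition gap A (n : nat) (x : Omega) : R :=
  if n is n'.+1 then A n x - A n' x else A 0%N x.

(* Together with independence of the gaps, this says that the A n are the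
   epochs of a Poisson process of rate lam on [0, +oo[. *)
Definition exponential_gaps (lam : R) A :=
  (forall n, measurable_fun setT (A n)) /\
  (forall n (U : set R), measurable U ->
     P (gap A n @^-1` U) = exponential_prob lam U).

(* One server, FIFO, initially empty: D n is the departure epoch of the
   n-th request, which arrives at A n and needs service for B n. *)
Definition fifo A B D :=
  forall x, D 0%N x = A 0%N x + B 0%N x /\
    forall n, D n.+1 x = Num.max (A n.+1 x) (D n x) + B n.+1 x.

(* M/G/1 queue whose service time has tail function G. *)
Record MG1_queue (lam : R) (G : R -> R) A B D : Prop := {
  MG1_arrivals : exponential_gaps lam A ;
  MG1_measurable_service : forall n, measurable_fun setT (B n) ;
  MG1_service_law : forall n s, P [set x | s < B n x] = (G s)%:E ;
  MG1_independence : mutually_independent P (fun i : nat + nat =>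
    match i with inl n => sigma_of (gap A n) | inr n => sigma_of (B n) end) ;
  MG1_fifo : fifo A B D }.

(* Request n occupies the server during [D n - B n, D n[.  Redundant hot copies
   are preempted by cold requests, so they do not occur here. *)
Definition idle_at B D (u : R) : set Omega :=
  [set x | forall n, ~ (D n x - B n x <= u < D n x)].

Definition no_arrival_within A (u y : R) : set Omega :=
  [set x | forall n, ~ (u < A n x <= u + y)].

(* Almost surely, the long-run fraction of time u at which E u holds is p. *)
Definition time_average (E : R -> set Omega) (p : R) :=
  {ae P, forall x,
    fine (lebesgue_measure ([set u | E u x] `&` `[0, tau])) / tau
      @[tau --> +oo%R] --> p}.

End queues.

Section simplex_code.
Variable k : nat.

(* The server indexed by v stores the sum of the symbols in the support
   of v. *)
Definition server := {v : 'rV['F_2]_k | v != 0}.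

Lemma unit_vector_neq0 (j : 'I_k) : (delta_mx 0 j : 'rV['F_2]_k) != 0.
Proof.
by apply/eqP => /rowP /(_ j); rewrite !mxE !eqxx => /eqP; rewrite oner_eq0.
Qed.

Definition sys (j : 'I_k) : server := Sub (delta_mx 0 j) (unit_vector_neq0 j).

(* Two servers recover the hot symbol iff their vectors add up to the one of
   its systematic server. *)
Definition recovery_groups (hot : 'I_k) : {set {set server}} :=
  [set G : {set server} |
    (#|G| == 2) && (\sum_(v in G) val v == val (sys hot))].

Definition cold (hot : 'I_k) := {j : 'I_k | j != hot}.

End simplex_code.

Section hot_service.
Context d (Omega : measurableType d) (R : realType).
Variables (k : nat) (hot : 'I_k).
(* For one hot request: the service times its copies would have at the
   servers, the event that cold server j is idle at the launch, and the time
   from the launch to the next request for cold symbol j. *)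
Variables (svc : server k -> Omega -> R).
Variables (idle : cold hot -> set Omega) (next : cold hot -> Omega -> R).

Definition launched (G : {set server k}) : set Omega :=
  \bigcap_(j in [set j | sys (val j) \in G]) idle j.

Definition not_removed (G : {set server k}) : set Omega :=
  \bigcap_(j in [set j | sys (val j) \in G])
    [set x | svc (sys (val j)) x < next j x].

(* A copy at a group needs both servers. *)
Definition group_time (G : {set server k}) (x : Omega) : R :=
  \big[Num.max/0]_(v in G) svc v x.

Definition hot_service_time (x : Omega) : R :=
  \big[Num.min/svc (sys hot) x]_(G in recovery_groups hot |
    x \in launched G `&` not_removed G) group_time G x.

End hot_service.

Section system_state.
Context d (Omega : measurableType d) (R : realType).
Variables (k : nat) (hot : 'I_k).

(* The idle cold servers are exactly those of I, and for each j no request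
   for cold symbol j arrives during the next y j units of time; late j t is
   the event that the next arrival is more than t away. *)
Definition state_event (idle : cold hot -> set Omega)
    (late : cold hot -> R -> set Omega)
    (I : {set cold hot}) (y : cold hot -> R) : set Omega :=
  \bigcap_(j in [set: cold hot])
    ((if j \in I then idle j else ~` idle j) `&` late j (y j)).

Definition state_sigma (idle : cold hot -> set Omega)
    (next : cold hot -> Omega -> R) : set_system Omega :=
  <<s [set idle j | j in [set: cold hot]] `|`
      \bigcup_(j in [set: cold hot]) sigma_of (next j) >>.

End system_state.

Section tail.
Context d (Omega : measurableType d) (R : realType) (P : probability Omega R).
Variables (V : {RV P >-> R}) (f : R -> R) (lamc : R).

Definition rho : R := lamc * fine 'E_P[V].

(* f is the density of V. *)
Definition alpha (s : R) : R :=
  1 - fine (cdf V s) *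
      \int[lebesgue_measure]_(v in `[0, s]) (expR (- lamc * v) * f v).

Definition Cfactor (t m : nat) (s : R) : R :=
  fine (ccdf V s) * (1 - fine (cdf V s) ^+ 2) ^+ (t - m).

Definition hot_tail (t m : nat) (s : R) : R :=
  Cfactor t m s * (alpha s * (1 - rho) + rho) ^+ m.

End tail.

(* Main.v *)
(* Time averages seen by a hot request.  Averaging the time-average hypothesis
   over the probability space (bounded convergence and Fubini) turns it into a
   limit of P(E u) as u tends to infinity.  Since the cold queues are
   independent, P(E u) factors, and exponential interarrival times make the
   next arrival independent of the server being idle.  It remains to see that
   an M/G/1 queue that starts empty is idle at time u with a probability q u
   that tends to 1 - rho.  Takacs' ballot argument gives
     q u = sum_n exp (- lam u) (lam u)^n / n! E (1 - (V_1 + ... + V_n) / u)^+ ;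
   dropping the positive part leaves 1 - rho, and the error vanishes by a
   truncated second moment bound on V_1 + ... + V_n.

   Hot service time.  A request is still in service after s iff its systematic
   copy is, and no recovery group has completed.  The recovery groups are the
   disjoint pairs {v, v + e_hot}, so these events are independent.  A group
   without cold server survives with probability 1 - F(s)^2; a group whose cold
   server is j completes iff j was idle, finishes before the next request for
   its symbol and before s, and the other server finishes before s, which has
   probability (1 - rho) F(s) int_0^s exp (- lamc v) f v dv. *)
Require Import Defs.
From HB Require Import structures.
From mathcomp Require Import all_boot all_order all_algebra.
From mathcomp Require Import all_classical all_reals all_analysis.
From mathcomp Require Import measurable_realfun.
From mathcomp Require Import ring lra.

Set Implicit Arguments.
Unset Strict Implicit.
Unset Printing Implicit Defensive.

Import Order.TTheory GRing.Theory Num.Theory.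
Import numFieldNormedType.Exports.

Local Open Scope classical_set_scope.
Local Open Scope ring_scope.

(** * Independence of grouped families *)

(** The hypothesis on time averages already contains the existence of the almost sure limit. Only
    its value has to be identified, so convergence of means suffices and no ergodic theorem enters.
    The ballot formula is not obtained by counting paths: the explicit polynomial [weight] is
    checked to solve the backward equation of the Markov chain of arrival and departure epochs,
    exchangeability serving to average out the first service time. The error term is the mean of
    (V_1 + ... + V_n - u)^+ / u with n Poisson. [V] is merely integrable, hence the truncation;
    stability leaves a gap, linear in u, between u and the mean of the truncated sum, and this gap
    fixes the free constant of the quadratic bound. On the launch side the difficulty is one of
    sigma-algebras. Time averages give the probabilities of full states of all cold servers only,
    whereas the groups need independence server by server. Idleness and the next arrival at a server
    matter only jointly, so the pair is encoded in a single real variable, [availability]. *)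

Lemma bigcap_cons (I : eqType) T (x : I) (s : seq I) (A : I -> set T) :
  \bigcap_(i in [set` x :: s]) A i = A x `&` \bigcap_(i in [set` s]) A i.
Proof.
apply/seteqP; split=> [z H|z [Hx H] i /=].
  split; first by apply: H; rewrite /= mem_head.
  by move=> i /= si; apply: H; rewrite /= in_cons si orbT.
by rewrite in_cons => /orP[/eqP->//|]; exact: H.
Qed.

Lemma bigcap_seq0 (I : eqType) T (A : I -> set T) :
  \bigcap_(i in [set` [::]]) A i = setT.
Proof. by rewrite -subTset => x _ i. Qed.

Lemma eq_bigcap_seq (I : eqType) T (s : seq I) (A B : I -> set T) :
  {in s, A =1 B} ->
  \bigcap_(i in [set` s]) A i = \bigcap_(i in [set` s]) B i.
Proof. by move=> AB; apply: eq_bigcapr => i; exact: AB. Qed.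

Lemma bigcap_seq_measurable d (T : measurableType d) (I : eqType) (s : seq I)
    (A : I -> set T) : (forall i, i \in s -> measurable (A i)) ->
  measurable (\bigcap_(i in [set` s]) A i).
Proof.
elim: s => [_|x s IH mA]; first by rewrite bigcap_seq0.
rewrite bigcap_cons; apply: measurableI; first by apply: mA; rewrite mem_head.
by apply: IH => i si; apply: mA; rewrite in_cons si orbT.
Qed.

Section grouping.
Context d (Omega : measurableType d) (R : realType) (P : probability Omega R).
Variables (I K : eqType) (g : I -> K) (F : I -> set_system Omega).
Hypotheses (Fm : forall i, F i `<=` measurable)
  (FI : forall i, setI_closed (F i)) (Find : mutually_independent P F).

(** A pi-system generating [group_sigma k]; the empty list [r] puts [setT] into it. *)
Definition group_pi (k : K) : set_system Omega := [set B | exists r C,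
  [/\ uniq r, forall i, i \in r -> g i = k /\ F i (C i) &
      B = \bigcap_(i in [set` r]) C i]].

Definition group_sigma (k : K) : set_system Omega :=
  <<s \bigcup_(i in [set i | g i = k]) F i >>.

Lemma group_piT k : group_pi k setT.
Proof. by exists [::], (fun=> setT); split => //; rewrite bigcap_seq0. Qed.

Lemma group_pi_measurable k : group_pi k `<=` measurable.
Proof.
move=> _ [r [C [ur rC ->]]]; apply: bigcap_seq_measurable => i ir.
by apply: (Fm (i := i)); have [] := rC i ir.
Qed.

Lemma group_piI k : setI_closed (group_pi k).
Proof.
move=> _ _ [r1 [C1 [u1 H1 ->]]] [r2 [C2 [u2 H2 ->]]].
exists (undup (r1 ++ r2)), (fun i =>
  if i \in r1 then if i \in r2 then C1 i `&` C2 i else C1 i else C2 i).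
split; first exact: undup_uniq.
  move=> i; rewrite mem_undup mem_cat.
  have [i1|i1] := boolP (i \in r1); have [i2|i2] := boolP (i \in r2) => //= _.
  - have [? ?] := H1 i i1; have [? ?] := H2 i i2.
    by split => //; exact: FI.
  - exact: H1.
  - exact: H2.
apply/seteqP; split.
  move=> x [X1 X2] i /=; rewrite mem_undup mem_cat.
  have [i1|i1] := boolP (i \in r1); have [i2|i2] := boolP (i \in r2) => //= _.
  - by split; [exact: X1|exact: X2].
  - exact: X1.
  - exact: X2.
move=> x X; split=> i /= ir.
  move: (X i); rewrite /= mem_undup mem_cat ir/= => /(_ isT).
  by case: ifPn => // _ [].
move: (X i); rewrite /= mem_undup mem_cat ir orbT => /(_ isT).
by case: ifPn => // _ [].
Qed.

Lemma group_sigma_sub_pi k : group_sigma k `<=` <<s group_pi k >>.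
Proof.
apply: sub_smallest2r => //.
move=> B [i /= ik FB]; exists [:: i], (fun=> B); split => //.
  by move=> j; rewrite inE => /eqP ->.
by rewrite set_cons1 bigcap_set1.
Qed.

(** Each [A k] unfolds into finitely many members of [F] with indices in group [k]. Distinct groups
    use disjoint index lists, so the lists concatenate and the witnesses glue into one family
    [C]. *)
Lemma group_pi_independent s (A : K -> set Omega) : uniq s ->
  (forall k, k \in s -> group_pi k (A k)) ->
  exists r C, [/\ uniq r, forall i, i \in r -> g i \in s /\ F i (C i),
    \bigcap_(k in [set` s]) A k = \bigcap_(i in [set` r]) C i &
    (\prod_(k <- s) P (A k) = \prod_(i <- r) P (C i))%E].
Proof.
elim: s => [_ _|k s IH /= /andP[ks us] HA].
  by exists [::], (fun=> setT); split => //; rewrite ?bigcap_seq0 ?big_nil.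
have [|r [C [ur HC EC PC]]] := IH us.
  by move=> j js; apply: HA; rewrite in_cons js orbT.
have [r1 [C1 [u1 H1 E1]]] := HA k (mem_head _ _).
pose C' i := if g i == k then C1 i else C i.
have rC' : {in r, C' =1 C}.
  move=> i /HC[gi _]; rewrite /C'; case: eqP => // gk.
  by move: ks; rewrite -gk gi.
have r1C' : {in r1, C' =1 C1} by move=> i /H1[gi _]; rewrite /C' gi eqxx.
exists (r1 ++ r), C'; split.
- rewrite cat_uniq u1 ur andbT/=; apply/hasPn => i /HC[gi _].
  by apply/negP => /H1[gk _]; move: ks; rewrite -gk gi.
- move=> i; rewrite mem_cat => /orP[ir1|ir].
    by rewrite r1C'//; have [-> ?] := H1 i ir1; rewrite mem_head.
  by rewrite rC'//; have [? ?] := HC i ir; rewrite in_cons orbC; split => //;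
    apply/orP; left.
- rewrite bigcap_cons EC E1 -(eq_bigcap_seq rC') -(eq_bigcap_seq r1C').
  apply/seteqP; split=> [x [X1 X2] i /=|x X].
    by rewrite mem_cat => /orP[]; [exact: X1|exact: X2].
  by split=> i /= ir; apply: X; rewrite /= mem_cat ir ?orbT.
- rewrite big_cons PC big_cat/=; congr (_ * _)%E.
    rewrite E1 Find//; last by move=> i /H1[].
    by apply: eq_big_seq => i /r1C' ->.
  by apply: eq_big_seq => i /rC' ->.
Qed.

Lemma group_sigma_measurable k : group_sigma k `<=` measurable.
Proof.
apply: smallest_sub; first exact: sigma_algebra_measurable.
by move=> B [i _]; exact: Fm.
Qed.

Lemma prode_fin_num (s : seq K) (A : K -> set Omega) :
  (forall k, k \in s -> measurable (A k)) ->
  (\prod_(k <- s) P (A k) = (\prod_(k <- s) fine (P (A k)))%:E)%E.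
Proof.
elim: s => [_|k s IH mA]; first by rewrite !big_nil.
rewrite !big_cons IH ?EFinM ?fineK ?fin_num_measure//.
  by apply: mA; rewrite mem_head.
by move=> j js; apply: mA; rewrite in_cons js orbT.
Qed.

(** The induction upgrades one index at a time from the pi-system to the sigma-algebra. With the
    other events fixed, the finite measures P (B [&] rest) and c * P B of [B] agree on [group_pi k],
    by the induction hypothesis with [k] moved into [s2]. *)
Lemma group_independent_split s1 s2 (A : K -> set Omega) : uniq (s1 ++ s2) ->
  (forall k, k \in s1 -> group_sigma k (A k)) ->
  (forall k, k \in s2 -> group_pi k (A k)) ->
  P (\bigcap_(k in [set` s1 ++ s2]) A k) = (\prod_(k <- s1 ++ s2) P (A k))%E.
Proof.
elim: s1 s2 A => [|k s1 IH] s2 A.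
  move=> us _ HA; have [r [C [ur HC -> ->]]] := group_pi_independent us HA.
  by apply: Find => // i /HC[].
rewrite cat_cons => /= /andP[ks us] HA1 HA2.
have mrest : measurable (\bigcap_(j in [set` s1 ++ s2]) A j).
  apply: bigcap_seq_measurable => i; rewrite mem_cat => /orP[i1|i2].
    by apply: (@group_sigma_measurable i); apply: HA1; rewrite in_cons i1 orbT.
  by apply: (@group_pi_measurable i); exact: HA2.
have mA j : j \in s1 ++ s2 -> measurable (A j).
  rewrite mem_cat => /orP[i1|i2].
    by apply: (@group_sigma_measurable j); apply: HA1; rewrite in_cons i1 orbT.
  by apply: (@group_pi_measurable j); exact: HA2.
pose c := \prod_(j <- s1 ++ s2) fine (P (A j)).
have c0 : 0 <= c by apply: prodr_ge0 => j _; rewrite fine_ge0.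
rewrite bigcap_cons big_cons (prode_fin_num mA).
suff H B : <<s group_pi k >> B ->
    mrestr P mrest B = mscale (NngNum c0) P B.
  have := H _ (group_sigma_sub_pi (HA1 k (mem_head _ _))).
  by rewrite /mrestr/= /mscale/= muleC.
apply: (g_sigma_algebra_measure_unique (group_pi k) (@group_pi_measurable k)
  (fun=> setT)).
- by move=> _; exact: group_piT.
- by rewrite -subTset => x _; exists 0%N.
- exact: group_piI.
- move=> {}B HB; rewrite /= /mrestr /mscale/=.
  pose A' j := if j == k then B else A j.
  have A'E : {in s1 ++ s2, A' =1 A}.
    by move=> j js; rewrite /A'; case: eqP => // jk; move: ks; rewrite -jk js.
  have A'k : A' k = B by rewrite /A' eqxx.
  have perm : perm_eq (s1 ++ k :: s2) (k :: s1 ++ s2).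
    by rewrite -cat1s perm_catCA.
  have := IH (k :: s2) A'; rewrite (perm_uniq perm) /= ks us => /(_ isT) Hyp.
  rewrite (perm_big _ perm)/= big_cons A'k in Hyp.
  rewrite (eq_big_seq (fun j => P (A j))) in Hyp; last first.
    by move=> j /A'E ->.
  rewrite (prode_fin_num mA) in Hyp.
  rewrite muleC -Hyp.
  + congr (P _); rewrite -A'k -(eq_bigcap_seq A'E) -bigcap_cons.
    by rewrite (_ : [set` k :: s1 ++ s2] = [set` s1 ++ k :: s2])//;
      apply/seteqP; split => j /=; rewrite (perm_mem perm).
  + move=> j j1; rewrite A'E ?mem_cat ?j1//.
    by apply: HA1; rewrite in_cons j1 orbT.
  + move=> j; rewrite in_cons => /orP[/eqP->|j2]; first by rewrite A'k.
    by rewrite A'E ?mem_cat ?j2 ?orbT//; exact: HA2.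
- move=> _; rewrite /= /mrestr setTI.
  by rewrite (le_lt_trans (probability_le1 _ _)) ?ltry.
Qed.

Lemma group_independent : mutually_independent P group_sigma.
Proof.
move=> s A us HA; have := @group_independent_split s [::] A.
by rewrite cats0; apply.
Qed.

End grouping.

Lemma mutually_independentW d (Omega : measurableType d) (R : realType)
    (P : probability Omega R) (I : eqType) (F G : I -> set_system Omega) :
  (forall i, F i `<=` G i) -> mutually_independent P G ->
  mutually_independent P F.
Proof. by move=> FG HG s A us HA; apply: HG => // i si; exact/FG/HA. Qed.

Lemma mutually_independent_comp d (Omega : measurableType d) (R : realType)
    (P : probability Omega R) (I J : eqType) (h : J -> I)
    (F : I -> set_system Omega) : injective h ->
  mutually_independent P F -> mutually_independent P (F \o h).
Proof.
move=> hinj HF [|j0 s'] A.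
  by rewrite bigcap_seq0 big_nil probability_setT.
move: (j0 :: s') => s us HA.
(* [A] is indexed by [J] and has to be pulled back to [I]; [hV] inverts [h] on [s] only, with [j0]
   as the default of [nth]. *)
pose hV i := nth j0 s (find (fun j => h j == i) s).
have hVK j : j \in s -> hV (h j) = j.
  move=> js; apply: hinj; apply/eqP; rewrite /hV.
  by apply: (@nth_find _ j0 (fun j' => h j' == h j)); apply/hasP; exists j.
have := HF (map h s) (fun i => A (hV i)).
rewrite map_inj_uniq// => /(_ us).
rewrite big_map (eq_big_seq (fun j => P (A j))); last by move=> j /hVK ->.
move=> <-.
  congr (P _); apply/seteqP; split=> [x X i /= /mapP[j js ->]|x X j /= js].
    by rewrite hVK//; exact: X.
  by rewrite -(hVK j js); apply: X => /=; exact: map_f.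
by move=> i /mapP[j js ->]; rewrite hVK//; exact: HA.
Qed.

(** * Densities and independent pairs *)

Lemma measure_integral_indic d (T : measurableType d) (R : realType)
    (mu : {measure set T -> \bar R}) (X : set T) : measurable X ->
  mu X = (\int[mu]_x (\1_X x)%:E)%E.
Proof. by move=> mX; rewrite integral_indic// setIT. Qed.

(** Change of variables along the Radon-Nikodym derivative of [nu], which agrees with [f] almost
    everywhere because both have the same integral over every measurable set. *)
Lemma ge0_integral_density d (T : measurableType d) (R : realType)
    (m : {sigma_finite_measure set T -> \bar R})
    (nu : {finite_measure set T -> \bar R}) (f : T -> R) (h : T -> \bar R) :
  measurable_fun setT f -> (forall x, 0 <= f x) ->
  (forall U, measurable U -> nu U = (\int[m]_(x in U) (f x)%:E)%E) ->
  measurable_fun setT h -> (forall x, (0 <= h x)%E) ->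
  (\int[nu]_x h x = \int[m]_x (h x * (f x)%:E))%E.
Proof.
move=> mf f0 nuE mh h0.
have num : nu `<< m.
  apply/null_content_dominatesP => U mU mU0; rewrite nuE//.
  by apply: null_set_integral => //; apply/measurable_EFinP/measurable_funTS.
rewrite -(Radon_Nikodym_SigmaFinite.change_of_variables num)//.
have intf := Radon_Nikodym_SigmaFinite.f_integrable num.
have mg := measurable_int _ intf.
apply: ae_eq_integral => //.
- exact: emeasurable_funM.
- by apply: emeasurable_funM => //; exact/measurable_EFinP.
apply: ae_eqe_mul2l; apply: integral_ae_eq => //.
  exact/measurable_EFinP.
move=> U _ mU.
by rewrite -nuE// -Radon_Nikodym_SigmaFinite.f_integral.
Qed.

Lemma ge0_integral_law_density d (Omega : measurableType d) (R : realType)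
    (P : probability Omega R) (X : Omega -> R) (f : R -> R) (h : R -> \bar R) :
  measurable_fun setT X -> measurable_fun setT f -> (forall x, 0 <= f x) ->
  (forall U, measurable U ->
    P (X @^-1` U) = (\int[lebesgue_measure]_(x in U) (f x)%:E)%E) ->
  measurable_fun setT h -> (forall x, (0 <= h x)%E) ->
  (\int[P]_w h (X w) = \int[lebesgue_measure]_x (h x * (f x)%:E))%E.
Proof.
move=> mX mf f0 XE mh h0.
pose X' : {mfun Omega >-> measurableTypeR R} :=
  HB.pack (X : Omega -> measurableTypeR R)
    (isMeasurableFun.Build _ _ Omega (measurableTypeR R) X mX).
rewrite -(@ge0_integral_density _ _ R lebesgue_measure
  (distribution P X') f h mf f0 XE mh h0).
by rewrite (ge0_integral_distribution (X' : {RV P >-> measurableTypeR R}) mh h0).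
Qed.

Section independent_pair.
Context d d1 d2 (Omega : measurableType d) (T1 : measurableType d1)
  (T2 : measurableType d2) (R : realType) (P : probability Omega R).
Variables (X : {mfun Omega >-> T1}) (Y : {mfun Omega >-> T2}).
Hypothesis XY : forall A B, measurable A -> measurable B ->
  P (X @^-1` A `&` Y @^-1` B) = (P (X @^-1` A) * P (Y @^-1` B))%E.

(** Independence on rectangles identifies the joint law with the product of the two laws; the rest
    is Tonelli. *)
Lemma ge0_integral_independent (h : T1 * T2 -> \bar R) :
  measurable_fun setT h -> (forall z, (0 <= h z)%E) ->
  (\int[P]_w h (X w, Y w) = \int[P]_w \int[P]_w' h (X w, Y w'))%E.
Proof.
move=> mh h0.
have mXY : measurable_fun setT (fun w => (X w, Y w)).
  by apply: measurable_fun_pair.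
pose Z : {mfun Omega >-> (T1 * T2)%type} :=
  HB.pack (fun w => (X w, Y w)) (isMeasurableFun.Build _ _ _ _ _ mXY).
rewrite -[LHS](ge0_integral_distribution (Z : {RV P >-> (T1 * T2)%type}) mh h0).
transitivity (\int[distribution P X \x distribution P Y]_z h z)%E.
  apply: eq_measure_integral => A mA _; apply/esym.
  apply: (@product_measure_unique _ _ _ _ _ (distribution P X)
    (distribution P Y) (distribution P Z)) => //.
rewrite fubini_tonelli1//.
rewrite (@ge0_integral_distribution _ _ _ _ _ P X (fubini_F (distribution P Y) h))//.
- apply: eq_integral => w _; apply: ge0_integral_distribution => //.
  by apply: (measurableT_comp mh); exact: measurable_fun_pair.
- exact: measurable_fun_fubini_tonelli_F.
- by move=> x; apply: integral_ge0.
Qed.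

End independent_pair.

Lemma sigma_of_measurable d (T : measurableType d) (R : realType) (X : T -> R) :
  measurable_fun setT X -> sigma_of X `<=` measurable.
Proof. by move=> mX _ [B mB <-]; exact: mX. Qed.

Lemma sigma_of_setI_closed d (T : measurableType d) (R : realType)
  (X : T -> R) : setI_closed (sigma_of X).
Proof.
move=> _ _ [A mA <-] [B mB <-]; exists (A `&` B); first exact: measurableI.
by rewrite preimage_setI setIIr.
Qed.

Lemma g_sigma_measurable_fun d (T : measurableType d) (R : realType)
    (G : set_system T) (X : T -> R) : sigma_of X `<=` G ->
  measurable_fun setT (X : g_sigma_algebraType G -> R).
Proof.
by move=> XG _ U mU; apply: sub_gen_smallest; apply: XG; exists U.
Qed.

Lemma sigma_of_sub_group (d : measure_display) (T : measurableType d)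
    (R : realType) (I : eqType) (D : set I) (F : I -> set_system T)
    (X : T -> R) (mX : (measurable_fun setT
      (X : g_sigma_algebraType (\bigcup_(i in D) F i) -> R))) :
  sigma_of X `<=` <<s \bigcup_(i in D) F i >>.
Proof. by move=> _ [B mB <-]; exact: mX. Qed.

(** * Takacs' formula for the idle probability *)

Section iterated_sum.
Context d (Omega : measurableType d) (R : realType) (P : probability Omega R).
Variable V : Omega -> R.
Hypotheses (V_ge0 : forall x, 0 <= V x) (mV : measurable_fun setT V).
Local Open Scope ereal_scope.

(* [iter_sum k h] is the expectation of [h] at the sum of [k] independent copies
   of [V]. *)
Fixpoint iter_sum (k : nat) (h : R -> \bar R) : \bar R :=
  if k is k'.+1 then \int[P]_x iter_sum k' (fun y => h (V x + y)%R) else h 0%R.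

Lemma iter_sumS k h :
  iter_sum k.+1 h = \int[P]_x iter_sum k (fun y => h (V x + y)%R).
Proof. by []. Qed.

Lemma iter_sum_ge0 k h : (forall y, (0 <= y)%R -> 0 <= h y) ->
  0 <= iter_sum k h.
Proof.
elim: k h => [|k IH] h h0 /=; first exact: h0.
by apply: integral_ge0 => x _; apply: IH => y y0; rewrite h0// addr_ge0.
Qed.

Lemma eq_iter_sum k h1 h2 : (forall y, (0 <= y)%R -> h1 y = h2 y) ->
  iter_sum k h1 = iter_sum k h2.
Proof.
elim: k h1 h2 => [|k IH] h1 h2 h12 /=; first exact: h12.
by apply: eq_integral => x _; apply: IH => y y0; rewrite h12// addr_ge0.
Qed.

Lemma measurable_shift d' (T : measurableType d') (h : T * R -> \bar R) :
  measurable_fun setT h ->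
  measurable_fun setT (fun z : (T * Omega) * R => h (z.1.1, V z.1.2 + z.2)%R).
Proof.
move=> mh; apply: (measurableT_comp mh); apply: measurable_fun_pair.
  exact: measurableT_comp.
apply: measurable_funD => //; apply: (measurableT_comp mV).
exact: measurableT_comp.
Qed.

(** The parameter space [T] is general because each induction step adjoins a copy of [Omega] to
    it. *)
Lemma measurable_iter_sum k d' (T : measurableType d') (h : T * R -> \bar R) :
  measurable_fun setT h -> (forall z, 0 <= h z) ->
  measurable_fun setT (fun t => iter_sum k (fun y => h (t, y))).
Proof.
elim: k d' T h => [|k IH] d' T h mh h0 /=.
  by apply: (measurableT_comp mh); exact: measurable_fun_pair.
have := IH _ _ _ (measurable_shift mh) (fun=> h0 _).
move=> /(measurable_fun_fubini_tonelli_F (m2 := P)); apply.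
by move=> z; apply: iter_sum_ge0.
Qed.

Lemma iter_sum_integral k d' (T : measurableType d')
    (nu : {sigma_finite_measure set T -> \bar R}) (h : T * R -> \bar R) :
  measurable_fun setT h -> (forall z, 0 <= h z) ->
  \int[nu]_t iter_sum k (fun y => h (t, y)) =
  iter_sum k (fun y => \int[nu]_t h (t, y)).
Proof.
elim: k h => [//|k IH] h mh h0 /=.
rewrite (@fubini_tonelli _ _ _ _ _ nu P
  (fun z => iter_sum k (fun y => h (z.1, V z.2 + y)%R)))/=.
- apply: eq_integral => x _; rewrite (IH (fun z => h (z.1, V x + z.2)%R))//.
  apply: (measurableT_comp mh); apply: measurable_fun_pair => //.
  by apply: measurable_funD => //.
- exact: (measurable_iter_sum _ (measurable_shift mh)).
- by move=> z; exact: iter_sum_ge0.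
Qed.

Lemma measurable_iter_sum1 k (h : R -> \bar R) : measurable_fun setT h ->
  (forall y, 0 <= h y) ->
  measurable_fun setT (fun x => iter_sum k (fun y => h (V x + y)%R)).
Proof.
move=> mh h0; apply: (measurable_iter_sum k (h := fun z => h (V z.1 + z.2)%R)) => //.
apply: (measurableT_comp mh); apply: measurable_funD => //.
exact: (measurableT_comp mV).
Qed.

Lemma measurable_shift1 (h : R -> \bar R) (c : R) : measurable_fun setT h ->
  measurable_fun setT (fun y => h (c + y)%R).
Proof. by move=> mh; apply: (measurableT_comp mh); exact: measurable_funD. Qed.

Lemma iter_sumD k h1 h2 :
  measurable_fun setT h1 -> (forall y, 0 <= h1 y) ->
  measurable_fun setT h2 -> (forall y, 0 <= h2 y) ->
  iter_sum k (fun y => h1 y + h2 y) = iter_sum k h1 + iter_sum k h2.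
Proof.
elim: k h1 h2 => [//|k IH] h1 h2 m1 h10 m2 h20 /=.
rewrite -ge0_integralD//.
- by apply: eq_integral => x _; rewrite IH//; exact: measurable_shift1.
- by move=> x _; exact: iter_sum_ge0.
- exact: measurable_iter_sum1.
- by move=> x _; exact: iter_sum_ge0.
- exact: measurable_iter_sum1.
Qed.

Lemma iter_sumZ k (c : R) h : (0 <= c)%R ->
  measurable_fun setT h -> (forall y, 0 <= h y) ->
  iter_sum k (fun y => c%:E * h y) = c%:E * iter_sum k h.
Proof.
move=> c0; elim: k h => [//|k IH] h mh h0 /=.
rewrite -ge0_integralZl_EFin//.
- by apply: eq_integral => x _; rewrite IH//; exact: measurable_shift1.
- by move=> x _; exact: iter_sum_ge0.
- exact: measurable_iter_sum1.
Qed.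

Lemma le_iter_sum k (h1 h2 : R -> \bar R) :
  measurable_fun setT h1 -> (forall y, 0 <= h1 y) ->
  measurable_fun setT h2 -> (forall y, 0 <= h2 y) ->
  (forall y, (0 <= y)%R -> h1 y <= h2 y) ->
  iter_sum k h1 <= iter_sum k h2.
Proof.
elim: k h1 h2 => [|k IH] h1 h2 m1 h10 m2 h20 h12 /=; first exact: h12.
apply: ge0_le_integral => //.
- by move=> x _; exact: iter_sum_ge0.
- exact: measurable_iter_sum1.
- exact: measurable_iter_sum1.
- move=> x _; apply: IH => //; [exact: measurable_shift1..|].
  by move=> y y0; rewrite h12// addr_ge0.
Qed.

Lemma iter_sum_cst k (c : R) : iter_sum k (fun=> c%:E) = c%:E.
Proof.
elim: k => [//|k IH] /=; under eq_integral do rewrite IH.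
by rewrite integral_cst//= probability_setT mule1.
Qed.

(** [|z|] stands for z at sums of nonnegative service times and keeps the integrand nonnegative on
    the whole line. *)
Lemma measurable_abse_mul (h : R -> \bar R) : measurable_fun setT h ->
  measurable_fun setT (fun z : R => `|z|%:E * h z).
Proof.
by move=> mh; apply: emeasurable_funM => //; exact: measurableT_comp.
Qed.

(* By exchangeability all [k.+1] summands contribute equally. *)
Lemma iter_sum_exchangeable k h : measurable_fun setT h ->
  (forall y, 0 <= h y) ->
  iter_sum k.+1 (fun z => `|z|%:E * h z) =
  k.+1%:R%:E * \int[P]_x ((V x)%:E * iter_sum k (fun y => h (V x + y)%R)).
Proof.
elim: k h => [|k IH] h mh h0.
  by rewrite mul1e; apply: eq_integral => x _; rewrite /= addr0 ger0_norm.
have mint k' h' : measurable_fun setT h' -> (forall y, 0 <= h' y) ->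
    measurable_fun setT
      (fun x => (V x)%:E * iter_sum k' (fun y => h' (V x + y)%R)).
  move=> mh' h'0; apply: emeasurable_funM; first exact/measurable_EFinP.
  exact: measurable_iter_sum1.
have int0 k' h' : (forall y, 0 <= h' y) -> forall x, setT x ->
    0 <= (V x)%:E * iter_sum k' (fun y => h' (V x + y)%R).
  by move=> h'0 x _; rewrite mule_ge0 ?lee_fin// iter_sum_ge0.
(* One share of the [k.+2] is that of the first summand; the induction hypothesis, applied to the
   shifted function, provides the others. *)
rewrite -[k.+2%:R]/(1 + k.+1%:R)%R EFinD ge0_muleDl// mul1e.
transitivity (\int[P]_x ((V x)%:E * iter_sum k.+1 (fun y => h (V x + y)%R) +
    iter_sum k.+1 (fun y => `|y|%:E * h (V x + y)%R))).
  rewrite iter_sumS; apply: eq_integral => x _.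
  rewrite -iter_sumZ//; last exact: measurable_shift1.
  rewrite -iter_sumD//.
  - apply: eq_iter_sum => y y0.
    by rewrite !ger0_norm ?addr_ge0// EFinD ge0_muleDl ?lee_fin.
  - by apply: emeasurable_funM => //; exact: measurable_shift1.
  - by move=> y; rewrite mule_ge0 ?lee_fin.
  - by apply: measurable_abse_mul; exact: measurable_shift1.
  - by move=> y; rewrite mule_ge0 ?lee_fin.
rewrite ge0_integralD//; last 4 first.
- exact: int0.
- exact: mint.
- by move=> x _; apply: iter_sum_ge0 => y _; rewrite mule_ge0 ?lee_fin.
- apply: (measurable_iter_sum k.+1
    (h := fun z => `|z.2|%:E * h (V z.1 + z.2)%R)).
  + apply: emeasurable_funM; first by apply/measurable_EFinP; exact: measurableT_comp.
    apply: (measurableT_comp mh); apply: measurable_funD => //.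
    exact: (measurableT_comp mV).
  + by move=> z; rewrite mule_ge0 ?lee_fin.
congr (_ + _).
transitivity (\int[P]_x (k.+1%:R%:E * \int[P]_x' ((V x')%:E *
    iter_sum k (fun y => h (V x + (V x' + y))%R)))).
  by apply: eq_integral => x _; rewrite IH//; exact: measurable_shift1.
have mVV : measurable_fun setT (fun z : Omega * Omega =>
    (V z.2)%:E * iter_sum k (fun y => h (V z.1 + (V z.2 + y))%R)).
  apply: emeasurable_funM.
    by apply/measurable_EFinP; exact: (measurableT_comp mV).
  apply: (measurable_iter_sum k
    (h := fun w : (Omega * Omega) * R => h (V w.1.1 + (V w.1.2 + w.2))%R)) => //.
  apply: (measurableT_comp mh); apply: measurable_funD => /=.
    by apply: (measurableT_comp mV); exact: measurableT_comp.
  apply: measurable_funD => //=.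
  by apply: (measurableT_comp mV); exact: measurableT_comp.
have VV0 z : 0 <= (V z.2)%:E *
    iter_sum k (fun y => h (V z.1 + (V z.2 + y))%R).
  by rewrite mule_ge0 ?lee_fin// iter_sum_ge0.
rewrite ge0_integralZl_EFin//; last 2 first.
- by move=> x _; apply: integral_ge0 => x' _; exact: (VV0 (x, x')).
- exact: (measurable_fun_fubini_tonelli_F (m2 := P) _ mVV VV0).
(* The share of a later summand equals that of the first: Tonelli swaps the two copies of [Omega]
   and [addrCA] the two terms. *)
congr (_ * _); rewrite (fubini_tonelli _ mVV VV0).
apply: eq_integral => x' _; rewrite iter_sumS -ge0_integralZl//=.
- apply: eq_integral => x _; congr (_ * _).
  by apply: eq_iter_sum => y _; rewrite addrCA.
- by apply: (measurable_iter_sum1 k (h := fun z => h (V x' + z)%R)) => //;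
    exact: measurable_shift1.
- by move=> x _; apply: iter_sum_ge0.
- by rewrite lee_fin.
Qed.

End iterated_sum.

Arguments iter_sum : simpl never.

Lemma integral_deriv_poly (R : realType) (p : {poly R}) (a b : R) : a <= b ->
  (\int[lebesgue_measure]_(x in `[a, b]) (p^`().[x])%:E =
   (p.[b] - p.[a])%:E)%E.
Proof.
rewrite le_eqVlt => /predU1P[->|ab].
  by rewrite set_itv1 integral_set1 subrr.
rewrite (@continuous_FTC2 _ (horner p^`()) (horner p))//.
- by apply: continuous_subspaceT; exact: continuous_horner.
- split; first by move=> x _; exact: derivable_horner.
  + by apply: cvg_at_right_filter; exact: continuous_horner.
  + by apply: cvg_at_left_filter; exact: continuous_horner.
- by move=> x _; rewrite derivE.
Qed.

(** * Ballot weights and the backward equation of the queue *)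

Section takacs.
Context d (Omega : measurableType d) (R : realType) (P : probability Omega R).
Variable V : Omega -> R.
Hypotheses (V_ge0 : forall x, 0 <= V x) (mV : measurable_fun setT V).
Variables (lam u : R).
Hypothesis lam_ge0 : 0 <= lam.

(* Takacs' ballot theorem: [expR (- lam * r) * weight k r y] is the probability
   that [k] requests arrive during [r] units of time and leave the server idle
   at the end, given that their exchangeable service times add up to [y]. *)
Definition weight (k : nat) (r y : R) : R :=
  if k is k'.+1 then lam ^+ k * (r ^+ k' * (r - y)) / k`!%:R else 1.

(** The derivative of [weight k.+1 r z] in [r]. It is also [lam] times the mean of
    [weight k r (z - V_1)] given that [k.+1] exchangeable service times add up to [z], the mean of
    V_1 being z / k.+1. The equality of the two readings is the ballot theorem in differential
    form. *)
Definition dweight (k : nat) (r z : R) : R :=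
  if k is k'.+1 then
    lam ^+ k.+1 * (r ^+ k' * (r - z) + r ^+ k' * (z / k.+1%:R)) / k`!%:R
  else lam.

Lemma integral_dweight k (c z : R) : z <= c ->
  (\int[lebesgue_measure]_(g in `[0%R, (c - z)%R]) (dweight k (c - g) z)%:E =
   (weight k.+1 c z)%:E)%E.
Proof.
move=> zc.
pose a0 : R := lam ^+ k.+1 / k.+1`!%:R.
(* As a polynomial in the gap [g], this is [- weight k.+1 (c - g) z]; it vanishes at g = c - z. *)
pose p : {poly R} := - (a0 *: ((c%:P - 'X) ^+ k * ((c - z)%:P - 'X))).
have k1 : k.+1`!%:R != 0 :> R by rewrite pnatr_eq0 -lt0n fact_gt0.
transitivity (\int[lebesgue_measure]_(g in `[0%R, (c - z)%R]) (p^`().[g])%:E)%E.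
  apply: eq_integral => g _; congr EFin.
  rewrite /p !poly.derivE !deriv_exp !poly.derivE !hornerE hornerMn !hornerE /a0 /dweight.
  case: k a0 p k1 => [|k] a0 p k1 /=; 
    first by rewrite expr0 mulr0n expr1 (_ : 1`! = 1)%N// divr1; ring.
  have k0 : k.+1`!%:R != 0 :> R by rewrite pnatr_eq0 -lt0n fact_gt0.
  have k2 : k.+2%:R != 0 :> R by rewrite pnatr_eq0.
  have k3 : k.+2%:R = k.+1%:R + 1 :> R by rewrite natr1.
  have k4 : k.+2`!%:R = k.+2%:R * k.+1`!%:R :> R by rewrite factS natrM.
  rewrite k4 -(mulr_natr _ k.+1) (exprSr (c - g)); rewrite k3 in k2 *.
  move: (lam ^+ k.+2) ((c - g) ^+ k) (k.+1%:R : R) (k.+1`!%:R : R) k2 k0.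
  move=> L r K F K1 F0; field.
  by rewrite K1 F0.
rewrite integral_deriv_poly ?subr_ge0//; congr EFin.
rewrite /p !hornerE /= subrr !(mulr0, oppr0, subr0, sub0r, opprK, add0r, addr0).
by rewrite /a0; field.
Qed.

(** Here [z] is the pair of the last arrival epoch a and the last departure epoch b, and [y] the
    total of [k] further service times. The server is idle at [u] iff b + y <= u and a queue that
    starts empty at a and gets the same further requests is idle at [u]; the latter has probability
    [expR (- lam * (u - a)) * weight k (u - a) y]. The factor [expR (- lam * u)], common to all
    terms, is left out. *)
Definition summand (k : nat) (z : R * R) (y : R) : R :=
  if [&& 0 <= y, z.2 + y <= u & z.1 + y <= u] then
    expR (lam * z.1) * weight k (u - z.1) y else 0.

Definition weighted_sum (k : nat) (z : R * R) : \bar R :=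
  iter_sum P V k (fun y => (summand k z y)%:E).

Lemma weight_ge0 k r y : 0 <= y -> y <= r -> 0 <= weight k r y.
Proof.
move=> y0 yr; case: k => [//|k] /=.
have r0 : 0 <= r by exact: le_trans yr.
by rewrite divr_ge0// !mulr_ge0 ?exprn_ge0 ?subr_ge0.
Qed.

Lemma dweight_ge0 k r y : 0 <= y -> y <= r -> 0 <= dweight k r y.
Proof.
move=> y0 yr; case: k => [//|k] /=.
have r0 : 0 <= r by exact: le_trans yr.
rewrite divr_ge0// mulr_ge0 ?exprn_ge0// addr_ge0// mulr_ge0 ?exprn_ge0//.
  by rewrite subr_ge0.
by rewrite divr_ge0.
Qed.

Lemma measurable_weight k d' (T : measurableType d') (r y : T -> R) :
  measurable_fun setT r -> measurable_fun setT y ->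
  measurable_fun setT (fun t => weight k (r t) (y t)).
Proof.
move=> mr my; case: k => [|k] /=; first exact: measurable_cst.
apply: measurable_funM => //; apply: measurable_funM => //.
apply: measurable_funM; first exact: measurable_funX.
exact: measurable_funB.
Qed.

Lemma measurable_dweight k d' (T : measurableType d') (r y : T -> R) :
  measurable_fun setT r -> measurable_fun setT y ->
  measurable_fun setT (fun t => dweight k (r t) (y t)).
Proof.
move=> mr my; case: k => [|k] /=; first exact: measurable_cst.
apply: measurable_funM => //; apply: measurable_funM => //.
apply: measurable_funD; apply: measurable_funM; try exact: measurable_funX.
  exact: measurable_funB.
exact: measurable_funM.
Qed.

Lemma summand_ge0 k z y : 0 <= summand k z y.
Proof.
rewrite /summand; case: ifPn => // /and3P[y0 _ ay].
by rewrite mulr_ge0 ?expR_ge0// weight_ge0// lerBrDl.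
Qed.

Lemma measurable_summand k d' (T : measurableType d') (z : T -> R * R)
    (y : T -> R) : measurable_fun setT z -> measurable_fun setT y ->
  measurable_fun setT (fun t => summand k (z t) (y t)).
Proof.
move=> mz my.
have mz1 : measurable_fun setT (fun t => (z t).1) by exact: measurableT_comp.
have mz2 : measurable_fun setT (fun t => (z t).2) by exact: measurableT_comp.
apply: measurable_fun_ifT => //.
  apply: measurable_and; first exact: measurable_fun_ler.
  apply: measurable_and; apply: measurable_fun_ler => //;
    exact: measurable_funD.
apply: measurable_funM.
  by apply: (measurableT_comp (@measurable_expR R)); exact: measurable_funM.
by apply: measurable_weight => //; exact: measurable_funB.
Qed.

Lemma measurable_weighted_sum k : measurable_fun setT (weighted_sum k).
Proof.
apply: (measurable_iter_sum P V_ge0 mV k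
  (h := fun w : (R * R) * R => (summand k w.1 w.2)%:E)).
  by apply/measurable_EFinP; apply: measurable_summand.
by move=> w; rewrite lee_fin summand_ge0.
Qed.

Lemma weighted_sum_ge0 k z : (0 <= weighted_sum k z)%E.
Proof. by apply: iter_sum_ge0 => // y y0; rewrite lee_fin summand_ge0. Qed.

(* One step of the Markov chain of arrival and departure epochs. *)
Lemma weighted_sum_step k (z : R * R) : 0 < lam ->
  (\int[lebesgue_measure]_g ((\int[P]_x weighted_sum k
     (z.1 + g, Num.max (z.1 + g) z.2 + V x)%R) * (exponential_pdf lam g)%:E) =
   weighted_sum k.+1 z)%E.
Proof.
move: z => [a b] lam_gt0 /=.
pose c := u - a.
(* the joint integrand after the substitution z = V x + y *)
pose th (g w : R) : R :=
  if [&& 0 <= g, 0 <= w, b + w <= u & a + g + w <= u] then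
    expR (lam * a) * dweight k (c - g) w else 0.
have mth : measurable_fun setT (fun gw : R * R => (th gw.1 gw.2)%:E).
  apply/measurable_EFinP; apply: measurable_fun_ifT => //.
    apply: measurable_and; first exact: measurable_fun_ler.
    apply: measurable_and; first exact: measurable_fun_ler.
    apply: measurable_and; apply: measurable_fun_ler => //.
      by apply: measurable_funD.
    by apply: measurable_funD => //; apply: measurable_funD.
  apply: measurable_funM => //; apply: measurable_dweight => //.
  by apply: measurable_funB.
have th0 g w : 0 <= th g w.
  rewrite /th; case: ifPn => // /and4P[g0 w0 _ agw].
  by rewrite mulr_ge0 ?expR_ge0// dweight_ge0// /c; lra.
transitivity (\int[lebesgue_measure]_g
    iter_sum P V k.+1 (fun w => (th g w)%:E))%E.
  apply: eq_integral => g _.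
  have [g0|g0] := ltP g 0.
    rewrite lt0_exponential_pdf// mule0
      (eq_iter_sum P V_ge0 k.+1 (h2 := fun=> 0%:E)) ?iter_sum_cst//.
    by move=> y y0; rewrite /th leNgt g0.
  rewrite exponential_pdfE// muleC.
  pose C (w : R) := [&& 0 <= w, b + w <= u & a + g + w <= u].
  have mC : measurable_fun setT C.
    apply: measurable_and; first exact: measurable_fun_ler.
    by apply: measurable_and; apply: measurable_fun_ler => //;
      apply: measurable_funD.
  have mxW : measurable_fun setT (fun x =>
      weighted_sum k ((a + g)%R, (Num.max (a + g) b + V x)%R)).
    apply: (measurableT_comp (measurable_weighted_sum k)).
    by apply: measurable_fun_pair => //; exact: measurable_funD.
  rewrite -ge0_integralZl_EFin//; last 2 first.
  - by move=> x _; exact: weighted_sum_ge0.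
  - by rewrite mulr_ge0 ?expR_ge0.
  transitivity (\int[P]_x iter_sum P V k (fun y =>
      (if C (V x + y) then lam * expR (lam * a) * weight k (c - g) y else 0)%:E))%E.
    apply: eq_integral => x _; rewrite -iter_sumZ//.
    - apply: eq_iter_sum => // y y0; rewrite -EFinM; congr EFin.
      rewrite /summand/= /C y0 addr_ge0//= -addrA.
      (* After the step the work left is y, but as [V x] is nonnegative its bound a + g + y <= u is
         implied by the one on V x + y that comes from the maximum. *)
      have -> : (Num.max (a + g) b + (V x + y) <= u) && (a + g + y <= u) =
          (b + (V x + y) <= u) && (a + g + (V x + y) <= u).
        rewrite -lerBrDr ge_max !lerBrDr; have := V_ge0 x.
        by do 3 case: leP => //=; lra.
      case: ifPn => _; last by rewrite mulr0.
      rewrite mulrDr expRD mulNr /c opprD addrA expRN.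
      by field; rewrite gt_eqF// expR_gt0.
    - by rewrite mulr_ge0 ?expR_ge0.
    - by apply/measurable_EFinP; apply: measurable_summand.
    - by move=> y; rewrite lee_fin summand_ge0.
  have C0 w : C w -> 0 <= w /\ w <= c - g.
    by move=> /and3P[w0 _ gw]; split=> //; rewrite /c; lra.
  have lamA0 : 0 <= lam * expR (lam * a) by rewrite mulr_ge0 ?expR_ge0.
  have thC w : th g w = if C w then expR (lam * a) * dweight k (c - g) w else 0.
    by rewrite /th g0.
  rewrite (eq_iter_sum P V_ge0 k.+1 (h2 := fun w =>
    (if C w then expR (lam * a) * dweight k (c - g) w else 0)%:E)); last first.
    by move=> w _; rewrite thC.
  clear th mth th0 thC mxW; case: k => [|k].
    rewrite iter_sumS; apply: eq_integral => x _; rewrite /iter_sum.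
    by case: ifP => //= _; rewrite mulr1 mulrC.
  (* [A] and w * B / k.+2 are the two terms of [dweight]. Over the total w of [k.+2] service times,
     [iter_sum_exchangeable] turns the second into V x * B, which together with [A] is the weight of
     the remaining work w - V x. *)
  pose A w := if C w then
    expR (lam * a) * (lam ^+ k.+2 * ((c - g) ^+ k * (c - g - w)) / k.+1`!%:R)
    else 0.
  pose B w := if C w then
    expR (lam * a) * (lam ^+ k.+2 * (c - g) ^+ k / k.+1`!%:R) else 0.
  have A0 w : 0 <= A w.
    rewrite /A; case: ifPn => // /C0[w0 wc].
    have cg : 0 <= c - g by exact: le_trans wc.
    have cgw : 0 <= c - g - w by rewrite subr_ge0.
    rewrite mulr_ge0 ?expR_ge0//; apply: divr_ge0 => //.
    by apply: mulr_ge0; [exact: exprn_ge0|apply: mulr_ge0 => //; exact: exprn_ge0].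
  have B0 w : 0 <= B w.
    rewrite /B; case: ifPn => // /C0[w0 wc].
    have cg : 0 <= c - g by exact: le_trans wc.
    rewrite mulr_ge0 ?expR_ge0//; apply: divr_ge0 => //.
    by apply: mulr_ge0; exact: exprn_ge0.
  have mA : measurable_fun setT A.
    apply: measurable_fun_ifT => //; apply: measurable_funM => //.
    apply: measurable_funM => //; apply: measurable_funM => //.
    by apply: measurable_funM => //; apply: measurable_funB.
  have mB : measurable_fun setT B by apply: measurable_fun_ifT.
  have mA' : measurable_fun setT (fun w => (A w)%:E) by exact/measurable_EFinP.
  have mB' : measurable_fun setT (fun w => (B w / k.+2%:R)%:E).
    by apply/measurable_EFinP; exact: measurable_funM.
  have B'0 w : (0 <= (B w / k.+2%:R)%:E)%E by rewrite lee_fin divr_ge0.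
  have mVB : measurable_fun setT (fun x =>
      ((V x)%:E * iter_sum P V k.+1 (fun y => (B (V x + y) / k.+2%:R)%:E))%E).
    by apply: emeasurable_funM; [exact/measurable_EFinP|
      exact: (measurable_iter_sum1 P V_ge0 mV k.+1 mB')].
  have VB0 x : (0 <=
      (V x)%:E * iter_sum P V k.+1 (fun y => (B (V x + y) / k.+2%:R)%:E))%E.
    by rewrite mule_ge0 ?lee_fin// iter_sum_ge0.
  have k2 : k.+2%:R != 0 :> R by rewrite pnatr_eq0.
  have k0 : k.+1`!%:R != 0 :> R by rewrite pnatr_eq0 -lt0n fact_gt0.
  rewrite (eq_iter_sum P V_ge0 k.+2
    (h2 := fun w => (A w)%:E + `|w|%:E * (B w / k.+2%:R)%:E)%E); last first.
    move=> w w0; rewrite -EFinM -EFinD; congr EFin.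
    rewrite /A /B; case: ifP => _; last by rewrite mul0r mulr0 addr0.
    rewrite ger0_norm// /dweight.
    move: (k.+2%:R : R) (k.+1`!%:R : R) k2 k0 (lam ^+ _) => K F K0 F0 L; field.
    by rewrite K0 F0.
  rewrite iter_sumD//; last 2 first.
  - exact: measurable_abse_mul.
  - by move=> w; apply: mule_ge0; [rewrite lee_fin|exact: B'0].
  rewrite (iter_sum_exchangeable P V_ge0 mV k.+1 mB')//.
  rewrite -ge0_integralZl_EFin// [in RHS]iter_sumS -ge0_integralD//; last 4 first.
  - by move=> x _; rewrite iter_sum_ge0// => y _; rewrite lee_fin.
  - exact: (measurable_iter_sum1 P V_ge0 mV k.+1 mA').
  - by move=> x _; rewrite mule_ge0// lee_fin.
  - exact: emeasurable_funM.
  apply: eq_integral => x _.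
  have mBx : measurable_fun setT (fun y => (B (V x + y) / k.+2%:R)%:E).
    exact: (measurable_shift1 (V x) mB').
  have mAx : measurable_fun setT (fun y => (A (V x + y))%:E).
    exact: (measurable_shift1 (V x) mA').
  rewrite muleCA -(iter_sumZ P V_ge0 mV k.+1 (ler0n R k.+2) mBx)//.
  rewrite -iter_sumZ//; last 2 first.
  - exact: emeasurable_funM.
  - by move=> y; apply: mule_ge0; [rewrite lee_fin|exact: B'0].
  rewrite -iter_sumD//; last 3 first.
  - by move=> y; rewrite lee_fin.
  - by apply: emeasurable_funM => //; exact: emeasurable_funM.
  - move=> y; apply: mule_ge0; first by rewrite lee_fin.
    by apply: mule_ge0; [rewrite lee_fin|exact: B'0].
  apply: eq_iter_sum => // y y0; rewrite -!EFinM -EFinD; congr EFin.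
  rewrite /A /B; case: ifP => _; last by rewrite mul0r !mulr0 addr0.
  rewrite /weight (exprSr _ k.+1).
  move: (k.+2%:R : R) (k.+1`!%:R : R) k2 k0 (lam ^+ _) => K F K0 F0 L; field.
  by rewrite K0 F0.
(* Tonelli brings the integral over the gap inside; for a fixed total w the condition a + g + w <= u
   confines [g] to [0, c - w], where [integral_dweight] applies. *)
rewrite (iter_sum_integral P V_ge0 mV k.+1 lebesgue_measure
  (h := fun gw => (th gw.1 gw.2)%:E))//; last first.
  by move=> gw; rewrite lee_fin.
rewrite /weighted_sum /summand; apply: eq_iter_sum => // w w0.
rewrite w0/= -/c.
have [bw|bw] := leP (b + w) u; last first.
  rewrite integral0_eq//= => g _; rewrite /th (leNgt (b + w)) bw/=.
  by rewrite !andbF.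
have [aw|aw] := leP (a + w) u; last first.
  rewrite integral0_eq//= => g _; rewrite /th; case: ifPn => // /and4P[g0 _ _ agw].
  by exfalso; lra.
rewrite EFinM -integral_dweight; last by rewrite /c; lra.
rewrite -ge0_integralZl_EFin ?expR_ge0//.
- rewrite integral_mkcond; apply: eq_integral => g _.
  rewrite patchE /th mem_setE in_itv/= w0 bw/= lerBrDl /c.
  rewrite (_ : (a + g + w <= u) = (w + g <= u - a)).
    by case: ifP.
  by apply/idP/idP; lra.
- move=> g /=; rewrite in_itv/= => /andP[g0 gc].
  by rewrite lee_fin dweight_ge0//; lra.
- apply/measurable_funTS/measurable_EFinP; apply: measurable_dweight => //.
  exact: measurable_funB.
Qed.

End takacs.

(** * The M/G/1 queue started empty *)

Section queue_path.
Context d (Omega : measurableType d) (R : realType).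
Variables (A B D : nat -> Omega -> R) (x : Omega).
Hypotheses (ABD : fifo A B D) (gap_ge0 : forall n, 0 <= gap A n x)
  (B_ge0 : forall n, 0 <= B n x).

Lemma arrival_le n m : (n <= m)%N -> A n x <= A m x.
Proof.
move=> /subnK <-; elim: (m - n)%N => [|i IH]; first by rewrite add0n.
by rewrite addSn (le_trans IH)//; have := gap_ge0 (i + n).+1; rewrite /gap subr_ge0.
Qed.

Lemma departure_le n m : (n <= m)%N -> D n x <= D m x.
Proof.
move=> /subnK <-; elim: (m - n)%N => [|i IH]; first by rewrite add0n.
rewrite addSn (le_trans IH)// (ABD x).2.
by rewrite (le_trans (y := Num.max (A (i + n).+1 x) (D (i + n)%N x)))
  ?le_max ?lexx ?orbT// lerDl.
Qed.

Lemma arrival_le_start n : A n x <= D n x - B n x.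
Proof.
case: n => [|n]; first by rewrite (ABD x).1 addrK.
by rewrite (ABD x).2 addrK le_max lexx.
Qed.

Lemma idle_at_before u : u < A 0%N x -> idle_at B D u x.
Proof.
move=> uA n /andP[+ _]; apply/negP; rewrite -ltNge.
by rewrite (lt_le_trans uA)// (le_trans (arrival_le (leq0n n)))// arrival_le_start.
Qed.

(** If [D n] lies beyond [u], the least i with u < D i is in service at [u]: its start is the
    maximum of its arrival, which is at most [A n], and of an earlier departure, which by minimality
    is at most [u]. *)
Lemma idle_atP u n : A n x <= u -> u < A n.+1 x ->
  (idle_at B D u x <-> D n x <= u).
Proof.
move=> An uA; split=> [idle|Dn i].
  have [//|uD] := leP (D n x) u; exfalso.
  have [i Hi imin] := ex_minnP (ex_intro (fun i => u < D i x) n uD).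
  apply: (idle i); rewrite Hi andbT.
  have ilen : (i <= n)%N by exact: imin.
  case: i Hi imin ilen => [|i] Hi imin ilen.
    by rewrite (ABD x).1 addrK (le_trans _ An)// arrival_le.
  rewrite (ABD x).2 addrK ge_max (le_trans (arrival_le ilen))//=.
  by rewrite leNgt; apply/negP => /imin; rewrite ltnn.
have [ni|ni] := leqP i n.
  by rewrite (ltNge u) (le_trans (departure_le ni))// andbF.
move=> /andP[+ _]; apply/negP; rewrite -ltNge (lt_le_trans uA)//.
by rewrite (le_trans (arrival_le ni))// arrival_le_start.
Qed.

(** For negative [y] the window is empty and the event is certain, hence the truncation of [y] at
    0. *)
Lemma no_arrival_before u y : u < A 0%N x ->
  (no_arrival_within A u y x <-> u + Num.max y 0 < A 0%N x).
Proof.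
move=> uA; split=> [noA|uy n].
  have := noA 0%N; rewrite uA/=.
  by rewrite ltNge; have [] := leP y 0 => y0; lra.
apply/negP; rewrite negb_and -!ltNge; apply/orP; right.
have := arrival_le (leq0n n); move: uy; case: (leP y 0) => y0; lra.
Qed.

Lemma no_arrivalP u y n : A n x <= u -> u < A n.+1 x ->
  (no_arrival_within A u y x <-> u + Num.max y 0 < A n.+1 x).
Proof.
move=> An uA; split=> [noA|uy i].
  have := noA n.+1; rewrite uA/=.
  by rewrite ltNge; have [] := leP y 0 => y0; lra.
apply/negP; rewrite negb_and -!ltNge -leNgt.
have [ni|ni] := leqP i n.
  by rewrite (le_trans (arrival_le ni)).
apply/orP; right.
have := arrival_le ni; move: uy; case: (leP y 0) => y0; lra.
Qed.

End queue_path.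

(** The measurable space is a parameter: it is instantiated with sigma-algebras generated by part of
    the gaps and service times, to show that the state depends on nothing else. For the same reason
    measurability is assumed only up to [n]. *)
Lemma measurable_state d (T : measurableType d) (R : realType)
    (A B D : nat -> T -> R) n : fifo A B D ->
  (forall i, (i <= n)%N -> measurable_fun setT (gap A i)) ->
  (forall i, (i <= n)%N -> measurable_fun setT (B i)) ->
  measurable_fun setT (A n) /\ measurable_fun setT (D n).
Proof.
move=> ABD; elim: n => [|n IH] mA mB.
  have mA0 : measurable_fun setT (A 0%N) by exact: (mA 0%N).
  split => //; rewrite (_ : D 0%N = A 0%N \+ B 0%N); last first.
    by apply/funext => x /=; rewrite (ABD x).1.
  by apply: measurable_funD => //; exact: mB.
have [|//|mAn mDn] := IH.
- by move=> i ni; apply: mA; rewrite ltnW.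
- by move=> i ni; apply: mB; rewrite ltnW.
have mAS : measurable_fun setT (A n.+1).
  rewrite (_ : A n.+1 = A n \+ gap A n.+1).
    by apply: measurable_funD => //; exact: mA.
  by apply/funext => x /=; rewrite addrC subrK.
split => //; rewrite (_ : D n.+1 = (A n.+1 \max D n) \+ B n.+1); last first.
  by apply/funext => x /=; rewrite (ABD x).2.
by apply: measurable_funD; [exact: measurable_maxr|exact: mB].
Qed.

Lemma exponential_prob_itvoy (R : realType) (rate c : R) : 0 < rate -> 0 <= c ->
  exponential_prob rate `]c, +oo[ = (expR (- rate * c))%:E.
Proof.
move=> r0 c0; rewrite /exponential_prob integral_itv_obnd_cbnd; last first.
  by apply/measurable_funTS/measurable_EFinP; exact: measurable_exponential_pdf.
have cexp : continuous (fun z : R^o => expR (- rate * z)).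
  move=> z; apply: continuous_comp; last exact: continuous_expR.
  by apply: continuousM => //; apply: (@continuousN _ R^o); exact: cst_continuous.
have sub : `[c, +oo[ `<=` `[0, +oo[.
  by apply: subset_itvr; rewrite bnd_simp.
rewrite (@ge0_continuous_FTC2y _ _ (fun x => - (expR (- rate * x))) _ 0)//.
- by rewrite sub0e EFinN oppeK.
- by move=> x _; apply: exponential_pdf_ge0; exact: ltW.
- apply: (@continuous_subspaceW R^o _ _ [set` `[0, +oo[%R]) => //.
  exact: within_continuous_exponential_pdf.
- rewrite -oppr0; apply: cvgN.
  rewrite (_ : (fun x => expR (- rate * x)) =
               (fun z => expR (- z)) \o (fun z => rate * z)); last first.
    by apply: eq_fun => x; rewrite mulNr.
  apply: (@cvg_comp _ _ _ _ _ _ (pinfty_nbhs R)); last exact: cvgr_expR.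
  exact: gt0_cvgMry.
- by apply: cvgN; apply/cvg_at_right_filter; exact: cexp.
- move=> x xc; apply: derive1_exponential_pdf.
  by move: xc; rewrite !in_itv/= !andbT; exact: le_lt_trans.
Qed.

Lemma independent_of_group d (Omega : measurableType d) (R : realType)
    (P : probability Omega R) (I : eqType) (F : I -> set_system Omega)
    (p : pred I) (j : I) :
  (forall i, F i `<=` measurable) -> (forall i, setI_closed (F i)) ->
  mutually_independent P F -> ~~ p j ->
  forall U W, <<s \bigcup_(i in [set i | p i]) F i >> U -> F j W ->
  P (U `&` W) = (P U * P W)%E.
Proof.
move=> Fm FI Find pj U W HU HW.
(* Colours 0 and 1 are the two groups to be separated; every other index gets colour 2. *)
pose g i : nat := if p i then 0%N else if i == j then 1%N else 2%N.
have := group_independent (g := g) Fm FI Find (s := [:: 0%N; 1%N])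
  (A := fun k => if k == 0%N then U else W) isT.
rewrite !bigcap_cons bigcap_seq0 setIT big_cons big_seq1/=; apply.
move=> k; rewrite !inE => /orP[]/eqP -> /=.
  rewrite /group_sigma; congr (<<s _ >> _): HU.
  congr (bigcup _ _); apply/seteqP; split=> i /=; rewrite /g; first by move=> ->.
  by case: ifP => //; case: ifP.
apply: sub_gen_smallest; exists j => //=.
by rewrite /g (negbTE pj) eqxx.
Qed.

Lemma measurable_leset d (T : measurableType d) (R : realType) (f g : T -> R) :
  measurable_fun setT f -> measurable_fun setT g ->
  measurable [set x | f x <= g x].
Proof. by move=> mf mg; have := measurable_fun_le measurableT mf mg; rewrite setTI. Qed.

Lemma measurable_ltset d (T : measurableType d) (R : realType) (f g : T -> R) :
  measurable_fun setT f -> measurable_fun setT g ->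
  measurable [set x | f x < g x].
Proof.
move=> mf mg; rewrite (_ : [set x | f x < g x] = ~` [set x | g x <= f x]).
  by apply: measurableC; exact: measurable_leset.
by apply/seteqP; split=> x /= => [|/negP]; rewrite ltNge => // /negP.
Qed.

Lemma measurable_never d (T : measurableType d) (a b : nat -> T -> bool) :
  (forall n, measurable [set x | a n x]) ->
  (forall n, measurable [set x | b n x]) ->
  measurable [set x | forall n, ~ (a n x && b n x)].
Proof.
move=> ma mb; rewrite (_ : [set x | _] =
    \bigcap_n ~` ([set x | a n x] `&` [set x | b n x])); last first.
  apply/seteqP; split=> x H n; first by move=> _ [/= H1 H2]; apply: (H n); rewrite H1.
  by move=> /andP[H1 H2]; exact: (H n I).
by apply: bigcapT_measurable => n; apply: measurableC; exact: measurableI.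
Qed.

Lemma measurable_never_in_service d (T : measurableType d) (R : realType)
    (B D : nat -> T -> R) (u : T -> R) :
  (forall n, measurable_fun setT (B n)) -> (forall n, measurable_fun setT (D n)) ->
  measurable_fun setT u ->
  measurable [set z | forall n, ~ (D n z - B n z <= u z < D n z)].
Proof.
move=> mB mD mu; apply: measurable_never => n; last exact: measurable_ltset.
by apply: measurable_leset => //; exact: measurable_funB.
Qed.

Lemma measurable_never_arrives d (T : measurableType d) (R : realType)
    (A : nat -> T -> R) (u : T -> R) (y : R) :
  (forall n, measurable_fun setT (A n)) -> measurable_fun setT u ->
  measurable [set z | forall n, ~ (u z < A n z <= u z + y)].
Proof.
move=> mA mu; apply: measurable_never => n; first exact: measurable_ltset.
by apply: measurable_leset => //; exact: measurable_funD.
Qed.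

(** * Markov property, first passages and memorylessness of the M/G/1 queue *)

Section mg1_queue.
Context d (Omega : measurableType d) (R : realType) (P : probability Omega R).
Variables (V : {RV P >-> R}) (lam : R) (A B D : nat -> Omega -> R).
Hypotheses (V_ge0 : forall x, 0 <= V x) (lam_gt0 : 0 < lam).
Hypothesis ABD : MG1_queue P lam (fun s => fine (ccdf V s)) A B D.

Lemma MG1_measurable_gap n : measurable_fun setT (gap A n).
Proof.
case: n => [|n]; first exact: (MG1_arrivals ABD).1.
by apply: measurable_funB; exact: (MG1_arrivals ABD).1.
Qed.

Lemma MG1_measurable_departure n : measurable_fun setT (D n).
Proof.
apply: (proj2 (measurable_state (MG1_fifo ABD) _ _)) => i _.
  exact: MG1_measurable_gap.
exact: MG1_measurable_service ABD i.
Qed.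

Let mV : measurable_fun setT V.
Proof. exact: measurable_funP. Qed.

Let gapm n : {mfun Omega >-> R} :=
  HB.pack (gap A n) (isMeasurableFun.Build _ _ _ _ _ (MG1_measurable_gap n)).
Let Bm n : {mfun Omega >-> R} := HB.pack (B n)
  (isMeasurableFun.Build _ _ _ _ _ (MG1_measurable_service ABD n)).

(** [MG1_queue] prescribes only the tail of the service times; the rays ]x, +oo[ form a generating
    pi-system, so the tail determines the law. *)
Lemma MG1_law_service n U : measurable U -> P (B n @^-1` U) = distribution P V U.
Proof.
move=> mU; pose mB := distribution P (Bm n); pose lV := distribution P V.
rewrite -[LHS]/(mB U).
apply: (@g_sigma_algebra_measure_unique _ R _ (@RGenOInfty.G R) _
  (fun n => `]- n%:R, +oo[%classic) _ _ mB lV).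
- by move=> _ [x ->]; exact: measurable_itv.
- by move=> k; exists (- k%:R).
- rewrite -subTset => x _; exists (Num.bound `|x|) => //=.
  rewrite in_itv/= andbT ltrNl (le_lt_trans _ (archi_boundP _))//.
  by rewrite -normrN ler_norm.
- move=> _ _ [x ->] [y ->]; exists (Num.max x y).
  by apply/seteqP; split => z /=; rewrite !in_itv/= !andbT gt_max => /andP.
- move=> _ [x ->]; have := MG1_service_law ABD n x.
  move=> HP; transitivity (fine (ccdf V x))%:E; last by rewrite fineK ?fin_num_measure.
  rewrite -HP; congr (P _).
  by apply/seteqP; split => z /=; rewrite in_itv/= andbT.
- by move=> k; rewrite (le_lt_trans (probability_le1 _ _)) ?ltry.
- have : (@RGenOInfty.G R).-sigma.-measurable U.
    by rewrite -RGenOInfty.measurableE; exact: mU.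
  exact.
Qed.

Lemma MG1_integral_service n (h : R -> \bar R) : measurable_fun setT h ->
  (forall y, (0 <= h y)%E) ->
  (\int[P]_x h (B n x) = \int[P]_x h (V x))%E.
Proof.
move=> mh h0; rewrite -(ge0_integral_distribution V mh h0).
rewrite -(ge0_integral_distribution (Bm n : {RV P >-> R}) mh h0).
by apply: eq_measure_integral => U mU _; exact: MG1_law_service.
Qed.

Lemma MG1_integral_gap n (h : R -> \bar R) : measurable_fun setT h ->
  (forall y, (0 <= h y)%E) ->
  (\int[P]_x h (gap A n x) =
   \int[lebesgue_measure]_g (h g * (exponential_pdf lam g)%:E))%E.
Proof.
move=> mh h0; apply: ge0_integral_law_density => //.
- exact: MG1_measurable_gap.
- exact: measurable_exponential_pdf.
- by move=> x; apply: exponential_pdf_ge0; exact: ltW.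
- by move=> U mU; exact: (MG1_arrivals ABD).2.
Qed.

Let base (i : nat + nat) : set_system Omega :=
  match i with inl n => sigma_of (gap A n) | inr n => sigma_of (B n) end.

Let base_measurable i : base i `<=` measurable.
Proof.
case: i => n; apply: sigma_of_measurable; first exact: MG1_measurable_gap.
exact: MG1_measurable_service ABD n.
Qed.

Let base_setI i : setI_closed (base i).
Proof. by case: i => n; exact: sigma_of_setI_closed. Qed.

Let state n x := (A n x, D n x).

Let past n : pred (nat + nat) :=
  fun i => match i with inl m | inr m => (m <= n)%N end.

(** The index set [p] may exceed the past: in the Markov property below it also contains the next
    gap. *)
Lemma MG1_state_adapted (p : pred (nat + nat)) n : {subset past n <= p} ->
  measurable_fun setT (state n :
    g_sigma_algebraType (\bigcup_(i in [set i | p i]) base i) -> R * R).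
Proof.
move=> np.
have [] := @measurable_state _ (g_sigma_algebraType
  (\bigcup_(i in [set i | p i]) base i)) R A B D n (MG1_fifo ABD).
- move=> i ni; apply: g_sigma_measurable_fun => W HW.
  by exists (inl i) => //=; exact: (np (inl i)).
- move=> i ni; apply: g_sigma_measurable_fun => W HW.
  by exists (inr i) => //=; exact: (np (inr i)).
by move=> mA mD; exact: measurable_fun_pair.
Qed.

Lemma MG1_measurable_state n : measurable_fun setT (state n).
Proof.
apply: measurable_fun_pair; first exact: (MG1_arrivals ABD).1.
exact: MG1_measurable_departure.
Qed.

Lemma measurable_next_state (h : R * R -> \bar R) : measurable_fun setT h ->
  measurable_fun setT (fun z : (R * R) * R * R =>
    h ((z.1.1.1 + z.1.2)%R, (Num.max (z.1.1.1 + z.1.2) z.1.1.2 + z.2)%R)).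
Proof.
move=> mh; apply: (measurableT_comp mh); apply: measurable_fun_pair.
  apply: measurable_funD; last exact: measurableT_comp.
  by apply: measurableT_comp => //; exact: measurableT_comp.
apply: measurable_funD => //; apply: measurable_maxr.
  apply: measurable_funD; last exact: measurableT_comp.
  by apply: measurableT_comp => //; exact: measurableT_comp.
by apply: measurableT_comp => //; exact: measurableT_comp.
Qed.

Let statem n : {mfun Omega >-> (R * R)%type} :=
  HB.pack (state n) (isMeasurableFun.Build _ _ _ _ _ (MG1_measurable_state n)).

Let state_gap n x := (state n x, gap A n.+1 x).

Let measurable_state_gap n : measurable_fun setT (state_gap n).
Proof.
apply: measurable_fun_pair; first exact: MG1_measurable_state.
exact: MG1_measurable_gap.
Qed.

Let state_gapm n : {mfun Omega >-> ((R * R) * R)%type} :=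
  HB.pack (state_gap n) (isMeasurableFun.Build _ _ _ _ _ (measurable_state_gap n)).

(** The Markov property. The new service time is independent of the state together with the new gap,
    and the new gap is independent of the state; the two are integrated out in this order. *)
Lemma MG1_integral_stateS n (h : R * R -> \bar R) : measurable_fun setT h ->
  (forall z, (0 <= h z)%E) ->
  (\int[P]_x h (A n.+1 x, D n.+1 x) =
   \int[P]_x \int[lebesgue_measure]_g ((\int[P]_w
     h (A n x + g, Num.max (A n x + g) (D n x) + V w)%R) *
     (exponential_pdf lam g)%:E))%E.
Proof.
move=> mh h0.
pose h1 (z : (R * R) * R * R) :=
  h ((z.1.1.1 + z.1.2)%R, (Num.max (z.1.1.1 + z.1.2) z.1.1.2 + z.2)%R).
have mh1 : measurable_fun setT h1 by exact: measurable_next_state.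
have h10 z : (0 <= h1 z)%E by exact: h0.
transitivity (\int[P]_x h1 (state_gapm n x, Bm n.+1 x))%E.
  apply: eq_integral => x _; rewrite /h1/= (MG1_fifo ABD x).2.
  by rewrite (addrC (A n x)) subrK.
rewrite ge0_integral_independent//; last first.
  move=> U W mU mW.
  pose p : pred (nat + nat) := fun i => past n i || (i == inl n.+1).
  apply: (@independent_of_group _ _ _ P _ base p (inr n.+1)) => //.
  - exact: MG1_independence ABD.
  - by rewrite /p/= ltnn.
  - have mst : measurable_fun setT (state_gap n :
        g_sigma_algebraType (\bigcup_(i in [set i | p i]) base i) -> (R * R) * R).
      apply: measurable_fun_pair.
        by apply: MG1_state_adapted => i; rewrite /p /in_mem/= => ->.
      apply: g_sigma_measurable_fun => Z HZ; exists (inl n.+1) => //=.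
      by rewrite /p eqxx orbT.
    by have := mst measurableT U mU; rewrite setTI.
  - by exists W => //; rewrite setTI.
transitivity (\int[P]_x \int[P]_w h1 (state_gapm n x, V w))%E.
  apply: eq_integral => x _.
  apply: (MG1_integral_service n.+1 (h := fun b => h1 (state_gapm n x, b))) => //.
  by apply: (measurableT_comp mh1); exact: measurable_fun_pair.
pose h2 (z : (R * R) * R) := (\int[P]_w h1 (z, V w))%E.
have mh2 : measurable_fun setT h2.
  apply: (measurable_fun_fubini_tonelli_F (m2 := P) (fun z => h1 (z.1, V z.2))) => //.
  apply: (measurableT_comp mh1); apply: measurable_fun_pair => //.
  exact: (measurableT_comp mV).
have h20 z : (0 <= h2 z)%E by exact: integral_ge0.
transitivity (\int[P]_x h2 (statem n x, gapm n.+1 x))%E => //.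
rewrite ge0_integral_independent//; last first.
  move=> U W mU mW.
  apply: (@independent_of_group _ _ _ P _ base (past n) (inl n.+1)) => //.
  - exact: MG1_independence ABD.
  - by rewrite /= ltnn.
  - have := MG1_state_adapted (p := past n) (n := n) (fun _ => id).
    by move=> /(_ measurableT U mU); rewrite setTI.
  - by exists W => //; rewrite setTI.
apply: eq_integral => x _.
apply: (MG1_integral_gap n.+1 (h := fun g => h2 (statem n x, g))) => //.
by apply: (measurableT_comp mh2); exact: measurable_fun_pair.
Qed.

(** The empty start counts as a step out of the virtual state (0, 0): gaps are nonnegative where the
    density is not zero, so the maximum with 0 changes nothing. Thus [weighted_sum_step] covers the
    first arrival too. *)
Lemma MG1_integral_state0 (h : R * R -> \bar R) : measurable_fun setT h ->
  (forall z, (0 <= h z)%E) ->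
  (\int[P]_x h (A 0%N x, D 0%N x) =
   \int[lebesgue_measure]_g ((\int[P]_w
     h (0 + g, Num.max (0 + g) 0 + V w)%R) * (exponential_pdf lam g)%:E))%E.
Proof.
move=> mh h0.
pose h1 (z : R * R) := h (z.1, (z.1 + z.2)%R).
have mh1 : measurable_fun setT h1.
  apply: (measurableT_comp mh); apply: measurable_fun_pair => //.
  exact: measurable_funD.
have h10 z : (0 <= h1 z)%E by exact: h0.
transitivity (\int[P]_x h1 (gapm 0%N x, Bm 0%N x))%E.
  by apply: eq_integral => x _; rewrite /h1/= (MG1_fifo ABD x).1.
rewrite ge0_integral_independent//; last first.
  move=> U W mU mW.
  apply: (@independent_of_group _ _ _ P _ base (pred1 (inl 0%N)) (inr 0%N)) => //.
  - exact: MG1_independence ABD.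
  - apply: sub_gen_smallest; exists (inl 0%N) => /=; first exact: eqxx.
    by exists U => //; rewrite setTI.
  - by exists W => //; rewrite setTI.
pose h2 (g : R) := (\int[P]_w h1 (g, V w))%E.
have mh2 : measurable_fun setT h2.
  apply: (measurable_fun_fubini_tonelli_F (m2 := P) (fun z => h1 (z.1, V z.2))) => //.
  apply: (measurableT_comp mh1); apply: measurable_fun_pair => //.
  exact: (measurableT_comp mV).
transitivity (\int[P]_x h2 (gapm 0%N x))%E.
  apply: eq_integral => x _.
  apply: (MG1_integral_service 0%N (h := fun b => h1 (gapm 0%N x, b))) => //.
  by apply: (measurableT_comp mh1); exact: measurable_fun_pair.
have h20 g : (0 <= h2 g)%E by exact: integral_ge0.
transitivity (\int[lebesgue_measure]_g (h2 g * (exponential_pdf lam g)%:E))%E.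
  exact: (MG1_integral_gap 0%N mh2 h20).
apply: eq_integral => g _.
have [g0|g0] := ltP g 0; first by rewrite lt0_exponential_pdf// !mule0.
congr (_ * _)%E; apply: eq_integral => w _.
by rewrite /h1/= add0r max_l.
Qed.

(** Each use of [weighted_sum_step] trades the last step of the chain for one more unit of the
    index, down to the virtual state (0, 0). The induction raises [k], which is therefore general;
    the intended value is 0. *)
Lemma MG1_weighted_sum u n k :
  (\int[P]_x weighted_sum P V lam u k (A n x, D n x) =
   weighted_sum P V lam u (k + n).+1 (0, 0)%R)%E.
Proof.
have mws j := measurable_weighted_sum P V_ge0 mV u (ltW lam_gt0) j.
have ws0 j := weighted_sum_ge0 P V_ge0 u (ltW lam_gt0) j.
elim: n k => [|n IH] k.
  rewrite (MG1_integral_state0 (mws k) (ws0 k)) addn0.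
  exact: (weighted_sum_step P V_ge0 mV u (ltW lam_gt0) k (0, 0)).
rewrite (MG1_integral_stateS n (mws k) (ws0 k)) -addSnnS -IH.
apply: eq_integral => x _.
exact: (weighted_sum_step P V_ge0 mV u (ltW lam_gt0) k (A n x, D n x)).
Qed.

Lemma MG1_gap_tail n c : 0 <= c ->
  P [set x | c < gap A n x] = (expR (- lam * c))%:E.
Proof.
move=> c0; rewrite -exponential_prob_itvoy// -((MG1_arrivals ABD).2 n)//.
by congr (P _); apply/seteqP; split=> x /=; rewrite in_itv/= andbT.
Qed.

Lemma MG1_gap_ge0 : {ae P, forall x n, 0 <= gap A n x}.
Proof.
apply: ae_foralln => n; exists (gap A n @^-1` `]-oo, 0[); split.
- by rewrite -[X in measurable X]setTI; apply: MG1_measurable_gap.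
- transitivity (exponential_prob lam `]-oo, 0%R[); first exact: (MG1_arrivals ABD).2.
  rewrite /exponential_prob integral0_eq// => x /=; rewrite in_itv/= => x0.
  by rewrite lt0_exponential_pdf.
- by move=> x /= /negP; rewrite in_itv/= -ltNge.
Qed.

Lemma MG1_service_ge0 : {ae P, forall x n, 0 <= B n x}.
Proof.
apply: ae_foralln => n; exists (B n @^-1` `]-oo, 0[); split.
- by rewrite -[X in measurable X]setTI; apply: (MG1_measurable_service ABD).
- transitivity (distribution P V `]-oo, 0%R[); first exact: MG1_law_service.
  rewrite /distribution /pushforward (_ : _ @^-1` _ = set0) ?measure0//.
  by rewrite -subset0 => x /=; rewrite in_itv/= ltNge V_ge0.
- by move=> x /= /negP; rewrite in_itv/= -ltNge.
Qed.

(** If all arrivals were at most [u], all gaps would be, and [n] independent gaps are so with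
    probability r ^ n, where r < 1. *)
Lemma MG1_arrivals_unbounded u : 0 <= u ->
  {ae P, forall x, exists n, u < A n x}.
Proof.
move=> u0; apply: (@negligibleS _ _ _ _ (
  (\bigcap_n [set x | A n x <= u]) `&` [set x | forall n, 0 <= gap A n x]
  `|` ~` [set x | forall n, 0 <= gap A n x])).
  move=> x /= nA; have [g0|g0] := pselect (forall n, 0 <= gap A n x); last by right.
  left; split => // n _ /=; rewrite leNgt; apply/negP => uA; apply: nA.
  by exists n.
apply: negligibleU; last exact: MG1_gap_ge0.
pose r : R := 1 - expR (- lam * u).
have r0 : 0 <= r by rewrite subr_ge0 -expR0 ler_expR mulNr oppr_le0 mulr_ge0// ltW.
have r1 : r < 1 by rewrite ltrBlDr ltrDl expR_gt0.
pose E n := \bigcap_(i in [set` iota 0 n]) [set x | gap A i x <= u].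
have mE n : measurable (E n).
  apply: bigcap_seq_measurable => i _.
  by apply: measurable_leset => //; exact: MG1_measurable_gap.
have PE n : P (E n) = (r ^+ n)%:E.
  have -> : P (E n) = (\prod_(i <- iota 0 n) P [set x | (gap A i x <= u)%R])%E.
    have ind := mutually_independent_comp (h := @inl nat nat)
      (fun _ _ => @inl_inj _ _ _ _) (MG1_independence ABD).
    apply: ind; first exact: iota_uniq.
    move=> i _; exists `]-oo, u]%classic => //.
    by rewrite setTI; apply/seteqP; split=> x /=; rewrite in_itv.
  rewrite (eq_bigr (fun=> r%:E)); last first.
    move=> i _; rewrite (_ : [set x | _] = ~` [set x | u < gap A i x]); last first.
      by apply/seteqP; split=> x /=; [rewrite leNgt => /negP|move=> /negP; rewrite -leNgt].
    rewrite probability_setC ?MG1_gap_tail//.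
    by apply: measurable_ltset => //; exact: MG1_measurable_gap.
  by rewrite prodEFin big_const_seq count_predT size_iota iter_mulr_1.
apply: (@negligibleS _ _ _ _ (\bigcap_n E n)).
  move=> x [/= Au g0] n _ i /=; rewrite mem_iota => _; rewrite (le_trans _ (Au i I))//.
  case: i => [|i]; first by [].
  rewrite /gap lerBlDr lerDl; have := arrival_le g0 (leq0n i).
  by apply: le_trans; have := g0 0%N.
exists (\bigcap_n E n); split => //; first exact: bigcapT_measurable.
have mcap : measurable (\bigcap_n E n) by exact: bigcapT_measurable.
have cr : (fun n => r ^+ n) @ \oo --> (0 : R) by apply: cvg_expr; rewrite ger0_norm.
apply/eqP; rewrite eq_le measure_ge0 andbT -(fineK (fin_num_measure P _ mcap)) lee_fin.
rewrite -(cvg_lim _ cr)//; apply: limr_ge; first by apply/cvg_ex; exists 0.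
apply: nearW => n; rewrite -lee_fin fineK ?fin_num_measure// -PE.
by apply: le_measure; rewrite ?inE//; exact: bigcap_inf.
Qed.

Lemma ae_eq_measure (X Y : set Omega) : measurable X -> measurable Y ->
  {ae P, forall x, X x <-> Y x} -> P X = P Y.
Proof.
move=> mX mY XY; rewrite !measure_integral_indic//.
apply: ae_eq_integral => //; try by apply/measurable_EFinP; exact: measurable_indic.
move: XY; apply: filterS => x XY _; congr EFin; rewrite !indicE; congr (_ _).
by congr (nat_of_bool _); apply/idP/idP; rewrite !inE => /XY.
Qed.

Lemma measurable_no_arrival_within u y :
  measurable (no_arrival_within A u y).
Proof.
by apply: measurable_never_arrives => // n; exact: (MG1_arrivals ABD).1.
Qed.

Lemma measurable_idle_at u : measurable (idle_at B D u).
Proof.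
apply: measurable_never_in_service => // n.
  exact: (MG1_measurable_service ABD).
exact: MG1_measurable_departure.
Qed.

(** All earlier arrivals are required to be at most [u], not just the last one, because arrivals
    increase only almost surely; in this form the events are disjoint at every point. *)
Definition first_passage u n : set Omega :=
  [set x | u < A n x] `&` \bigcap_(i in [set` iota 0 n]) [set x | A i x <= u].

Lemma measurable_first_passage u n : measurable (first_passage u n).
Proof.
have mA i : measurable_fun setT (A i) by exact: (MG1_arrivals ABD).1.
apply: measurableI; first exact: measurable_ltset.
by apply: bigcap_seq_measurable => i _; exact: measurable_leset.
Qed.

Lemma trivIset_first_passage u : trivIset setT (first_passage u).
Proof.
move=> i j _ _ [x [[/= ui iu] [/= uj ju]]].
have [ij|ji|//] := ltngtP i j.
  by have := ju i; rewrite /= mem_iota/= add0n leNgt ui => /(_ ij).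
by have := iu j; rewrite /= mem_iota/= add0n leNgt uj => /(_ ji).
Qed.

Lemma sum_first_passage u X : 0 <= u -> measurable X ->
  P X = (\sum_(0 <= n <oo) P (X `&` first_passage u n))%E.
Proof.
move=> u0 mX.
transitivity (P (\bigcup_n (X `&` first_passage u n))); last first.
  rewrite measure_bigcup//; last 2 first.
  - by move=> n _; apply: measurableI => //; exact: measurable_first_passage.
  - by apply: trivIset_setIl; exact: trivIset_first_passage.
  by apply: eq_eseriesl => // i; rewrite in_setT.
apply: ae_eq_measure => //.
  apply: bigcup_measurable => n _; apply: measurableI => //.
  exact: measurable_first_passage.
have := MG1_arrivals_unbounded u0; apply: filterS => x [n un].
split=> [Xx|[i _ []]//].
have [i ui imin] := ex_minnP (ex_intro (fun n => u < A n x) n un).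
exists i => //; split => //; split => // j /=; rewrite mem_iota/= add0n => ji.
by rewrite leNgt; apply/negP => /imin; rewrite leqNgt ji.
Qed.

Let good x := (forall n, 0 <= gap A n x) /\ (forall n, 0 <= B n x).

Let ae_good : {ae P, forall x, good x}.
Proof.
by have := MG1_gap_ge0; apply: filterS2 MG1_service_ge0 => x ? ?; split.
Qed.

Lemma first_passageS x u n : good x ->
  first_passage u n.+1 x <-> A n x <= u /\ u < A n.+1 x.
Proof.
move=> [g0 _]; split=> [[uA Au]|[Au uA]].
  have ni : n \in iota 0 n.+1 by rewrite mem_iota add0n ltnSn.
  by split => //; exact: (Au n ni).
split=> // i; rewrite /mkset mem_iota add0n ltnS => /andP[_ ni].
by rewrite (le_trans _ Au)// arrival_le.
Qed.

(* Conditionally on the past of the queue, the residual interarrival time is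
   exponential. *)
Lemma MG1_residual n (S : R * R -> bool) u v : u <= v -> measurable_fun setT S ->
  P [set x | [/\ S (A n x, D n x), A n x <= u & v < A n.+1 x]] =
  (\int[P]_x (if S (A n x, D n x) && (A n x <= u) then
     expR (- lam * (v - A n x)) else 0)%:E)%E.
Proof.
move=> uv mS.
pose b (w : (R * R) * R) := S w.1 && (w.1.1 <= u) && (v < w.1.1 + w.2).
have mb : measurable_fun setT b.
  apply: measurable_and; last first.
    apply: measurable_fun_ltr => //; apply: measurable_funD => //.
    exact: measurableT_comp.
  apply: measurable_and; first exact: (measurableT_comp mS).
  by apply: measurable_fun_ler => //; exact: measurableT_comp.
pose h w : \bar R := (if b w then 1 else 0)%:E.
have mh : measurable_fun setT h.
  by apply/measurable_EFinP; exact: measurable_fun_ifT.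
have h0 w : (0 <= h w)%E by rewrite lee_fin; case: ifP.
have mE : measurable [set x | [/\ S (A n x, D n x), A n x <= u & v < A n.+1 x]].
  rewrite (_ : [set x | _] = (state_gapm n) @^-1` (b @^-1` [set true])).
    by rewrite -[X in measurable X]setTI; apply: measurable_state_gap => //;
      rewrite -[X in measurable X]setTI; exact: mb.
  apply/seteqP; split=> x /=; rewrite /b/= (addrC (A n x)) subrK.
    by move=> [-> -> ->].
  by move=> /andP[/andP[-> ->] ->].
rewrite measure_integral_indic//.
transitivity (\int[P]_x h (statem n x, gapm n.+1 x))%E.
  apply: eq_integral => x _; rewrite /h /b/= (addrC (A n x)) subrK; congr EFin.
  rewrite indicE; case: ifPn => [/andP[/andP[Sx Ax] vA]|nb].
    by rewrite mem_set.
  by rewrite memNset// => -[Sx Ax vA]; move: nb; rewrite /state Sx Ax vA.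
rewrite ge0_integral_independent//; last first.
  move=> U W mU mW.
  apply: (@independent_of_group _ _ _ P _ base (past n) (inl n.+1)) => //.
  - exact: MG1_independence ABD.
  - by rewrite /= ltnn.
  - have := MG1_state_adapted (p := past n) (n := n) (fun _ => id).
    by move=> /(_ measurableT U mU); rewrite setTI.
  - by exists W => //; rewrite setTI.
apply: eq_integral => x _; rewrite /h /b/= -/(state n x).
case: (boolP (S (state n x) && (A n x <= u))) => /= [/andP[_ Ax]|_]; last first.
  by rewrite integral0_eq.
rewrite -(MG1_gap_tail n.+1); last by rewrite subr_ge0 (le_trans Ax).
have mg : measurable [set x' | v - A n x < gap A n.+1 x'].
  by apply: measurable_ltset => //; exact: MG1_measurable_gap.
rewrite measure_integral_indic//.
apply: eq_integral => w _; rewrite indicE; congr EFin.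
case: ifPn => [vA|vA]; first by rewrite mem_set//= ltrBlDl.
by rewrite memNset//= ltrBlDl; exact/negP.
Qed.

Lemma no_arrival_within0 u : no_arrival_within A u 0 = setT.
Proof.
rewrite -subTset => x _ n; rewrite addr0 => /andP[uA].
by rewrite leNgt uA.
Qed.

Section observation.
Variables (u : R) (X : set Omega) (S : R * R -> bool).
Hypotheses (u0 : 0 <= u) (mX : measurable X) (mS : measurable_fun setT S).
Hypothesis X0 : forall x, good x -> u < A 0%N x -> X x.
Hypothesis XS : forall x n, good x -> A n x <= u -> u < A n.+1 x ->
  X x <-> S (A n x, D n x).

Let idle_weight n : \bar R := if n is n'.+1 then
  (\int[P]_x (if S (A n' x, D n' x) && (A n' x <= u)%R then
     expR (- lam * (u - A n' x)) else 0%R)%:E)%E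
  else (expR (- lam * u))%:E.

(** Given the past, the time from [u] to the next arrival is exponential, so the window costs the
    same factor for every number [n] of arrivals up to [u], and the factor leaves the sum over [n].
    [X] is abstract because it is taken to be both the idle event and the whole space. *)
Lemma MG1_passage_prob y n :
  P (X `&` no_arrival_within A u y `&` first_passage u n) =
  ((expR (- lam * Num.max y 0))%:E * idle_weight n)%E.
Proof.
have mA i : measurable_fun setT (A i) by exact: (MG1_arrivals ABD).1.
have y0 : 0 <= Num.max y 0 by rewrite le_max lexx orbT.
have mL : measurable (X `&` no_arrival_within A u y `&` first_passage u n).
  apply: measurableI; last exact: measurable_first_passage.
  by apply: measurableI => //; exact: measurable_no_arrival_within.
case: n mL => [|n] mL /=.
  rewrite -EFinM -expRD -mulrDr -(MG1_gap_tail 0%N) ?addr_ge0//.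
  apply: ae_eq_measure => //.
    by apply: measurable_ltset => //; exact: MG1_measurable_gap.
  have := ae_good; apply: filterS => x gx; split.
    move=> [[_ nx] [/= uA _]]; rewrite addrC.
    by apply/(no_arrival_before gx.1 y uA).
  rewrite addrC => /= uy.
  have uA : u < A 0%N x by rewrite (le_lt_trans _ uy)// lerDl.
  split; first by split; [exact: X0|apply/(no_arrival_before gx.1 y uA)].
  by split => // i /=; rewrite in_nil.
have mSA : measurable_fun setT (fun x => S (A n x, D n x) && (A n x <= u)).
  apply: measurable_and; last exact: measurable_fun_ler.
  exact: (measurableT_comp mS (MG1_measurable_state n)).
rewrite -ge0_integralZl_EFin ?expR_ge0//; last 2 first.
- by move=> x _; rewrite lee_fin; case: ifP.
- apply/measurable_EFinP; apply: measurable_fun_ifT => //.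
  apply: (measurableT_comp (@measurable_expR R)).
  by apply: measurable_funM => //; exact: measurable_funB.
transitivity (P [set x | [/\ S (A n x, D n x), A n x <= u &
    u + Num.max y 0 < A n.+1 x]]).
  apply: ae_eq_measure => //.
    rewrite (_ : [set x | _] = [set x | S (A n x, D n x) && (A n x <= u)] `&`
        [set x | u + Num.max y 0 < A n.+1 x]).
      apply: measurableI; last exact: measurable_ltset.
      by rewrite -[X in measurable X]setTI; exact: (mSA measurableT [set true]).
    apply/seteqP; split=> x /=; first by move=> [-> -> ->].
    by move=> [/andP[]].
  have := ae_good; apply: filterS => x gx; split.
    move=> [[Xx nx] /(first_passageS u n gx)[Au uA]]; split => //.
      exact/(XS gx Au uA).
    exact/(no_arrivalP gx.1 y Au uA).
  move=> [Sx Au uy].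
  have uA : u < A n.+1 x by rewrite (le_lt_trans _ uy)// lerDl.
  split; last exact/(first_passageS u n gx).
  split; first exact/(XS gx Au uA).
  exact/(no_arrivalP gx.1 y Au uA).
rewrite MG1_residual//; last by rewrite lerDl.
apply: eq_integral => x _; rewrite -EFinM; congr EFin.
case: ifP => _; last by rewrite mulr0.
by rewrite -expRD; congr expR; ring.
Qed.

Let idle_weight_ge0 n : (0 <= idle_weight n)%E.
Proof.
case: n => [|n]; rewrite /= ?lee_fin ?expR_ge0//.
by apply: integral_ge0 => x _; rewrite lee_fin; case: ifP => // _; exact: expR_ge0.
Qed.

Lemma MG1_observation_series :
  P X = (\sum_(0 <= n <oo) idle_weight n)%E.
Proof.
rewrite (sum_first_passage u0 mX); apply: eq_eseriesr => n _.
have := MG1_passage_prob 0 n; rewrite no_arrival_within0 setIT => ->.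
by rewrite maxxx mulr0 expR0 mul1e.
Qed.

Lemma MG1_memoryless y : P (X `&` no_arrival_within A u y) =
  ((expR (- lam * Num.max y 0))%:E * P X)%E.
Proof.
rewrite (sum_first_passage u0); last first.
  by apply: measurableI => //; exact: measurable_no_arrival_within.
rewrite MG1_observation_series -nneseriesZl//; last first.
by apply: eq_eseriesr => n _; exact: MG1_passage_prob.
Qed.

End observation.

Lemma MG1_no_arrival u y : 0 <= u ->
  P (no_arrival_within A u y) = (expR (- lam * Num.max y 0))%:E.
Proof.
move=> u0.
have := @MG1_memoryless u setT (fun=> true) u0 measurableT
  (measurable_cst _) (fun _ _ _ => I) (fun _ _ _ _ _ => conj (fun=> isT) (fun=> I)) y.
by rewrite setTI probability_setT mule1.
Qed.

Let measurable_departed u : measurable_fun setT (fun z : R * R => z.2 <= u).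
Proof. exact: measurable_fun_ler. Qed.

Let idle0 u x : good x -> u < A 0%N x -> idle_at B D u x.
Proof. by move=> [g0 B0] uA; apply: (idle_at_before (MG1_fifo ABD)) uA. Qed.

Let idleS u x n : good x -> A n x <= u -> u < A n.+1 x ->
  idle_at B D u x <-> D n x <= u.
Proof. by move=> [g0 B0]; exact: idle_atP (MG1_fifo ABD) g0 B0 u n. Qed.

Lemma MG1_idle_no_arrival u y : 0 <= u ->
  P (idle_at B D u `&` no_arrival_within A u y) =
  ((expR (- lam * Num.max y 0))%:E * P (idle_at B D u))%E.
Proof.
move=> u0.
exact: (MG1_memoryless u0 (measurable_idle_at u) (measurable_departed u)
  (@idle0 u) (@idleS u)).
Qed.

Lemma MG1_idle_series u : 0 <= u -> P (idle_at B D u) =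
  (\sum_(0 <= n <oo)
     ((expR (- lam * u))%:E * weighted_sum P V lam u n (0, 0)%R))%E.
Proof.
move=> u0.
rewrite (MG1_observation_series u0 (measurable_idle_at u) (measurable_departed u)
  (@idle0 u) (@idleS u)).
apply: eq_eseriesr => -[|n] _.
  by rewrite /weighted_sum /summand /iter_sum/= !addr0 lexx u0 mulr0 expR0 mul1r mule1.
(* At index 0 the weight is 1, so the integrand is the indicator that [A n] and [D n] are at most
   [u], times expR (lam * A n); together with expR (- lam * u) this is the tail of the residual
   gap. *)
rewrite -(MG1_weighted_sum u n 0) -ge0_integralZl_EFin ?expR_ge0//.
- apply: eq_integral => x _; rewrite -EFinM; congr EFin.
  rewrite /summand/= !addr0 lexx; case: ifP => _; last by rewrite mulr0.
  by rewrite mulr1 -expRD; congr expR; ring.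
- by move=> x _; exact: (weighted_sum_ge0 P V_ge0 u (ltW lam_gt0) 0).
- apply: (measurableT_comp (measurable_weighted_sum P V_ge0 mV u (ltW lam_gt0) 0)).
  exact: MG1_measurable_state.
Qed.

End mg1_queue.

(** * Convergence of the idle probability *)

Section poisson_moments.
Context (R : realType).
Implicit Types x : R.

Definition pois x n : R := expR (- x) * (x ^+ n / n`!%:R).

Lemma pois_ge0 x n : 0 <= x -> 0 <= pois x n.
Proof. by move=> x0; rewrite mulr_ge0 ?expR_ge0// divr_ge0// exprn_ge0. Qed.

Lemma poisS x n : n.+1%:R * pois x n.+1 = x * pois x n.
Proof.
rewrite /pois factS natrM exprS.
have n0 : n`!%:R != 0 :> R by rewrite pnatr_eq0 -lt0n fact_gt0.
have n1 : n.+1%:R != 0 :> R by rewrite pnatr_eq0.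
move: (n`!%:R : R) (n.+1%:R : R) n0 n1 => F K F0 K0; field.
by rewrite F0 K0.
Qed.

Lemma cvg_pois x : series (pois x) @ \oo --> (1 : R).
Proof.
rewrite -(expRxMexpNx_1 x) mulrC.
rewrite (_ : series (pois x) = fun N => expR (- x) * series (exp_coeff x) N).
  by apply: cvgMr => //; exact: is_cvg_series_exp_coeff.
by apply/funext => N; rewrite /series/= mulr_sumr.
Qed.

Lemma cvg_pois1 x : series (fun n => n%:R * pois x n) @ \oo --> x.
Proof.
rewrite -cvg_shiftS.
have H : (fun N => x * series (pois x) N) @ \oo --> x * 1.
  by apply: cvgMr => //; exact: cvg_pois.
rewrite mulr1 in H; apply: cvg_trans H; apply: near_eq_cvg; apply: nearW => N.
rewrite /series/= big_nat_recl// mul0r add0r mulr_sumr.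
by apply: eq_bigr => i _; rewrite poisS.
Qed.

Lemma cvg_pois2 x :
  series (fun n => n%:R * (n%:R - 1) * pois x n) @ \oo --> x * x.
Proof.
rewrite -cvg_shiftS.
have H : (fun N => x * series (fun n => n%:R * pois x n) N) @ \oo --> x * x.
  by apply: cvgMr => //; exact: cvg_pois1.
apply: cvg_trans H; apply: near_eq_cvg; apply: nearW => N.
rewrite /series/= big_nat_recl// !mul0r add0r mulr_sumr.
by apply: eq_bigr => i _; rewrite mulrAC poisS -natr1 addrK mulrAC mulrA.
Qed.

Lemma cvg_pois_variance x :
  series (fun n => (n%:R - x) ^+ 2 * pois x n) @ \oo --> x.
Proof.
have H : (fun N => series (fun n => n%:R * (n%:R - 1) * pois x n) N +
    (1 - 2 * x) * series (fun n => n%:R * pois x n) N +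
    x ^+ 2 * series (pois x) N) @ \oo --> x * x + (1 - 2 * x) * x + x ^+ 2 * 1.
  apply: cvgD; first apply: cvgD; first exact: cvg_pois2.
    by apply: cvgMr => //; exact: cvg_pois1.
  by apply: cvgMr => //; exact: cvg_pois.
have E : x * x + (1 - 2 * x) * x + x ^+ 2 * 1 = x by ring.
rewrite E in H; apply: cvg_trans H; apply: near_eq_cvg; apply: nearW => N.
rewrite /series/= !mulr_sumr -!big_split/=.
by apply: eq_bigr => i _; ring.
Qed.

Lemma eseries_EFin (f : nat -> R) (l : R) : series f @ \oo --> l ->
  (\sum_(0 <= n <oo) (f n)%:E = l%:E)%E.
Proof.
move=> fl; apply/cvg_lim => //.
rewrite (_ : (fun n => _) = EFin \o series f).
  by apply: cvg_comp fl _; exact: cvg_id.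
by apply/funext => n; rewrite /= sumEFin.
Qed.

End poisson_moments.

Section stationary_idle.
Context d (Omega : measurableType d) (R : realType) (P : probability Omega R).
Variables (V : {RV P >-> R}) (lam : R).
Hypotheses (V_ge0 : forall x, 0 <= V x) (lam_gt0 : 0 < lam).
Hypothesis V_int : P.-integrable setT (EFin \o V).
Hypothesis rho_lt1 : rho V lam < 1.

Let mV : measurable_fun setT V.
Proof. exact: measurable_funP. Qed.

Let M : R := fine 'E_P[V].

Lemma expectation_fine : (\int[P]_x (V x)%:E = M%:E)%E.
Proof.
have -> : (\int[P]_x (V x)%:E = 'E_P[V])%E by rewrite expectation_def.
by rewrite /M fineK//; rewrite unlock; apply: integrable_fin_num.
Qed.

Lemma iter_sum_mean k :
  iter_sum P V k (fun y => `|y|%:E) = (k%:R * M)%:E.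
Proof.
case: k => [|k]; first by rewrite /iter_sum normr0 mul0r.
rewrite (eq_iter_sum P V_ge0 k.+1 (h2 := fun y => (`|y|%:E * 1%:E)%E)); last first.
  by move=> y _; rewrite mule1.
rewrite (iter_sum_exchangeable P V_ge0 mV k (h := fun=> 1%:E))//.
under eq_integral do rewrite iter_sum_cst mule1.
by rewrite expectation_fine.
Qed.

Definition excess (u : R) n : \bar R :=
  iter_sum P V n (fun y => (Num.max (y - u) 0)%:E).

(** Pointwise max(1 - y / u, 0) + y / u = 1 + max(y - u, 0) / u, weighted by the Poisson
    probability; the mean of y / u over [n] service times is n M / u. The identity is additive to
    avoid differences of extended reals. *)
Lemma weighted_sum_excess u n : 0 < u ->
  ((expR (- lam * u))%:E * weighted_sum P V lam u n (0, 0)%R +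
   (n%:R * pois (lam * u) n * (M / u))%:E =
   (pois (lam * u) n)%:E + (pois (lam * u) n / u)%:E * excess u n)%E.
Proof.
move=> u0; pose p := pois (lam * u) n.
have p0 : 0 <= p by apply: pois_ge0; rewrite mulr_ge0 ?ltW.
have ui : 0 <= u^-1 by rewrite invr_ge0 ltW.
have mexc : measurable_fun setT (fun y : R => (Num.max (y - u) 0)%:E).
  by apply/measurable_EFinP; apply: measurable_maxr => //; exact: measurable_funB.
have exc0 y : (0 <= (Num.max (y - u) 0)%:E)%E.
  by rewrite lee_fin le_max lexx orbT.
have mdef : measurable_fun setT (fun y : R => (p * Num.max (1 - y / u) 0)%:E).
  apply/measurable_EFinP; apply: measurable_funM => //.
  by apply: measurable_maxr => //; apply: measurable_funB => //; exact: measurable_funM.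
have def0 y : (0 <= (p * Num.max (1 - y / u) 0)%:E)%E.
  by rewrite lee_fin mulr_ge0// le_max lexx orbT.
have -> : ((expR (- lam * u))%:E * weighted_sum P V lam u n (0, 0)%R)%E =
    iter_sum P V n (fun y => (p * Num.max (1 - y / u) 0)%:E).
  rewrite /weighted_sum -iter_sumZ ?expR_ge0//; last 2 first.
  - by apply/measurable_EFinP; apply: measurable_summand.
  - by move=> y; rewrite lee_fin summand_ge0// ltW.
  have sE j y : 0 <= y -> ((expR (- lam * u)) * summand lam u j.+1 (0, 0) y =
      pois (lam * u) j.+1 * Num.max (1 - y / u) 0).
    move=> y0; rewrite /summand/= y0 !add0r mulr0 expR0 subr0 andbb/=.
    case: leP => [yu|uy]; last first.
      by rewrite max_r ?mulr0// subr_le0 ler_pdivlMr// mul1r ltW.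
    rewrite max_l; last by rewrite subr_ge0 ler_pdivrMr// mul1r.
    rewrite /pois (exprSr (lam * u)) exprMn (exprSr lam) mulNr.
    have j0 : j.+1`!%:R != 0 :> R by rewrite pnatr_eq0 -lt0n fact_gt0.
    by field; rewrite j0 gt_eqF.
  rewrite /p; clear p p0 mdef def0; case: n => [|n].
    rewrite /iter_sum -EFinM; congr EFin.
    by rewrite /summand/= lexx !add0r ltW// mulr0 expR0 mul0r subr0 max_l// /pois
      expr0 (_ : 0`! = 1)%N// divr1 !mulr1 mulNr.
  by apply: eq_iter_sum => // y y0; rewrite -EFinM; congr EFin; exact: sE.
have -> : (n%:R * pois (lam * u) n * (M / u))%:E =
    iter_sum P V n (fun y => ((p / u)%:E * `|y|%:E)%E).
  rewrite iter_sumZ//; last 2 first.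
  - by rewrite divr_ge0// ltW.
  - exact: measurableT_comp.
  by rewrite iter_sum_mean -EFinM; congr EFin; rewrite -/p; ring.
rewrite -iter_sumD//; last 2 first.
- by apply/measurable_EFinP; apply: measurable_funM => //; exact: measurable_normr.
- by move=> y; rewrite -EFinM lee_fin; apply: mulr_ge0 => //; rewrite divr_ge0// ltW.
rewrite /excess -iter_sumZ//; last by rewrite mulr_ge0.
rewrite -[in RHS](iter_sum_cst P V n (pois (lam * u) n)) -iter_sumD//; last 2 first.
- by apply: emeasurable_funM.
- by move=> y; rewrite mule_ge0// lee_fin mulr_ge0.
apply: eq_iter_sum => // y y0; rewrite -!EFinM -!EFinD; congr EFin.
rewrite ger0_norm// -/p.
have [yu|uy] := leP y u.
  rewrite max_l ?subr_ge0 ?ler_pdivrMr ?mul1r// max_r ?subr_le0//.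
  by rewrite mulr0 addr0; field; rewrite gt_eqF.
rewrite max_r ?subr_le0 ?ler_pdivlMr ?mul1r ?ltW// max_l ?subr_ge0 1?ltW//.
by field; rewrite gt_eqF.
Qed.

(* The excess is controlled by truncating [V] at [K] and applying the AM-GM
   inequality [max (c - u) 0 <= (c - u + de) ^ 2 / (4 de)] to the truncation. *)
Section truncation.
Variable K : R.

Hypothesis K_ge0 : 0 <= K.

Let tr x : R := Num.min (V x) K.
Let rest x : R := Num.max (V x - K) 0.

Let tr_ge0 x : 0 <= tr x. Proof. by rewrite le_min V_ge0 K_ge0. Qed.
Let tr_leV x : tr x <= V x. Proof. by rewrite ge_min lexx. Qed.
Let tr_leK x : tr x <= K. Proof. by rewrite ge_min lexx orbT. Qed.
Let rest_ge0 x : 0 <= rest x. Proof. by rewrite le_max lexx orbT. Qed.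
Let rest_leV x : rest x <= V x.
Proof. by rewrite ge_max V_ge0 andbT lerBlDr lerDl. Qed.
Let trDrest x : tr x + rest x = V x.
Proof.
by rewrite /tr /rest; case: (leP (V x) K); case: (leP (V x - K) 0); lra.
Qed.

Let mtr : measurable_fun setT tr.
Proof. exact: measurable_minr. Qed.
Let mrest : measurable_fun setT rest.
Proof. by apply: measurable_maxr => //; exact: measurable_funB. Qed.

Let integrable_leV (f : Omega -> R) : measurable_fun setT f ->
  (forall x, 0 <= f x <= V x) ->
  P.-integrable setT (EFin \o f).
Proof.
move=> mf fV; apply: le_integrable V_int => //; first exact/measurable_EFinP.
by move=> x _; have /andP[f0 fV'] := fV x; rewrite lee_fin !ger0_norm.
Qed.

Let itr : P.-integrable setT (EFin \o tr).
Proof. by apply: integrable_leV => // x; rewrite tr_ge0 tr_leV. Qed.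

Let irest : P.-integrable setT (EFin \o rest).
Proof. by apply: integrable_leV => // x; rewrite rest_ge0 rest_leV. Qed.

Let itr2 : P.-integrable setT (EFin \o (fun x => tr x ^+ 2)).
Proof.
have iKV : P.-integrable setT (fun x => K%:E * (EFin \o tr) x)%E.
  exact: integrableZl.
apply: le_integrable iKV => //.
  by apply/measurable_EFinP; exact: measurable_funX.
move=> x _; rewrite /= lee_fin !ger0_norm ?exprn_ge0 ?mulr_ge0//.
by rewrite expr2 ler_wpM2r.
Qed.

Let m1 := fine (\int[P]_x (tr x)%:E).
Let m2 := fine (\int[P]_x (tr x ^+ 2)%:E).
Definition tail_mean := fine (\int[P]_x (rest x)%:E).
Let e := tail_mean.

Let integral_quadratic a b c :
  (\int[P]_x (a + rest x + b * tr x + c * tr x ^+ 2)%:E =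
   (a + e + b * m1 + c * m2)%:E)%E.
Proof.
have ia : P.-integrable setT (EFin \o (fun=> a)).
  by apply: finite_measure_integrable_cst.
have ib : P.-integrable setT (EFin \o (fun x => b * tr x)).
  exact: (integrableZl measurableT b itr).
have ic : P.-integrable setT (EFin \o (fun x => c * tr x ^+ 2)).
  exact: (integrableZl measurableT c itr2).
have iar := integrableD measurableT ia irest.
have iarb := integrableD measurableT iar ib.
transitivity (\int[P]_x (((a%:E + (rest x)%:E) + (b * tr x)%:E) + (c * tr x ^+ 2)%:E))%E.
  by apply: eq_integral => x _; rewrite !EFinD.
rewrite (integralD measurableT iarb ic) (integralD measurableT iar ib).
rewrite (integralD measurableT ia irest).
rewrite (integralZl measurableT itr b) (integralZl measurableT itr2 c).
have -> : (\int[P]_x (EFin \o (fun=> a)) x = a%:E)%E.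
  by rewrite /= integral_cst//= probability_setT mule1.
rewrite !EFinD !EFinM /e /tail_mean /m1 /m2 !fineK//; exact: integrable_fin_num.
Qed.

Let v := m2 - m1 ^+ 2.

(** Write V = tr + rest. The rest passes through the positive part linearly and adds [e] per step;
    the truncated summand is absorbed into the offset [c], which is therefore general. The bound
    being quadratic in [c], its average over [tr] is exactly the next bound, with mean [m1] and
    variance [v] per step. *)
Lemma excess_le u n c de : 0 < de ->
  (iter_sum P V n (fun y => (Num.max (c + y - u) 0)%:E) <=
   (n%:R * e + ((c - u + de + n%:R * m1) ^+ 2 + n%:R * v) / (4 * de))%:E)%E.
Proof.
move=> de0; elim: n c => [|n IH] c.
  rewrite /iter_sum lee_fin addr0 !mul0r !addr0 add0r.
  rewrite ge_max; apply/andP; split; last first.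
    by rewrite divr_ge0 ?sqr_ge0// mulr_ge0// ltW.
  rewrite ler_pdivlMr ?mulr_gt0//.
  rewrite -subr_ge0 (_ : _ - _ = (c - u - de) ^+ 2) ?sqr_ge0//; ring.
have mexc (w : R) : measurable_fun setT (fun y : R => (Num.max (w + y - u) 0)%:E).
  apply/measurable_EFinP; apply: measurable_maxr => //.
  by apply: measurable_funB => //; exact: measurable_funD.
have exc0 (w y : R) : (0 <= (Num.max (w + y - u) 0)%:E)%E.
  by rewrite lee_fin le_max lexx orbT.
rewrite iter_sumS.
pose w := c - u + de + n%:R * m1.
apply: (@le_trans _ _ (\int[P]_x ((n%:R * e + (w ^+ 2 + n%:R * v) / (4 * de)) +
    rest x + (2 * w / (4 * de)) * tr x + (4 * de)^-1 * tr x ^+ 2)%:E)%E).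
  apply: ge0_le_integral => //.
  - by move=> x _; apply: iter_sum_ge0 => // y _; rewrite lee_fin le_max lexx orbT.
  - by apply: (measurable_iter_sum1 P V_ge0 mV n
      (h := fun z => (Num.max (c + z - u) 0)%:E)).
  - apply/measurable_EFinP; apply: measurable_funD.
      by apply: measurable_funD; [exact: measurable_funD|exact: measurable_funM].
    by apply: measurable_funM => //; exact: measurable_funX.
  - move=> x _.
    apply: (@le_trans _ _ (iter_sum P V n (fun y => (rest x)%:E +
        (Num.max ((c + tr x) + y - u) 0)%:E)%E)).
      apply: le_iter_sum => //.
      + apply/measurable_EFinP; apply: measurable_maxr => //.
        by apply: measurable_funB => //; apply: measurable_funD => //; exact: measurable_funD.
      + exact: emeasurable_funD.
      + by move=> y; rewrite adde_ge0// lee_fin.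
      + move=> y y0; rewrite -EFinD lee_fin -(trDrest x); have := rest_ge0 x.
        by case: (leP (c + (tr x + rest x + y) - u) 0);
          case: (leP (c + tr x + y - u) 0); lra.
    rewrite iter_sumD//; last by move=> y; rewrite lee_fin.
    rewrite iter_sum_cst.
    apply: (le_trans (leeD2l _ (IH (c + tr x)))).
    rewrite -EFinD lee_fin /w le_eqVlt; apply/orP; left; apply/eqP.
    by field; rewrite gt_eqF.
rewrite integral_quadratic lee_fin /w /v -natr1 le_eqVlt; apply/orP; left; apply/eqP.
by field; rewrite gt_eqF.
Qed.

Let m1_leM : m1 <= M.
Proof.
rewrite -lee_fin /m1 fineK; last exact: integrable_fin_num.
rewrite -expectation_fine; apply: ge0_le_integral => //.
- by move=> x _; rewrite lee_fin.
- exact/measurable_EFinP.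
- exact/measurable_EFinP.
- by move=> x _; rewrite lee_fin.
Qed.

Lemma excess_series_le : exists C : R, forall u, 0 < u ->
  (\sum_(0 <= n <oo) ((pois (lam * u) n / u)%:E * excess u n) <=
   (lam * e + C / u)%:E)%E.
Proof.
(* With de = u * d0 the centre - u + de + n * m1 becomes m1 * (n - lam * u), so the square averages
   to a Poisson variance. Stability enters through d0 > 0, as m1 <= M. *)
pose d0 := 1 - lam * m1.
have d0_gt0 : 0 < d0.
  rewrite subr_gt0 (le_lt_trans _ rho_lt1)// /rho ler_wpM2l// ltW//.
(* Mean and variance of the Poisson law are both lam * u, so the coefficients m1 ^+ 2 and v add up
   to m2. *)
exists (lam * m2 / (4 * d0)) => u u0.
pose x := lam * u.
pose f n := u^-1 * e * (n%:R * pois x n) +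
  (m1 ^+ 2 / (4 * d0 * u ^+ 2)) * ((n%:R - x) ^+ 2 * pois x n) +
  (v / (4 * d0 * u ^+ 2)) * (n%:R * pois x n).
have fl : series f @ \oo --> lam * e + lam * m2 / (4 * d0) / u.
  have H : (fun N => u^-1 * e * series (fun n => n%:R * pois x n) N +
      (m1 ^+ 2 / (4 * d0 * u ^+ 2)) * series (fun n => (n%:R - x) ^+ 2 * pois x n) N +
      (v / (4 * d0 * u ^+ 2)) * series (fun n => n%:R * pois x n) N) @ \oo -->
      u^-1 * e * x + (m1 ^+ 2 / (4 * d0 * u ^+ 2)) * x + (v / (4 * d0 * u ^+ 2)) * x.
    apply: cvgD; first apply: cvgD; apply: cvgMr => //;
      by [exact: cvg_pois1|exact: cvg_pois_variance].
  have E : u^-1 * e * x + (m1 ^+ 2 / (4 * d0 * u ^+ 2)) * x +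
      (v / (4 * d0 * u ^+ 2)) * x = lam * e + lam * m2 / (4 * d0) / u.
    by rewrite /x /v; field; rewrite !gt_eqF.
  rewrite E in H; apply: cvg_trans H; apply: near_eq_cvg; apply: nearW => N.
  by rewrite /series/= !mulr_sumr -!big_split.
rewrite -(eseries_EFin fl); apply: lee_nneseries => n _.
  rewrite mule_ge0//; last first.
    by apply: iter_sum_ge0 => // y _; rewrite lee_fin le_max lexx orbT.
  by rewrite lee_fin divr_ge0 ?pois_ge0 ?mulr_ge0// ltW.
have pu : 0 <= pois (lam * u) n / u.
  by rewrite divr_ge0 ?pois_ge0 ?mulr_ge0// ltW.
have := excess_le u n 0 (mulr_gt0 u0 d0_gt0).
rewrite /excess (eq_iter_sum P V_ge0 n (h2 := fun y => (Num.max (y - u) 0)%:E)); last first.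
  by move=> y _; rewrite add0r.
move=> /(lee_wpmul2l (x := (pois (lam * u) n / u)%:E)); rewrite lee_fin => /(_ pu).
move=> /le_trans; apply; rewrite -EFinM lee_fin /f /x /d0.
rewrite le_eqVlt; apply/orP; left; apply/eqP.
by field; rewrite !gt_eqF.
Qed.

End truncation.

Lemma tail_mean_cvg : (fun n => tail_mean n%:R) @ \oo --> (0 : R).
Proof.
suff /fine_cvgP[_ //] : (fun n => \int[P]_x (Num.max (V x - n%:R) 0)%:E)%E @ \oo --> 0%:E.
have [||||_ _] := @dominated_convergence _ _ _ P setT measurableT
  (fun n x => (Num.max (V x - n%:R) 0)%:E) (cst 0%E) (EFin \o V) _ _ _ V_int _.
  - move=> n; apply/measurable_EFinP; apply: measurable_maxr => //.
    exact: measurable_funB.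
  - exact: measurable_cst.
  - apply/aeW => x _; apply: cvg_near_cst.
    near=> n; congr EFin; apply: max_r; rewrite subr_le0.
    near: n; exact: nbhs_infty_ger.
  - apply/aeW => x n _; rewrite lee_fin ger0_norm; last by rewrite le_max lexx orbT.
    by rewrite ge_max V_ge0 andbT lerBlDr lerDl.
by rewrite integral0.
Unshelve. all: by end_near. Qed.

Lemma cvg_idle_prob (q : R -> R) : (forall u : R, (0 < u)%R -> (q u)%:E =
    \sum_(0 <= n <oo)
      ((expR (- lam * u))%:E * weighted_sum P V lam u n (0, 0)%R))%E ->
  q u @[u --> +oo] --> 1 - rho V lam.
Proof.
move=> qE.
have M0 : 0 <= M by apply: fine_ge0; exact: expectation_ge0.
pose err u := (\sum_(0 <= n <oo) ((pois (lam * u) n / u)%:E * excess u n))%E.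
have term0 u n : 0 < u -> (0 <= (pois (lam * u) n / u)%:E * excess u n)%E.
  move=> u0; rewrite mule_ge0//; last first.
    by apply: iter_sum_ge0 => // y _; rewrite lee_fin le_max lexx orbT.
  by rewrite lee_fin divr_ge0 ?pois_ge0 ?mulr_ge0// ltW.
have err0 u : 0 < u -> (0 <= err u)%E.
  by move=> u0; apply: nneseries_ge0 => n _ _; exact: term0.
have qerr u : 0 < u -> ((q u + rho V lam)%:E = 1%:E + err u)%E.
  move=> u0; have x0 : 0 <= lam * u by rewrite mulr_ge0 ?ltW.
  rewrite EFinD qE//.
  have -> : (rho V lam)%:E =
      (\sum_(0 <= n <oo) (n%:R * pois (lam * u) n * (M / u))%:E)%E.
    apply/esym/eseries_EFin.
    have H : (fun N => M / u * series (fun n => n%:R * pois (lam * u) n) N) @ \oo -->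
        M / u * (lam * u).
      by apply: cvgMr => //; exact: cvg_pois1.
    have E : M / u * (lam * u) = rho V lam by rewrite /rho -/M; field; rewrite gt_eqF.
    rewrite E in H; apply: cvg_trans H; apply: near_eq_cvg; apply: nearW => N.
    by rewrite /series/= mulr_sumr; apply: eq_bigr => i _; rewrite mulrC.
  rewrite -nneseriesD; last 2 first.
  - move=> n _ _; rewrite mule_ge0 ?lee_fin ?expR_ge0//.
    by apply: weighted_sum_ge0 => //; exact: ltW.
  - by move=> n _ _; rewrite lee_fin mulr_ge0//; [exact: mulr_ge0 (pois_ge0 _ x0)|
      rewrite divr_ge0// ltW].
  under eq_eseriesr do rewrite weighted_sum_excess//.
  rewrite nneseriesD; last 2 first.
  - by move=> n _ _; rewrite lee_fin pois_ge0.
  - by move=> n _ _; exact: term0.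
  by congr (_ + _)%E; apply: eseries_EFin; exact: cvg_pois.
apply/cvgrPdist_le => eps eps0.
(* The truncation level is fixed first, making the tail mean small; the constant [C] that belongs to
   it is then beaten by letting [u] grow. *)
have [K Ke] : exists n : nat, lam * tail_mean n%:R <= eps / 2.
  have H : (fun n => lam * tail_mean n%:R) @ \oo --> lam * 0.
    by apply: cvgMr => //; exact: tail_mean_cvg.
  rewrite mulr0 in H; have e2 : 0 < eps / 2 by rewrite divr_gt0.
  move/cvgrPdist_le : H => /(_ _ e2)[n _ /(_ n (leqnn n))].
  rewrite sub0r normrN => Hn; exists n.
  by rewrite (le_trans _ Hn)// ler_norm.
have [C HC] := excess_series_le (ler0n R K).
near=> u.
have u0 : 0 < u by near: u; exact: nbhs_pinfty_gt.
have errfin : err u = (q u + rho V lam - 1)%:E.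
  have := qerr u u0; case: (err u) (err0 u u0) => [r _ [E]|//|//].
  by congr EFin; rewrite E; ring.
have := err0 u u0; have := HC u u0; rewrite -/(err u) errfin !lee_fin => h1 h2.
have Cu : C / u <= eps / 2.
  have Cu' : C / (eps / 2) <= u.
    by near: u; apply: nbhs_pinfty_ge; exact: num_real.
  by move: Cu'; rewrite !ler_pdivrMr ?divr_gt0// mulrC.
by rewrite ler_norml; lra.
Unshelve. all: by end_near. Qed.

End stationary_idle.

(** * Time averages *)

Section time_average_limit.
Context d (Omega : measurableType d) (R : realType) (P : probability Omega R).
Variables (E : R -> set Omega) (p c : R).
Let T := (measurableTypeR R * Omega)%type.
Hypothesis mE : measurable ([set z | E z.1 z.2] : set T).
Hypothesis Ep : time_average P E p.
Hypothesis Ec : fine (P (E u)) @[u --> +oo%R] --> c.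
Local Open Scope ereal_scope.
Notation leb := (@lebesgue_measure R).

Let window (n : nat) : set T := [set z | E z.1 z.2] `&` (`[0%R, n%:R]%classic `*` setT).

Let mwindow n : measurable (window n).
Proof. by apply: measurableI => //; exact: measurableX. Qed.

Let ysection_window n x :
  ysection (window n) x = [set u | E u x] `&` `[0%R, n%:R]%classic.
Proof.
apply/seteqP; split=> u; rewrite /ysection/= inE; first by move=> [? []].
by move=> [? ?]; split.
Qed.

Let mEu u : measurable (E u).
Proof.
have := measurable_xsection u mE; congr measurable.
by apply/seteqP; split=> x; rewrite /xsection/= inE.
Qed.

Let occupation n x := leb ([set u | E u x] `&` `[0%R, n%:R]%classic).

Let moccupation n : measurable_fun setT (occupation n).
Proof.
rewrite (_ : occupation n = leb \o ysection (window n)).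
  exact: measurable_fun_ysection.
by apply/funext => x; rewrite /= ysection_window.
Qed.

Let lebn n : leb `[0%R, n%:R]%classic = n%:R%:E.
Proof.
rewrite lebesgue_measure_itv/= lte_fin; case: ltP => [_|n0].
  by rewrite -EFinB subr0.
by congr EFin; apply/esym/le_anti; rewrite n0 ler0n.
Qed.

Let occupation_le n x : occupation n x <= n%:R%:E.
Proof.
rewrite -lebn; apply: le_measure; rewrite ?inE//.
  by rewrite -ysection_window; exact: measurable_ysection.
Qed.

Let occupation_fin n x : occupation n x \is a fin_num.
Proof. by rewrite ge0_fin_numE ?(le_lt_trans (occupation_le n x)) ?ltry. Qed.

Let mPE : measurable_fun [set: measurableTypeR R] (fun u => P (E u)).
Proof.
rewrite (_ : (fun u => P (E u)) = P \o xsection ([set z | E z.1 z.2] : set T)).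
  exact: measurable_fun_xsection.
by apply/funext => u /=; congr (P _); apply/seteqP; split=> x; rewrite /xsection/= inE.
Qed.

Let integral_occupation n :
  \int[P]_x occupation n x = \int[leb]_(u in `[0%R, n%:R]) P (E u).
Proof.
have mind : measurable_fun [set: T] (fun z => (\1_(window n) z)%:E : \bar R).
  by apply/measurable_EFinP; exact: measurable_indic.
have := @fubini_tonelli _ _ (measurableTypeR R) Omega R leb P _ mind (fun=> _).
move=> /(_ ltac:(by move=> z; rewrite lee_fin)) => FT.
transitivity (\int[P]_x \int[leb]_u (\1_(window n) (u, x))%:E).
  apply: eq_integral => x _; rewrite /occupation -ysection_window.
  rewrite measure_integral_indic; last exact: measurable_ysection.
  apply: eq_integral => u _; congr EFin; rewrite !indicE; congr (_%:R)%R.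
  by congr nat_of_bool; apply/idP/idP; rewrite !inE /ysection/= inE.
rewrite -FT [RHS]integral_mkcond; apply: eq_integral => u _.
rewrite patchE; case: ifPn => [u0|u0].
  rewrite measure_integral_indic//.
  apply: eq_integral => x _; congr EFin; rewrite !indicE; congr (_%:R)%R.
  rewrite inE in u0; congr nat_of_bool; apply/idP/idP; rewrite !inE.
    by move=> [].
  by move=> Ex; split.
rewrite integral0_eq// => x _; congr EFin; rewrite indicE memNset// => -[_ [/= u0' _]].
by move/negP: u0; apply; rewrite inE.
Qed.

Let phi u := fine (P (E u)).

Let phiE u : P (E u) = (phi u)%:E.
Proof. by rewrite /phi fineK ?fin_num_measure. Qed.

Let phi01 u : (0 <= phi u <= 1)%R.
Proof. by rewrite -!lee_fin -phiE measure_ge0 probability_le1. Qed.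

Let c01 : (0 <= c <= 1)%R.
Proof.
apply/andP; split.
  apply: (cvgr_to_ge Ec).
  by apply: nearW => u; case/andP: (phi01 u).
apply: (cvgr_to_le Ec).
by apply: nearW => u; case/andP: (phi01 u).
Qed.

(** [N] pays for the initial stretch, where P (E u) need not be close to [c] but both lie in
    [0, 1]. *)
Let cesaro (eps : R) : (0 < eps)%R -> exists N : nat, forall n,
  \int[leb]_(u in `[0%R, n%:R]) P (E u) <= (N%:R + (c + eps) * n%:R)%:E /\
  ((c - eps) * n%:R)%:E <= \int[leb]_(u in `[0%R, n%:R]) P (E u) + N%:R%:E.
Proof.
move=> eps0.
have [N HN] : exists N : nat, forall u, (N%:R <= u)%R -> (`|c - phi u| <= eps)%R.
  move/cvgrPdist_le : Ec => /(_ _ eps0)[M [_ HM]].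
  exists (Num.bound `|M|).+1 => u Nu; apply: HM; rewrite (lt_le_trans _ Nu)//.
  rewrite (le_lt_trans (ler_norm M))// (lt_trans (archi_boundP _))//.
  by rewrite ltr_nat.
exists N => n; have [c0 c1] := andP c01.
have mI : measurable_fun (`[0%R, n%:R]%classic : set (measurableTypeR R))
    (fun u => (\1_(`[0%R, N%:R]%classic : set R) u)%:E : \bar R).
  by apply: measurable_funTS; apply/measurable_EFinP; exact: measurable_indic.
have mPEn := measurable_funTS (D := (`[0%R, n%:R]%classic : set (measurableTypeR R))) mPE.
have intI : \int[leb]_(u in `[0%R, n%:R]) (\1_(`[0%R, N%:R]%classic : set R) u)%:E <= N%:R%:E.
  rewrite integral_indic// -lebn; apply: le_measure; rewrite ?inE//.
  exact: measurableI.
have intc (a : R) : \int[leb]_(u in `[0%R, n%:R]) a%:E = (a * n%:R)%:E.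
  by rewrite integral_cst//= lebn EFinM.
split.
  apply: (@le_trans _ _ (\int[leb]_(u in `[0%R, n%:R])
      ((\1_(`[0%R, N%:R]%classic : set R) u)%:E + (c + eps)%:E))).
    apply: ge0_le_integral => //; first exact: emeasurable_funD.
    move=> u /=; rewrite in_itv/= => /andP[u0 un]; rewrite phiE -EFinD lee_fin.
    have /andP[p0 p1] := phi01 u; rewrite indicE.
    case: (leP u N%:R) => uN.
      by rewrite mem_set/= ?in_itv/= ?u0//; lra.
    have := HN u (ltW uN); rewrite ler_norml => /andP[].
    have : (0 <= (u \in `[0%R, N%:R]%classic)%:R :> R)%R by []; lra.
  rewrite ge0_integralD//; last by move=> u _; rewrite lee_fin; lra.
  by rewrite intc EFinD leeD2r.
(* The constant c - eps may be negative, while the comparison of integrals asks for nonnegative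
   integrands. *)
apply: (@le_trans _ _ (\int[leb]_(u in `[0%R, n%:R]) (Num.max (c - eps) 0)%:E)).
  by rewrite intc lee_fin ler_wpM2r// le_max lexx.
apply: (@le_trans _ _ (\int[leb]_(u in `[0%R, n%:R])
    (P (E u) + (\1_(`[0%R, N%:R]%classic : set R) u)%:E))).
  apply: ge0_le_integral => //.
  - by move=> u _; rewrite lee_fin le_max lexx orbT.
  - exact: emeasurable_funD.
  move=> u /=; rewrite in_itv/= => /andP[u0 un]; rewrite phiE -EFinD lee_fin.
  have /andP[p0 p1] := phi01 u; rewrite indicE ge_max.
  case: (leP u N%:R) => uN.
    by rewrite mem_set/= ?in_itv/= ?u0//; apply/andP; split; lra.
  have := HN u (ltW uN); rewrite ler_norml => /andP[].
  have : (0 <= (u \in `[0%R, N%:R]%classic)%:R :> R)%R by [].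
  by move=> ? ? ?; apply/andP; split; lra.
by rewrite ge0_integralD// leeD2l.
Qed.

Lemma time_average_eq : p = c.
Proof.
pose f n x := (n%:R^-1)%:E * occupation n x.
have mf n : measurable_fun setT (f n) by exact: emeasurable_funM.
have f1 n x : `|f n x| <= 1.
  have f0 : 0 <= f n x by rewrite mule_ge0// lee_fin invr_ge0.
  rewrite gee0_abs// /f -(fineK (occupation_fin n x)) -EFinM lee_fin.
  have := occupation_le n x; rewrite -{1}(fineK (occupation_fin n x)) lee_fin.
  case: n {f0} => [|n] h; first by rewrite invr0 mul0r.
  by rewrite mulrC ler_pdivrMr// mul1r.
(* Integer window lengths suffice to identify the limit and provide the sequence that dominated
   convergence works with. *)
have fp : {ae P, forall x, setT x -> f ^~ x @ \oo --> p%:E}.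
  have := Ep; apply: filterS => x Hx _.
  have H : (fine (occupation n x) / n%:R)%R @[n --> \oo] --> p.
    apply: (cvg_comp (G := +oo%R) (fun n => n%:R : R)
      (fun tau : R => fine (leb ([set u | E u x] `&` `[0%R, tau]%classic)) / tau)%R) Hx.
    exact: cvgr_idn.
  rewrite (_ : f ^~ x = EFin \o (fun n => fine (occupation n x) / n%:R)%R).
    by apply: cvg_comp H _; exact: cvg_id.
  by apply/funext => n; rewrite /f/= EFinM muleC fineK.
have [|||_ _] := @dominated_convergence _ _ _ P setT measurableT f (cst p%:E)
  (cst 1) mf _ fp.
- exact: measurable_cst.
- exact: finite_measure_integrable_cst.
- by apply/aeW => x n _; exact: f1.
rewrite /cst integral_cst//= probability_setT mule1 => /fine_cvgP[_ Hp].
apply: (cvg_unique _ Hp) => //.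
apply/cvgrPdist_le => eps eps0.
have e2 : (0 < eps / 2)%R by rewrite divr_gt0.
have [N HN] := cesaro e2.
near=> n.
have n0 : (0 < n%:R :> R)%R by rewrite ltr0n; near: n; exact: nbhs_infty_gt.
have [] := HN n; rewrite /= -integral_occupation.
have -> : \int[P]_x f n x = (n%:R^-1)%:E * \int[P]_x occupation n x.
  by rewrite ge0_integralZl_EFin.
have : \int[P]_x occupation n x \is a fin_num.
  rewrite ge0_fin_numE ?integral_ge0//.
  apply: (@le_lt_trans _ _ (\int[P]_x n%:R%:E)).
    by apply: ge0_le_integral => // x _; exact: occupation_le.
  by rewrite integral_cst//= probability_setT mule1 ltry.
move=> /fineK <-; move: (fine _) => a; rewrite -EFinD !lee_fin -EFinM/= => h1 h2.
have Nn : (N%:R <= eps / 2 * n%:R)%R.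
  rewrite mulrC -ler_pdivrMr//; near: n; exact: nbhs_infty_ger.
rewrite ler_norml; apply/andP; split.
  rewrite -subr_ge0 opprK (_ : _ + _ = (c * n%:R - a + eps * n%:R) / n%:R)%R; last first.
    by field; rewrite gt_eqF.
  by apply: divr_ge0; [lra|exact: ltW].
rewrite -subr_ge0 (_ : _ - _ = (eps * n%:R - c * n%:R + a) / n%:R)%R; last first.
  by field; rewrite gt_eqF.
by apply: divr_ge0; [lra|exact: ltW].
Unshelve. all: by end_near. Qed.

End time_average_limit.

(** * Limit law of the joint state of the cold servers *)

Section state_law.
Context d (Omega : measurableType d) (R : realType) (P : probability Omega R).
Variables (k : nat) (hot : 'I_k) (V : {RV P >-> R}) (lamc : R).
Hypotheses (V_ge0 : forall x, 0 <= V x)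
  (V_int : P.-integrable setT (EFin \o V))
  (lamc_gt0 : 0 < lamc) (rho_lt1 : rho V lamc < 1).
Variables Ac Bc Dc : cold hot -> nat -> Omega -> R.
Hypothesis cold_MG1 : forall j,
  MG1_queue P lamc (fun s => fine (ccdf V s)) (Ac j) (Bc j) (Dc j).
Let base (i : (cold hot * nat) + (cold hot * nat)) : set_system Omega :=
  match i with
  | inl (j, n) => sigma_of (gap (Ac j) n)
  | inr (j, n) => sigma_of (Bc j n)
  end.
Hypothesis cold_indep : mutually_independent P base.

Let owner (i : (cold hot * nat) + (cold hot * nat)) : cold hot :=
  match i with inl (j, _) | inr (j, _) => j end.

Let system I (y : cold hot -> R) (u : R) : set Omega :=
  state_event (fun j => idle_at (Bc j) (Dc j) u)
    (fun j => no_arrival_within (Ac j) u) I y.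

Let server_event (I : {set cold hot}) (y : cold hot -> R) u j : set Omega :=
  (if j \in I then idle_at (Bc j) (Dc j) u else ~` idle_at (Bc j) (Dc j) u)
    `&` no_arrival_within (Ac j) u (y j).

Let systemE I y u : system I y u =
  \bigcap_(j in [set` enum {: cold hot}]) server_event I y u j.
Proof. by apply: eq_bigcapl; split=> j //= _; rewrite mem_enum. Qed.

Let measurable_arrival j n : measurable_fun setT (Ac j n).
Proof. exact: (MG1_arrivals (cold_MG1 j)).1. Qed.

Let measurable_service j n : measurable_fun setT (Bc j n).
Proof. exact: (MG1_measurable_service (cold_MG1 j)). Qed.

Let measurable_departure j n : measurable_fun setT (Dc j n).
Proof. exact: MG1_measurable_departure (cold_MG1 j) n. Qed.

(** Joint measurability in time and outcome, as exchanging the time average with the expectation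
    requires. *)
Lemma measurable_system I y : measurable
  ([set z | system I y z.1 z.2] : set (measurableTypeR R * Omega)).
Proof.
have -> : [set z | system I y z.1 z.2] =
    \bigcap_(j in [set` enum {: cold hot}]) [set z | server_event I y z.1 j z.2].
  by apply/seteqP; split=> z /=; rewrite systemE.
apply: bigcap_seq_measurable => j _.
pose mid := [set z : measurableTypeR R * Omega | idle_at (Bc j) (Dc j) z.1 z.2].
have mi : measurable mid.
  by apply: measurable_never_in_service => // n; exact: measurableT_comp.
have mn : measurable [set z : measurableTypeR R * Omega |
    no_arrival_within (Ac j) z.1 (y j) z.2].
  by apply: measurable_never_arrives => // n; exact: measurableT_comp.
rewrite /server_event; case: (j \in I); first exact: measurableI.
by apply: measurableI => //; exact: measurableC.
Qed.

Let server_event_group I y u j :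
  group_sigma owner base j (server_event I y u j).
Proof.
rewrite /group_sigma; set G := \bigcup_(i in _) _.
have mg i : measurable_fun setT (gap (Ac j) i : g_sigma_algebraType G -> R).
  by apply: g_sigma_measurable_fun => W HW; exists (inl (j, i)).
have mB i : measurable_fun setT (Bc j i : g_sigma_algebraType G -> R).
  by apply: g_sigma_measurable_fun => W HW; exists (inr (j, i)).
have mAD n : measurable_fun setT (Ac j n : g_sigma_algebraType G -> R) /\
    measurable_fun setT (Dc j n : g_sigma_algebraType G -> R).
  exact: (@measurable_state _ (g_sigma_algebraType G) R (Ac j) (Bc j) (Dc j) n
    (MG1_fifo (cold_MG1 j)) (fun i _ => mg i) (fun i _ => mB i)).
have mi : measurable (idle_at (Bc j) (Dc j) u : set (g_sigma_algebraType G)).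
  by apply: (@measurable_never_in_service _ (g_sigma_algebraType G)) => // n;
    exact: (mAD n).2.
have mn : measurable (no_arrival_within (Ac j) u (y j) : set (g_sigma_algebraType G)).
  by apply: (@measurable_never_arrives _ (g_sigma_algebraType G)) => // n; exact: (mAD n).1.
rewrite /server_event; case: (j \in I); first exact: (@measurableI _ (g_sigma_algebraType G)).
apply: (@measurableI _ (g_sigma_algebraType G)) => //.
exact: (@measurableC _ (g_sigma_algebraType G)).
Qed.

Let measurable_server_event I y u j : measurable (server_event I y u j).
Proof.
apply: measurableI; last exact: (measurable_no_arrival_within (cold_MG1 j)).
by case: ifP => _; [|apply: measurableC]; exact: (measurable_idle_at (cold_MG1 j)).
Qed.

Let system_prob I y u :
  P (system I y u) = (\prod_(j <- enum {: cold hot}) P (server_event I y u j))%E.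
Proof.
rewrite systemE; apply: (@group_independent _ _ _ P _ _ owner base) => //.
- move=> [[j n]|[j n]]; apply: sigma_of_measurable => //.
  exact: (MG1_measurable_gap (cold_MG1 j)).
- by move=> [[j n]|[j n]]; exact: sigma_of_setI_closed.
- exact: enum_uniq.
Qed.

Let idle_prob j u := fine (P (idle_at (Bc j) (Dc j) u)).

Let server_event_prob I y u j : 0 <= u ->
  fine (P (server_event I y u j)) = expR (- lamc * Num.max (y j) 0) *
    (if j \in I then idle_prob j u else 1 - idle_prob j u).
Proof.
move=> u0; have mi := measurable_idle_at (cold_MG1 j) u.
have mn := measurable_no_arrival_within (cold_MG1 j) u (y j).
have hi := MG1_idle_no_arrival V_ge0 lamc_gt0 (cold_MG1 j) (y j) u0.
have hn := MG1_no_arrival V_ge0 lamc_gt0 (cold_MG1 j) (y j) u0.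
have hf : P (idle_at (Bc j) (Dc j) u) = (idle_prob j u)%:E.
  by rewrite /idle_prob fineK ?fin_num_measure.
rewrite /server_event; case: ifP => _; first by rewrite hi hf.
rewrite setIC -setDE measureD//; last by rewrite -ge0_fin_numE// fin_num_measure.
by rewrite setIC [X in fine (_ - X)]hi [X in fine (X - _)]hn hf/= mulrBr mulr1.
Qed.

Lemma state_event_cvg I y : fine (P (system I y u)) @[u --> +oo] -->
  \prod_(j <- enum {: cold hot}) (expR (- lamc * Num.max (y j) 0) *
    (if j \in I then 1 - rho V lamc else rho V lamc)).
Proof.
have H : (\prod_(j <- enum {: cold hot}) (expR (- lamc * Num.max (y j) 0) *
    (if j \in I then idle_prob j u else 1 - idle_prob j u))) @[u --> +oo] -->
  \prod_(j <- enum {: cold hot}) (expR (- lamc * Num.max (y j) 0) *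
    (if j \in I then 1 - rho V lamc else rho V lamc)).
  apply: cvg_big => [|j _]; first exact: mul_continuous.
  apply: cvgMr.
  have qcvg : idle_prob j u @[u --> +oo] --> 1 - rho V lamc.
    apply: cvg_idle_prob => // u u0.
    rewrite /idle_prob fineK; last exact/fin_num_measure/(measurable_idle_at (cold_MG1 j)).
    by apply: (MG1_idle_series V_ge0 lamc_gt0 (cold_MG1 j)); exact: ltW.
  case: (j \in I) => //; rewrite -[X in _ --> X](subKr 1).
  by apply: cvgB => //; exact: cvg_cst.
apply: cvg_trans H; apply: near_eq_cvg; near=> u.
have u0 : 0 <= u by near: u; exact: nbhs_pinfty_ge.
rewrite system_prob prode_fin_num//=; apply: eq_bigr => j _.
by rewrite server_event_prob.
Unshelve. all: by end_near. Qed.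

Lemma state_law I y p :
  time_average P (system I y) p ->
  p = \prod_(j <- enum {: cold hot}) (expR (- lamc * Num.max (y j) 0) *
    (if j \in I then 1 - rho V lamc else rho V lamc)).
Proof.
move=> /time_average_eq; apply; first exact: measurable_system.
exact: state_event_cvg.
Qed.
End state_law.

(** * The cold servers at the launch *)

Lemma measurable_fun_superlevel d (T : measurableType d) (R : realType)
    (h : T -> R) : (forall c, measurable [set x | c < h x]) ->
  measurable_fun setT h.
Proof.
move=> mh; apply: (measurability _ (RGenOInfty.measurableE R)).
move=> _ [_ [c ->] <-]; rewrite setTI.
rewrite (_ : _ @^-1` _ = [set x | c < h x]) //.
by apply/seteqP; split=> x /=; rewrite in_itv/= andbT.
Qed.

Section cold_state.
Context d (Omega : measurableType d) (R : realType) (P : probability Omega R).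
Variables (k : nat) (hot : 'I_k) (r lamc : R).
Variables (idle : cold hot -> set Omega) (next : cold hot -> Omega -> R).
Hypotheses (midle : forall j, measurable (idle j))
  (mnext : forall j, measurable_fun setT (next j)).
Let late j c := [set x | c < next j x].
Hypothesis state_prob : forall (I : {set cold hot}) y,
  P (state_event idle late I y) =
  (\prod_(j <- enum {: cold hot}) (expR (- lamc * Num.max (y j) 0) *
    (if j \in I then 1 - r else r)))%:E.

Let mlate j c : measurable (late j c).
Proof. by apply: measurable_ltset. Qed.

(** [None] leaves the idleness of a server open, whereas [state_prob] speaks only of states
    specified at every server. *)
Let partial (c : cold hot -> option bool) y : set Omega :=
  \bigcap_(j in [set` enum {: cold hot}])
    ((match c j with Some true => idle j | Some false => ~` idle j
      | None => setT end) `&` late j (y j)).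

Let measurable_partial c y : measurable (partial c y).
Proof.
apply: bigcap_seq_measurable => j _; apply: measurableI => //.
by case: (c j) => [[]|] //; exact: measurableC.
Qed.

Let factor (b : option bool) : R :=
  match b with Some true => 1 - r | Some false => r | None => 1 end.

(** Induction on the number of open servers: declaring one of them idle or busy splits the event in
    two, with factors 1 - r and r that add up to 1. *)
Let partial_prob c y : P (partial c y) =
  (\prod_(j <- enum {: cold hot}) (expR (- lamc * Num.max (y j) 0) *
    factor (c j)))%:E.
Proof.
have [n] := ubnP #|[pred j | c j == None]|; elim: n c => // n IH c.
rewrite ltnS => cn.
have [j0 /eqP cj0|noN] := pickP (fun j => c j == None); last first.
  rewrite (_ : partial c y = state_event idle late [set j | c j == Some true] y).
    rewrite state_prob; congr EFin; apply: eq_bigr => j _; congr (_ * _).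
    by rewrite inE; have := noN j; case: (c j) => [[]|].
  apply: eq_bigcap => [|j _]; first by split=> j //= _; rewrite mem_enum.
  congr (_ `&` _); rewrite inE.
  by have := noN j; case: (c j) => [[]|].
pose c' b j := if j == j0 then Some b else c j.
have cN b : (#|[pred j | c' b j == None]| < n)%N.
  apply: leq_trans cn; apply: proper_card; apply/properP; split.
    by apply/fintype.subsetP => j; rewrite !inE /c'; case: (j == j0).
  by exists j0; rewrite !inE /c' ?eqxx// cj0.
have -> : partial c y = partial (c' true) y `|` partial (c' false) y.
  apply/seteqP; split=> x.
    move=> H; have [xi|xi] := pselect (idle j0 x); [left|right] => j jE;
      have := H j jE; rewrite /c'; case: eqP => [->|//]; rewrite cj0 => -[_ ?];
      by split.
  move=> H j jE; have [jj|jj] := eqVneq j j0.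
    by case: H => /(_ j jE)[_ ?]; split => //; rewrite jj cj0.
  by case: H => /(_ j jE); rewrite /c' (negbTE jj).
rewrite measureU//; last first.
  have j0E : j0 \in enum {: cold hot} by rewrite mem_enum.
  rewrite -subset0 => x [/(_ j0 j0E) + /(_ j0 j0E)].
  by rewrite /c' eqxx => -[? _] [? _].
rewrite [X in (X + _)%E]IH// [X in (_ + X)%E]IH// -EFinD; congr EFin.
have ju : uniq (enum {: cold hot}) by exact: enum_uniq.
have j0E : j0 \in enum {: cold hot} by rewrite mem_enum.
rewrite !(bigD1_seq j0)//= /c' eqxx cj0/=.
have e b : \prod_(i <- enum {: cold hot} | i != j0)
    (expR (- lamc * Num.max (y i) 0) * factor (if i == j0 then Some b else c i)) =
  \prod_(i <- enum {: cold hot} | i != j0)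
    (expR (- lamc * Num.max (y i) 0) * factor (c i)).
  by apply: eq_bigr => i /negbTE ->.
by rewrite !e -mulrDl -mulrDr subrK.
Qed.

Definition cell j y : set Omega := idle j `&` late j y.

Lemma measurable_cell j y : measurable (cell j y).
Proof. exact: measurableI. Qed.

(** A server outside [s] is left open and gets the bound -1, whose truncation at 0 gives the factor
    1. The event [next j > -1] need not be certain, so the two events are compared off the null set
    where some such bound fails. *)
Lemma cells_prob (s : seq (cold hot)) (y : cold hot -> R) : uniq s ->
  P (\bigcap_(j in [set` s]) cell j (y j)) =
  (\prod_(j <- s) (expR (- lamc * Num.max (y j) 0) * (1 - r)))%:E.
Proof.
move=> us; pose e := enum {: cold hot}.
pose c j := if j \in s then Some true else None.
pose y' j := if j \in s then Num.max (y j) (-1) else -1.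
have y'0 j : j \notin s -> Num.max (y' j) 0 = 0.
  by rewrite /y' => /negbTE ->; apply: max_r; rewrite oppr_le0.
have mW : measurable (partial (fun=> None) (fun=> -1)).
  exact: measurable_partial.
have W1 : P (~` partial (fun=> None) (fun=> -1)) = 0%E.
  rewrite probability_setC// partial_prob big1 ?subee// => j _.
  by rewrite max_r ?mulr0 ?expR0 ?mulr1// oppr_le0.
have mC : measurable (\bigcap_(j in [set` s]) cell j (y j)).
  by apply: bigcap_seq_measurable => j _; exact: measurable_cell.
transitivity (P (partial c y')).
  apply: ae_eq_measure => //.
  exists (~` partial (fun=> None) (fun=> -1)); split => //; first exact: measurableC.
  apply: subsetC => x W; split=> H j /= js.
    have [_ /= l1] := W j js; rewrite /c /y'; case: ifP => // sj.
    by have [? /= ?] := H j sj; split; rewrite // /late/= gt_max l1 andbT.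
  have : j \in e by rewrite mem_enum.
  move=> /H; rewrite /c js => -[? h]; split => //.
  by apply: le_lt_trans h; rewrite /y' js le_max lexx.
rewrite partial_prob; congr EFin.
rewrite (bigID (mem s))/= [X in _ * X]big1 ?mulr1.
  rewrite -big_filter (perm_big s)/=.
    apply: eq_big_seq => j js; rewrite /c js/=; congr (expR (_ * _) * _).
    rewrite /y' js -maxA (max_r (x := -1))// oppr_le0.
  apply: uniq_perm => //; first by rewrite filter_uniq// enum_uniq.
  by move=> j; rewrite mem_filter mem_enum andbT.
by move=> j js; rewrite y'0// mulr0 expR0 mul1r /c (negbTE js).
Qed.

(** Only idle states occur: at a busy server no copy is launched, so the next arrival there does not
    matter to the hot request. *)
Definition cell_pi j : set_system Omega :=
  [set W | W = setT \/ exists y, W = cell j y].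

Lemma cell_pi_setI j : setI_closed (cell_pi j).
Proof.
move=> _ _ [->|[y ->]] [->|[z ->]]; rewrite ?setIT ?setTI; [left|right..] => //.
- by exists z.
- by exists y.
exists (Num.max y z); apply/seteqP; split=> x.
  by move=> [[i h] [_ h']]; split; rewrite // /late/= gt_max; apply/andP.
by rewrite /cell /late/= gt_max => -[i /andP[]].
Qed.

Lemma cell_pi_measurable j : cell_pi j `<=` measurable.
Proof. by move=> _ [->|[y ->]] //; exact: measurable_cell. Qed.

Lemma cell_pi_independent : mutually_independent P cell_pi.
Proof.
move=> s A us HA.
have /choice[f Hf] : forall j, exists by_ : bool * R, j \in s ->
    A j = if by_.1 then cell j by_.2 else setT.
  move=> j; case: (boolP (j \in s)) => [js|_]; last by exists (true, 0).
  by case: (HA j js) => [->|[y ->]]; [exists (false, 0)|exists (true, y)].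
pose y j := (f j).2.
have us' : uniq [seq j <- s | (f j).1] by rewrite filter_uniq.
have -> : \bigcap_(j in [set` s]) A j =
    \bigcap_(j in [set` [seq j <- s | (f j).1]]) cell j (y j).
  apply/seteqP; split=> x H j /=; first rewrite mem_filter => /andP[bj js].
    by have := H j js; rewrite Hf// bj.
  move=> js; rewrite Hf//; case: ifP => // bj; apply: H.
  by rewrite /= mem_filter bj.
rewrite cells_prob// big_filter [RHS](bigID (fun j => (f j).1))/=.
rewrite [X in (_ * X)%E]big1_seq ?mule1; last first.
  by move=> j /andP[/negbTE bj js]; rewrite Hf// bj probability_setT.
transitivity (\prod_(j <- s | (f j).1)
    (expR (- lamc * Num.max (y j) 0) * (1 - r))%:E)%E.
  by elim/big_rec2: _ => // j a b _ <-; rewrite EFinM.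
rewrite big_seq_cond [RHS]big_seq_cond; apply: eq_bigr => j /andP[js bj].
rewrite Hf// bj; have := @cells_prob [:: j] y isT.
by rewrite bigcap_cons bigcap_seq0 setIT big_seq1 => ->.
Qed.

(* Encodes the state of a cold server: [idle j] and [c < next j] hold together
   iff [expR c < availability j]. *)
Definition availability j (x : Omega) : R :=
  if x \in idle j then expR (next j x) else 0.

Lemma availability_gt j c x :
  (expR c < availability j x) = (x \in idle j) && (c < next j x).
Proof.
rewrite /availability; case: ifP => _; first by rewrite ltr_expR.
by rewrite ltNge expR_ge0.
Qed.

Lemma availability_cell j c : [set x | expR c < availability j x] = cell j c.
Proof.
apply/seteqP; split=> x; rewrite /= availability_gt; first by move=> /andP[/set_mem].
by move=> [/mem_set -> ?].
Qed.

(** Positive thresholds are cells through the exponential and negative ones are trivial. The map [h]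
    serves to replace the sigma-algebra of [Omega] by a smaller one. *)
Lemma measurable_availability d' (T : measurableType d') (h : T -> Omega) j :
  (forall c, measurable (h @^-1` (cell j c))) ->
  measurable_fun setT (availability j \o h).
Proof.
move=> mc; apply: measurable_fun_superlevel => c.
change (measurable (h @^-1` [set x | c < availability j x])).
have av0 x : 0 <= availability j x.
  by rewrite /availability; case: ifP => _ //; exact: expR_ge0.
have [c0|c0|->] := ltgtP c 0.
- rewrite (_ : [set x | _] = setT) ?preimage_setT//.
  by apply/seteqP; split=> x //= _; exact: lt_le_trans (av0 x).
- by rewrite -(lnK c0) availability_cell.
(* Threshold 0 means idleness alone, which is the union of the cells with bounds - n because
   [next j x] is finite. *)
rewrite (_ : [set x | _] = \bigcup_(n : nat) cell j (- n%:R)).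
  by rewrite preimage_bigcup; apply: bigcupT_measurable.
apply/seteqP; split=> x /=.
  rewrite /availability; case: ifP => [|_]; last by rewrite ltxx.
  rewrite inE => xj _; exists (Num.bound `|next j x|) => //; split => //.
  rewrite /late/= ltrNl (le_lt_trans (ler_norm _))// normrN.
  exact: archi_boundP.
by move=> [n _]; rewrite -availability_cell/=; apply: lt_trans; exact: expR_gt0.
Qed.

Variable svc : server k -> Omega -> R.
Hypothesis msvc : forall v, measurable_fun setT (svc v).
Hypothesis svc_state_indep : mutually_independent P
  (fun i : server k + unit => match i with
   | inl v => sigma_of (svc v) | inr _ => state_sigma idle next end).

Let state_sigma_sub (s : seq (cold hot)) A :
  (forall j, j \in s -> cell_pi j (A j)) ->
  state_sigma idle next (\bigcap_(j in [set` s]) A j).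
Proof.
move=> HA; rewrite /state_sigma; set G := _ `|` _.
apply: (@bigcap_seq_measurable _ (g_sigma_algebraType G)) => j js.
have [->|[y ->]] := HA j js; first exact: measurableT.
apply: (@measurableI _ (g_sigma_algebraType G)); apply: sub_gen_smallest.
  by left; exists j.
by right; exists j => //; exists `]y, +oo[%classic => //;
  rewrite setTI; apply/seteqP; split=> x /=; rewrite in_itv/= andbT.
Qed.

Let svc_cell (i : server k + cold hot) : set_system Omega :=
  match i with inl v => sigma_of (svc v) | inr j => cell_pi j end.

(** The hypothesis treats the state of all cold servers as one block. An intersection of cells is a
    single event [W] of that block, and the probability of [W] factors by [cell_pi_independent]. *)
Let svc_cell_independent : mutually_independent P svc_cell.
Proof.
move=> s A us HA.
pose s1 := pmap (fun i : server k + cold hot => if i is inl v then Some v else None) s.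
pose s2 := pmap (fun i : server k + cold hot => if i is inr v then Some v else None) s.
have in1 v : (v \in s1) = (inl v \in s).
  rewrite mem_pmap; apply/mapP/idP => [[[w|w] //= ? [->]]//|vs].
  by exists (inl v).
have in2 v : (v \in s2) = (inr v \in s).
  rewrite mem_pmap; apply/mapP/idP => [[[w|w] //= ? [->]]//|vs].
  by exists (inr v).
have u1 : uniq s1 by apply: (pmap_uniq (g := inl)) => // -[].
have u2 : uniq s2 by apply: (pmap_uniq (g := inr)) => // -[].
have psplit : perm_eq s (map inl s1 ++ map inr s2).
  apply: uniq_perm => //.
    rewrite cat_uniq !map_inj_uniq ?u1 ?u2 ?andbT//=; last 2 first.
      by move=> ? ? [].
      by move=> ? ? [].
    by apply/hasPn => _ /mapP[j _ ->]; apply/mapP => -[].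
  move=> [v|j]; rewrite mem_cat.
    rewrite -in1 mem_map; last by move=> ? ? [].
    by rewrite (_ : _ \in map inr _ = false) ?orbF//; apply/mapP => -[].
  rewrite -in2 orbC mem_map; last by move=> ? ? [].
  by rewrite (_ : _ \in map inl _ = false) ?orbF//; apply/mapP => -[].
pose W := \bigcap_(j in [set` s2]) A (inr j).
have -> : \bigcap_(i in [set` s]) A i = \bigcap_(i in [set` (map inl s1 ++ [:: inr tt])])
    (match i with inl v => A (inl v) | inr _ => W end).
  apply/seteqP; split=> x H.
    move=> [v|[]]; rewrite /= mem_cat.
      rewrite orbC in_cons/= mem_map; last by move=> ? ? [].
      by rewrite in1 => ?; exact: H.
    by move=> _ j /=; rewrite in2 => ?; exact: H.
  move=> [v|j] /= si.
    by apply: (H (inl v)); rewrite /= mem_cat map_f// in1.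
  by apply: (H (inr tt)) => /=; rewrite ?mem_cat ?mem_head ?orbT// in2.
rewrite svc_state_indep.
- rewrite (perm_big _ psplit)/= !big_cat/= !big_map big_seq1; congr (_ * _)%E.
  apply: cell_pi_independent => // j; rewrite in2 => js; exact: (HA _ js).
- rewrite cat_uniq/= map_inj_uniq ?u1 ?andbT//=; last by move=> ? ? [].
  by rewrite orbF; apply/mapP => -[].
- move=> [v|[]]; rewrite mem_cat.
    rewrite orbC in_cons/= mem_map; last by move=> ? ? [].
    by rewrite in1 => vs; exact: (HA _ vs).
  by move=> _; apply: state_sigma_sub => j; rewrite in2 => js; exact: (HA _ js).
Qed.

Lemma svc_availability_independent : mutually_independent P
  (fun i : server k + cold hot => match i with
   | inl v => sigma_of (svc v) | inr j => sigma_of (availability j) end).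
Proof.
apply: mutually_independentW (group_independent (g := id) _ _ svc_cell_independent).
- move=> [v|j].
    by move=> W HW; apply: sub_gen_smallest; exists (inl v).
  apply: sigma_of_sub_group.
  apply: (@measurable_availability _ (g_sigma_algebraType _) id) => c.
  by apply: sub_gen_smallest; exists (inr j) => //; right; exists c.
- by move=> [v|j]; [exact: sigma_of_measurable|exact: cell_pi_measurable].
- by move=> [v|j]; [exact: sigma_of_setI_closed|exact: cell_pi_setI].
Qed.

End cold_state.

(** * Recovery groups *)

Section recovery_group_structure.
Variables (k : nat) (hot : 'I_k).
Implicit Types v w : server k.

Lemma addvv (v : 'rV['F_2]_k) : v + v = 0.
Proof. by apply/rowP => i; rewrite !mxE -mulr2n -mulr_natr pchar_Fp_0// mulr0. Qed.

Lemma val_sys_inj : injective (@sys k).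
Proof.
move=> i j /(congr1 val)/= /rowP /(_ i); rewrite !mxE !eqxx/=.
by case: eqP => // _ /eqP; rewrite oner_eq0.
Qed.

(** The coset of [v] modulo the line spanned by the vector of [sys hot], without 0. For [sys hot]
    itself it is a singleton, so these sets partition all servers, the systematic one included. *)
Definition group_of v : {set server k} :=
  [set w | (w == v) || (val w == val v + val (sys hot))]%SET.

Lemma mem_group_of v : v \in group_of v.
Proof. by rewrite inE eqxx. Qed.

Lemma group_of_eq v w : w \in group_of v -> group_of w = group_of v.
Proof.
rewrite inE => /orP[/eqP->//|/eqP wv]; apply/setP => z.
rewrite !inE wv -addrA addvv addr0 -(inj_eq val_inj z w) wv orbC.
by rewrite (inj_eq val_inj).
Qed.

Lemma group_of_hot : group_of (sys hot) = [set sys hot]%SET.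
Proof.
apply/setP => w; rewrite !inE addvv; case: eqP => //= _.
by apply/negbTE; exact: (valP w).
Qed.

Lemma group_of_pair v : v != sys hot ->
  exists w, [/\ w != v, w != sys hot & group_of v = [set v; w]%SET].
Proof.
move=> vh.
have nz : val v + val (sys hot) != 0.
  apply: contra vh => /eqP h; apply/eqP/val_inj => /=.
  by apply: (addIr (val (sys hot))); rewrite addvv.
exists (exist (fun u : 'rV['F_2]_k => u != 0) _ nz); split.
- rewrite -val_eqE/= -subr_eq0 addrAC subrr add0r.
  exact: (valP (sys hot)).
- rewrite -val_eqE/= -subr_eq0 addrK; exact: (valP v).
- by apply/setP => z; rewrite !inE -!val_eqE.
Qed.

Lemma recovery_groupsP (G : {set server k}) :
  reflect (exists2 v, v != sys hot & G = group_of v) (G \in recovery_groups hot).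
Proof.
apply: (iffP idP); rewrite inE.
  move=> /andP[/cards2P[v [w [vw ->]]]].
  rewrite big_setU1/= ?inE// big_set1 => /eqP vwh.
  have wE : val w = val v + val (sys hot) by rewrite -[val (sys hot)]vwh addrA addvv add0r.
  exists v.
    apply/eqP => vh; have := valP w; rewrite /= wE vh addvv eqxx//.
  by apply/setP => z; rewrite !inE -wE (inj_eq val_inj).
move=> [v vh ->]; have [w [wv wh e]] := group_of_pair vh.
have vw : v != w by rewrite eq_sym.
rewrite e cards2 vw/= big_setU1/= ?inE// big_set1.
have : w \in group_of v by rewrite e !inE eqxx orbT.
rewrite inE (negbTE wv)/= => /eqP ->.
by rewrite addrA addvv add0r.
Qed.

Lemma recovery_group_eq (G : {set server k}) v :
  G \in recovery_groups hot -> v \in G -> group_of v = G.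
Proof. by move=> /recovery_groupsP[w _ ->]; exact: group_of_eq. Qed.

Lemma card_server : #|{: server k}| = (2 ^ k - 1)%N.
Proof.
rewrite card_sig (eq_card (B := predC1 (0 : 'rV['F_2]_k)))//.
by rewrite cardC1 card_mx card_Fp// mul1n subn1.
Qed.

(** The groups partition the 2 ^ k - 2 servers other than [sys hot] into pairs. *)
Lemma card_recovery_groups : #|recovery_groups hot| = (2 ^ k.-1 - 1)%N.
Proof.
have part : finset.partition (recovery_groups hot) [set~ sys hot]%SET.
  apply/and3P; split.
  - rewrite finset.eqEsubset; apply/andP; split; apply/fintype.subsetP => v.
      move=> /bigcupP[_ /recovery_groupsP[w wh ->]]; have [z [_ zh ->]] := group_of_pair wh.
      by rewrite !inE => /orP[/eqP->|/eqP->].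
    rewrite !inE => vh; apply/bigcupP; exists (group_of v); last exact: mem_group_of.
    by apply/recovery_groupsP; exists v.
  - apply/finset.trivIsetP => G1 G2 h1 h2; apply: contraR => /pred0Pn[v /andP[v1 v2]].
    by rewrite -(recovery_group_eq h1 v1) (recovery_group_eq h2 v2).
  - by apply/negP; rewrite inE cards0.
have := card_uniform_partition (n := 2) _ part.
have -> : #|[set~ sys hot]%SET| = (2 ^ k - 1).-1.
  by rewrite cardsC1 card_server.
move=> /(_ _)/wrap[]; first by move=> G; rewrite inE => /andP[/eqP].
move=> e; apply/eqP; rewrite -(eqn_pmul2r (isT : 0 < 2)%N) -e -subn1 -subnDA mulnBl.
(* The existence of [hot : 'I_k] makes [k] positive, so 2 ^ k is twice 2 ^ k.-1. *)
by rewrite -[in X in X == _](ltn_predK (ltn_ord hot)) expnSr.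
Qed.

Definition has_cold (G : {set server k}) :=
  [exists j : cold hot, sys (val j) \in G].

Lemma cold_neq_hot (j : cold hot) : sys (val j) != sys hot.
Proof. by rewrite (inj_eq val_sys_inj); exact: (valP j). Qed.

(** Otherwise the unit vector of [j] would be the sum of those of [i] and [hot]; at the coordinate
    [hot] the two cold ones vanish and the hot one is 1. *)
Lemma cold_group_inj (i j : cold hot) :
  sys (val j) \in group_of (sys (val i)) -> i = j.
Proof.
rewrite inE (inj_eq val_sys_inj) => /orP[/eqP h|/eqP/= /rowP /(_ hot)].
  exact/esym/val_inj.
rewrite !mxE !eqxx/= ![hot == _]eq_sym (negbTE (valP i)) (negbTE (valP j))/=.
by rewrite add0r => /eqP; rewrite eq_sym oner_eq0.
Qed.

Lemma card_cold_recovery_groups :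
  #|[set G in recovery_groups hot | has_cold G]%SET| = k.-1.
Proof.
have -> : [set G in recovery_groups hot | has_cold G]%SET =
    [set group_of (sys (val j)) | j : cold hot]%SET.
  apply/setP => G; rewrite inE; apply/andP/imsetP.
    move=> [rG /existsP[j jG]]; exists j => //.
    by rewrite (recovery_group_eq rG jG).
  move=> [j _ ->]; split.
    by apply/recovery_groupsP; exists (sys (val j)) => //; exact: cold_neq_hot.
  by apply/existsP; exists j; exact: mem_group_of.
rewrite card_imset; last first.
  by move=> i j e; apply: cold_group_inj; rewrite e; exact: mem_group_of.
by rewrite card_sig (cardC1 hot) card_ord.
Qed.

End recovery_group_structure.

(** * Service time of a hot request *)

Section group_survival.
Context d (T : measurableType d) (R : realType).
Variables (k : nat) (hot : 'I_k).
Variables (svc : server k -> T -> R) (idle : cold hot -> set T).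
Variable next : cold hot -> T -> R.
Implicit Type G : {set server k}.

(** An implication, so a group whose copy was not launched, or was removed, survives trivially. *)
Definition group_survives s G : set T :=
  [set x | (launched idle G `&` not_removed svc next G) x ->
           s < group_time svc G x].

Lemma hot_service_time_gt s :
  [set x | s < hot_service_time svc idle next x] =
  [set x | s < svc (sys hot) x] `&`
  \bigcap_(G in [set` enum (recovery_groups hot)]) group_survives s G.
Proof.
apply/seteqP; split=> x /=.
  move=> /bigmin_gtP[sx HG]; split=> // G /=; rewrite mem_enum => rG xG.
  by apply: HG; rewrite rG; apply/mem_set.
move=> [sx HG]; apply/bigmin_gtP; split=> // G /andP[rG xG].
by apply: HG; [rewrite /= mem_enum|exact: set_mem].
Qed.

Lemma active_group G x : (launched idle G `&` not_removed svc next G) x <->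
  forall j, sys (val j) \in G -> idle j x /\ svc (sys (val j)) x < next j x.
Proof.
split=> [[l n] j jG|H]; first by split; [exact: l|exact: n].
by split=> j jG; have [] := H j jG.
Qed.

Lemma group_time_le s G x :
  group_time svc G x <= s <-> 0 <= s /\ forall v, v \in G -> svc v x <= s.
Proof. by split=> /bigmax_leP. Qed.

(** Only the servers of [G] and the combined event of idleness and timely completion are assumed
    measurable: the lemma is applied in the sigma-algebra of the service times and availabilities of
    [G], where [next j] alone need not be measurable. *)
Lemma measurable_group_survives s G :
  (forall v, v \in G -> measurable_fun setT (svc v)) ->
  (forall j, sys (val j) \in G ->
     measurable [set x | idle j x /\ svc (sys (val j)) x < next j x]) ->
  measurable (group_survives s G).
Proof.
move=> mG mj.
have mlate : measurable [set x | s < group_time svc G x].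
  rewrite (_ : [set x | _] = ~` [set x | 0 <= s /\ forall v, v \in G -> svc v x <= s]).
    (* The default 0 of the maximum in [group_time] exceeds every negative [s]. *)
    apply: measurableC; have [s0|s0] := leP 0 s.
      rewrite (_ : [set x | _] = \bigcap_(v in [set` enum G]) [set x | svc v x <= s]).
        apply: bigcap_seq_measurable => v; rewrite mem_enum => vG.
        by apply: measurable_leset => //; exact: mG.
      apply/seteqP; split=> x; first by move=> [_ H] v /=; rewrite mem_enum; exact: H.
      by move=> H; split=> // v vG; apply: H; rewrite /= mem_enum.
    by rewrite (_ : [set x | _] = set0)//; apply/seteqP; split=> x // [].
  apply/seteqP; split=> x /=; rewrite -group_time_le; first by move/lt_geF => ->.
  by move/negP; rewrite -ltNge.
rewrite (_ : group_survives s G =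
    ~` (\bigcap_(j in [set` [seq j <- enum {: cold hot} | sys (val j) \in G]])
      [set x | idle j x /\ svc (sys (val j)) x < next j x]) `|`
    [set x | s < group_time svc G x]).
  apply: measurableU => //; apply/measurableC/bigcap_seq_measurable => j.
  by rewrite mem_filter => /andP[jG _]; exact: mj.
apply/seteqP; split=> x.
  move=> H; have [a|na] := pselect ((launched idle G `&` not_removed svc next G) x).
    by right; exact: H.
  left => Hj; apply/na/active_group => j jG; apply: Hj.
  by rewrite /= mem_filter jG mem_enum.
move=> [H /active_group a|H _]; last exact: H.
case: H => j /=.
by rewrite mem_filter => /andP[jG _]; exact: a.
Qed.

Lemma measurable_hot_service_time :
  (forall v, measurable_fun setT (svc v)) -> (forall j, measurable (idle j)) ->
  (forall j, measurable_fun setT (next j)) ->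
  measurable_fun setT (hot_service_time svc idle next).
Proof.
move=> ms mi mn; apply: measurable_fun_superlevel => s.
rewrite hot_service_time_gt; apply: measurableI; first exact: measurable_ltset.
apply: bigcap_seq_measurable => G _; apply: measurable_group_survives => // j _.
by apply: measurableI => //; exact: measurable_ltset.
Qed.

End group_survival.

(** * Tail of the hot service time, group by group *)

Section hot_tail.
Context d (Omega : measurableType d) (R : realType) (P : probability Omega R).
Variables (k : nat) (hot : 'I_k) (V : {RV P >-> R}) (f : R -> R) (lamc : R).
Hypotheses (V_ge0 : forall x, 0 <= V x) (f_ge0 : forall v, 0 <= f v)
  (f_meas : measurable_fun setT f)
  (V_density : forall U : set R, measurable U ->
     distribution P V U = (\int[lebesgue_measure]_(v in U) (f v)%:E)%E).
Variables (svc : server k -> {RV P >-> R}) (idle : cold hot -> set Omega).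
Variable next : cold hot -> {RV P >-> R}.
Hypothesis svc_law : forall v (U : set R), measurable U ->
  distribution P (svc v) U = distribution P V U.
Hypothesis midle : forall j, measurable (idle j).
Let r := rho V lamc.
Hypothesis state_prob : forall (I : {set cold hot}) y,
  P (state_event idle (fun j c => [set x | c < next j x]) I y) =
  (\prod_(j <- enum {: cold hot}) (expR (- lamc * Num.max (y j) 0) *
    (if j \in I then 1 - r else r)))%:E.
Hypothesis svc_state_indep : mutually_independent P
  (fun i : server k + unit => match i with
   | inl v => sigma_of (svc v) | inr _ => state_sigma idle next end).

Let av j := availability idle next j.

Let base (i : server k + cold hot) : set_system Omega :=
  match i with inl v => sigma_of (svc v) | inr j => sigma_of (av j) end.

Let base_independent : mutually_independent P base.
Proof. exact: (svc_availability_independent midle _ state_prob _ svc_state_indep). Qed.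

Let mav j : measurable_fun setT (av j).
Proof.
by apply: (@measurable_availability _ _ _ _ _ _ _ _ _ id) => c; exact: measurable_cell.
Qed.

Let base_measurable i : base i `<=` measurable.
Proof. by case: i => v; exact: sigma_of_measurable. Qed.

Let base_setI i : setI_closed (base i).
Proof. by case: i => v; exact: sigma_of_setI_closed. Qed.

(** The blocks of the grouping: the availability of a cold server joins the group of that server,
    and the systematic hot server forms a block of its own, which is not a recovery group. *)
Let owner (i : server k + cold hot) : {set server k} :=
  match i with inl v => group_of hot v | inr j => group_of hot (sys (val j)) end.

Let F s : R := fine (cdf V s).

Let svc_le v s : P [set x | svc v x <= s] = (F s)%:E.
Proof.
rewrite /F fineK; last exact: fin_num_measure.
by rewrite /cdf -(svc_law v).
Qed.

Let activeE j x :
  (idle j x /\ svc (sys (val j)) x < next j x) <-> expR (svc (sys (val j)) x) < av j x.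
Proof.
rewrite /av availability_gt; split; first by move=> [/mem_set -> ->].
by move=> /andP[/set_mem].
Qed.

Let group_survives_owner s (G : {set server k}) : G \in recovery_groups hot ->
  group_sigma owner base G (group_survives svc idle next s G).
Proof.
move=> rG; rewrite /group_sigma; set B := \bigcup_(i in _) _.
have ms v : v \in G -> measurable_fun setT (svc v : g_sigma_algebraType B -> R).
  move=> vG; apply: g_sigma_measurable_fun => W HW; exists (inl v) => //=.
  exact: recovery_group_eq.
apply: (@measurable_group_survives _ (g_sigma_algebraType B)) => // j jG.
rewrite (_ : [set x | _] = [set x | expR (svc (sys (val j)) x) < av j x]).
  apply: (@measurable_ltset _ (g_sigma_algebraType B)).
    by apply: (measurableT_comp (@measurable_expR R)); exact: ms.
  apply: g_sigma_measurable_fun => W HW; exists (inr j) => //=.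
  exact: recovery_group_eq.
by apply/seteqP; split=> x /activeE.
Qed.

Lemma hot_service_time_prob s :
  P [set x | (s < hot_service_time svc idle next x)%R] =
  (P [set x | (s < svc (sys hot) x)%R] *
   \prod_(G <- enum (recovery_groups hot)) P (group_survives svc idle next s G))%E.
Proof.
rewrite hot_service_time_gt; pose H := group_of hot (sys hot).
have HN : H \notin recovery_groups hot.
  by rewrite /H group_of_hot inE cards1.
pose A (G : {set server k}) := if G \in recovery_groups hot
  then group_survives svc idle next s G else [set x | s < svc (sys hot) x].
have eA G : G \in enum (recovery_groups hot) -> A G = group_survives svc idle next s G.
  by rewrite mem_enum /A => ->.
have AH : A H = [set x | s < svc (sys hot) x] by rewrite /A (negbTE HN).
have := group_independent (g := owner) base_measurable base_setI base_independent
  (s := H :: enum (recovery_groups hot)) (A := A).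
rewrite bigcap_cons big_cons AH (eq_bigcap_seq eA).
rewrite (eq_big_seq (fun G => P (group_survives svc idle next s G))); last first.
  by move=> G /eA ->.
apply; first by rewrite /= mem_enum HN enum_uniq.
move=> G; rewrite in_cons => /orP[/eqP->|GR].
  rewrite AH; apply: sub_gen_smallest; exists (inl (sys hot)) => //=.
  exists `]s, +oo[%classic => //.
  by rewrite setTI; apply/seteqP; split=> x /=; rewrite in_itv/= andbT.
by rewrite eA//; apply: group_survives_owner; rewrite -mem_enum.
Qed.

Let setC_group_survives s G : ~` group_survives svc idle next s G =
  [set x | 0 <= s /\ (forall v, v \in G -> svc v x <= s) /\
    forall j, sys (val j) \in G -> expR (svc (sys (val j)) x) < av j x].
Proof.
apply/seteqP; split=> x.
  move=> /not_implyP[/active_group a /negP]; rewrite -leNgt => /group_time_le[s0 H].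
  by split => //; split => // j jG; apply/activeE; exact: a.
move=> [s0 [H a]]; apply/not_implyP; split.
  by apply/active_group => j jG; apply/activeE; exact: a.
by apply/negP; rewrite -leNgt; exact/group_time_le.
Qed.

Let measurable_survives s G : measurable (group_survives svc idle next s G).
Proof.
apply: measurable_group_survives => // j _.
by apply: measurableI => //; exact: measurable_ltset.
Qed.

Let F_lt0 s : s < 0 -> F s = 0.
Proof.
move=> s0; rewrite /F /cdf/= /distribution /pushforward.
rewrite (_ : _ @^-1` _ = set0) ?measure0//.
apply/seteqP; split=> x //=; rewrite in_itv/= => Vs.
by have := le_lt_trans Vs s0; rewrite ltNge V_ge0.
Qed.

(** For negative [s] every group survives, [group_time] being at least 0; the closed formulas agree
    because the distribution function of [V] vanishes there. *)
Let survives_prob s G p : (0 <= s -> P (~` group_survives svc idle next s G) = p%:E) ->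
  (s < 0 -> p = 0) -> P (group_survives svc idle next s G) = (1 - p)%:E.
Proof.
move=> H p0; rewrite -[group_survives _ _ _ _ _]setCK probability_setC//;
  last exact: measurableC.
have [s0|s0] := leP 0 s; first by rewrite H.
rewrite p0// setC_group_survives (_ : [set x | _] = set0) ?measure0//.
by apply/seteqP; split=> x // [/le_lt_trans /(_ s0)]; rewrite ltxx.
Qed.

Let svc_prob_setI v w s : v != w ->
  P ([set x | svc v x <= s] `&` [set x | svc w x <= s]) = (F s * F s)%:E.
Proof.
move=> vw; rewrite EFinM -{1}(svc_le v) -(svc_le w).
have sg u : sigma_of (svc u) [set x | svc u x <= s].
  exists `]-oo, s]%classic => //.
  by rewrite setTI; apply/seteqP; split=> x /=; rewrite in_itv.
have := base_independent (s := [:: inl v; inl w])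
  (A := fun i => if i is inl u then [set x | svc u x <= s] else setT).
rewrite !bigcap_cons bigcap_seq0 setIT !big_cons big_nil mule1; apply.
  by rewrite /= inE andbT; apply: contra vw => /eqP[->].
by move=> i; rewrite !inE => /orP[]/eqP ->; exact: sg.
Qed.

Lemma plain_group_survives_prob s (G : {set server k}) :
  G \in recovery_groups hot -> ~~ has_cold hot G ->
  P (group_survives svc idle next s G) = (1 - F s ^+ 2)%:E.
Proof.
move=> /recovery_groupsP[v vh ->] nc.
have [w [wv wh e]] := group_of_pair vh.
apply: survives_prob => [s0|s0]; last by rewrite F_lt0// expr0n.
rewrite setC_group_survives expr2 -(svc_prob_setI (v := w) (w := v) _ wv).
congr (P _); apply/seteqP; split=> x.
  by move=> [_ [H _]]; split; apply: H; rewrite e !inE eqxx ?orbT.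
move=> [Hw Hv]; split => //; split.
  by move=> u; rewrite e !inE => /orP[]/eqP ->.
move=> j jG; exfalso; move/negP: nc; apply.
by apply/existsP; exists j.
Qed.

Let cell_prob j c : P [set x | expR c < av j x] =
  (expR (- lamc * Num.max c 0) * (1 - r))%:E.
Proof.
rewrite availability_cell.
have := cells_prob midle _ state_prob (s := [:: j]) (fun=> c) isT.
by rewrite bigcap_cons bigcap_seq0 setIT big_seq1; apply.
Qed.

(** 1 - r is the probability of a cell with bound 0, so a cold symbol must be at hand to read this
    off. *)
Let rho_le1 : cold hot -> 0 <= 1 - r.
Proof.
move=> j; have : (0 <= P [set x | (expR 0 < av j x)%R])%E by [].
by rewrite cell_prob lee_fin maxxx mulr0 expR0 mul1r.
Qed.

Let discounted (s : R) : R :=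
  (\int[lebesgue_measure]_(v in `[0, s]) (expR (- lamc * v) * f v))%R.

Let mdiscount : measurable_fun setT (fun v : R => expR (- lamc * v) * f v).
Proof.
apply: measurable_funM => //; apply: (measurableT_comp (@measurable_expR R)).
exact: measurable_funM.
Qed.

Hypothesis lamc_ge0 : 0 <= lamc.

Let discountedE s : (\int[lebesgue_measure]_(v in `[0%R, s])
    (expR (- lamc * v) * f v)%:E = (discounted s)%:E)%E.
Proof.
rewrite /discounted /Rintegral fineK// ge0_fin_numE; last first.
  by apply: integral_ge0 => v _; rewrite lee_fin mulr_ge0// expR_ge0.
apply: (@le_lt_trans _ _ (\int[lebesgue_measure]_(v in `[0%R, s]) (f v)%:E)%E).
  apply: ge0_le_integral => //.
  - by move=> v _; rewrite lee_fin mulr_ge0// expR_ge0.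
  - by apply: measurable_funTS; apply/measurable_EFinP.
  - by apply: measurable_funTS; apply/measurable_EFinP.
  move=> v /=; rewrite in_itv/= => /andP[v0 _]; rewrite lee_fin ler_piMl//.
  by rewrite -expR0 ler_expR mulNr oppr_le0 mulr_ge0.
rewrite -V_density// (le_lt_trans (probability_le1 _ _)) ?ltry//.
Qed.

Let avm j : {mfun Omega >-> R} :=
  HB.pack (av j) (isMeasurableFun.Build _ _ _ _ _ (mav j)).

Let law_integral (X : {RV P >-> R}) (h : R -> R) :
  (forall U : set R, measurable U -> distribution P X U = distribution P V U) ->
  measurable_fun setT h -> (forall x, 0 <= h x) ->
  (\int[P]_x (h (X x))%:E = \int[lebesgue_measure]_v (h v * f v)%:E)%E.
Proof.
move=> lX mh h0; under [RHS]eq_integral do rewrite EFinM.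
apply: (ge0_integral_law_density (h := EFin \o h)) => //.
- by move=> U mU; rewrite -V_density// -lX.
- exact/measurable_EFinP.
Qed.

(** Given a service time x <= s, the server is idle with its next arrival after x with probability
    (1 - r) exp(- lamc max(x, 0)), service time and availability being independent; this is then
    integrated over the law of the service time. *)
Let early_prob j s : P [set x | svc (sys (val j)) x <= s /\
    expR (svc (sys (val j)) x) < av j x] = ((1 - r) * discounted s)%:E.
Proof.
set v := sys (val j).
pose H : set (R * R) := [set z | z.1 <= s] `&` [set z | expR z.1 < z.2].
have mH : measurable H.
  apply: measurableI; first exact: measurable_leset.
  by apply: measurable_ltset => //; exact: (measurableT_comp (@measurable_expR R)).
have mE : measurable [set x | svc v x <= s /\ expR (svc v x) < av j x].
  apply: measurableI; first exact: measurable_leset.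
  by apply: measurable_ltset => //; exact: (measurableT_comp (@measurable_expR R)).
rewrite measure_integral_indic//.
transitivity (\int[P]_x (\1_H (svc v x, avm j x))%:E)%E.
  by apply: eq_integral => x _; rewrite !indicE.
rewrite (@ge0_integral_independent _ _ _ _ _ _ _ P (svc v) (avm j) _
  (fun z => (\1_H z)%:E)); first last.
- by move=> z; rewrite lee_fin.
- by apply/measurable_EFinP; exact: measurable_indic.
- move=> U W mU mW.
  have := base_independent (s := [:: inl v; inr j])
    (A := fun i => if i is inl _ then svc v @^-1` U else av j @^-1` W).
  rewrite !bigcap_cons bigcap_seq0 setIT !big_cons big_nil mule1; apply => //.
  by move=> i; rewrite !inE => /orP[]/eqP -> /=;
    [exists U => //; rewrite setTI|exists W => //; rewrite setTI].
pose h1 x : R := \1_(`]-oo, s]%classic : set R) x * (expR (- lamc * Num.max x 0) * (1 - r)).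
pose h2 x : R := \1_(`[0, s]%classic : set R) x * (expR (- lamc * x) * (1 - r)).
have h10 x : 0 <= h1 x by rewrite mulr_ge0// mulr_ge0 ?expR_ge0// (rho_le1 j).
have h20 x : 0 <= h2 x by rewrite mulr_ge0// mulr_ge0 ?expR_ge0// (rho_le1 j).
have mh1 : measurable_fun setT h1.
  apply: measurable_funM; first exact: measurable_indic.
  apply: measurable_funM => //; apply: (measurableT_comp (@measurable_expR R)).
  by apply: measurable_funM => //; exact: measurable_maxr.
have mh2 : measurable_fun setT h2.
  apply: measurable_funM; first exact: measurable_indic.
  apply: measurable_funM => //; apply: (measurableT_comp (@measurable_expR R)).
  exact: measurable_funM.
transitivity (\int[P]_x (h1 (svc v x))%:E)%E.
  apply: eq_integral => x _; rewrite /h1 indicE.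
  have [xs|xs] := leP (svc v x) s; last first.
    rewrite [in RHS]memNset/= ?in_itv/= ?mul0r; last by apply/negP; rewrite -ltNge.
    rewrite integral0_eq// => w _; rewrite indicE memNset// => -[/=].
    by rewrite leNgt xs.
  rewrite [in RHS]mem_set/= ?in_itv//= mul1r -(cell_prob j).
  rewrite measure_integral_indic; last by apply: measurable_ltset.
  apply: eq_integral => w _; congr EFin; rewrite !indicE; congr (_ _).
  congr nat_of_bool; apply/idP/idP; rewrite !inE; first by move=> [].
  by move=> ?; split.
(* The copies have the law of [V], but only [V] is nonnegative everywhere; moving the integral to
   [V] removes the truncation at 0 and turns the ray into [0, s]. *)
rewrite (law_integral (svc_law v))// -(law_integral (X := V))//.
transitivity (\int[P]_x (h2 (V x))%:E)%E.
  apply: eq_integral => x _; congr EFin; rewrite /h1 /h2 max_l//.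
  congr (_ * _); rewrite !indicE; congr (_ _); congr nat_of_bool.
  by apply/idP/idP; rewrite !inE/= !in_itv/= V_ge0.
rewrite law_integral//.
transitivity (\int[lebesgue_measure]_(x in `[0%R, s])
    ((1 - r)%:E * (expR (- lamc * x) * f x)%:E))%E.
  rewrite [RHS]integral_mkcond; apply: eq_integral => x _.
  rewrite patchE /h2 indicE; case: ifP => _; last by rewrite !mul0r.
  by rewrite mul1r -EFinM; congr EFin; ring.
rewrite ge0_integralZl_EFin//; last 3 first.
- by move=> x _; rewrite lee_fin mulr_ge0// expR_ge0.
- by apply: measurable_funTS; apply/measurable_EFinP.
- exact: (rho_le1 j).
by rewrite discountedE EFinM.
Qed.

Lemma cold_group_survives_prob s (G : {set server k}) :
  G \in recovery_groups hot -> has_cold hot G ->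
  P (group_survives svc idle next s G) = (alpha V f lamc s * (1 - r) + r)%:E.
Proof.
move=> rG /existsP[j jG].
have GE := esym (recovery_group_eq rG jG).
have [w [wv wh e]] := group_of_pair (cold_neq_hot j).
rewrite (survives_prob (p := (1 - r) * discounted s * F s)).
- by congr EFin; rewrite /alpha -/(F s) -/(discounted s); ring.
- move=> s0; rewrite EFinM -(early_prob j) -(svc_le w).
  rewrite setC_group_survives (_ : [set x | _] =
      [set x | svc (sys (val j)) x <= s /\ expR (svc (sys (val j)) x) < av j x]
      `&` [set x | svc w x <= s]); last first.
    apply/seteqP; split=> x.
      move=> [_ [H a]]; split; first by split; [exact: H|exact: a].
      by apply: H; rewrite GE e !inE eqxx orbT.
    move=> [[Hj a] Hw]; split => //; split.
      by move=> u; rewrite GE e !inE => /orP[]/eqP ->.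
    (* [sys (val j)] is the only cold server of the group, so its condition is the only one. *)
    by move=> i; rewrite GE => /cold_group_inj <-.
  apply: (@independent_of_group _ _ _ P _ base
    [pred i | (i == inl (sys (val j))) || (i == inr j)] (inl w)) => //.
  + by rewrite /= orbF; apply: contra wv => /eqP[->].
  + set B := \bigcup_(i in _) _.
    have ms : measurable_fun setT (svc (sys (val j)) : g_sigma_algebraType B -> R).
      apply: g_sigma_measurable_fun => W HW; exists (inl (sys (val j))) => //=.
      by rewrite eqxx.
    have ma : measurable_fun setT (av j : g_sigma_algebraType B -> R).
      by apply: g_sigma_measurable_fun => W HW; exists (inr j) => //=; rewrite eqxx orbT.
    apply: (@measurableI _ (g_sigma_algebraType B)).
      exact: (@measurable_leset _ (g_sigma_algebraType B)).
    apply: (@measurable_ltset _ (g_sigma_algebraType B)) => //.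
    exact: (measurableT_comp (@measurable_expR R)).
  + exists `]-oo, s]%classic => //.
    by rewrite setTI; apply/seteqP; split=> x /=; rewrite in_itv.
- by move=> s0; rewrite F_lt0// mulr0.
Qed.

Lemma hot_service_time_tail s :
  P [set x | s < hot_service_time svc idle next x] =
  (hot_tail V f lamc (2 ^ k.-1 - 1) k.-1 s)%:E.
Proof.
rewrite hot_service_time_prob.
have -> : (P [set x | (s < svc (sys hot) x)%R] = (fine (ccdf V s))%:E)%E.
  rewrite fineK; last exact: fin_num_measure.
  rewrite /ccdf -(svc_law (sys hot))//; congr (P _).
  by apply/seteqP; split=> x /=; rewrite in_itv/= andbT.
pose a := 1 - F s ^+ 2; pose b := alpha V f lamc s * (1 - r) + r.
rewrite big_enum/=.
transitivity ((fine (ccdf V s))%:E *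
    (\prod_(G in recovery_groups hot) (if has_cold hot G then b else a))%:E)%E.
  congr (_ * _)%E; rewrite (big_morph EFin EFinM erefl); apply: eq_bigr => G rG.
  by case: ifPn; [exact: cold_group_survives_prob|exact: plain_group_survives_prob].
rewrite -EFinM; congr EFin; rewrite /hot_tail /Cfactor -mulrA; congr (_ * _).
rewrite -/(F s) -/a -/r -/b (bigID (has_cold hot))/= mulrC.
pose C := [set G in recovery_groups hot | has_cold hot G]%SET.
pose N := [set G in recovery_groups hot | ~~ has_cold hot G]%SET.
have cN : #|N| = (2 ^ k.-1 - 1 - k.-1)%N.
  rewrite -(card_recovery_groups hot) -(card_cold_recovery_groups hot).
  have -> : #|recovery_groups hot| = (#|C| + #|N|)%N.
    rewrite -!sum1_card (bigID (has_cold hot))/=.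
    by congr addn; apply: eq_bigl => G; rewrite !inE.
  by rewrite addKn.
rewrite -cN -(card_cold_recovery_groups hot) -!prodr_const.
congr (_ * _); apply: eq_big => G; rewrite ?inE//.
  by move=> /andP[_ /negbTE ->].
by move=> /andP[_ ->].
Qed.

End hot_tail.

(** * Assembly of the hot queue *)

Lemma state_sigma_measurable d (Omega : measurableType d) (R : realType) (k : nat)
    (hot : 'I_k) (idle : cold hot -> set Omega) (next : cold hot -> Omega -> R) :
  (forall j, measurable (idle j)) -> (forall j, measurable_fun setT (next j)) ->
  state_sigma idle next `<=` measurable.
Proof.
move=> mi mn; apply: smallest_sub; first exact: sigma_algebra_measurable.
by move=> W [[j _ <-]|[j _]]; [exact: mi|exact: sigma_of_measurable].
Qed.

Lemma state_sigma_setI_closed d (Omega : measurableType d) (R : realType)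
    (k : nat) (hot : 'I_k) (idle : cold hot -> set Omega)
    (next : cold hot -> Omega -> R) : setI_closed (state_sigma idle next).
Proof. by move=> U W; exact: (@measurableI _ (g_sigma_algebraType _)). Qed.

Theorem proposition2
  (d : measure_display) (Omega : measurableType d) (R : realType)
  (P : probability Omega R)
  (* [2^k - 1, k] simplex code, one hot symbol *)
  (k : nat) (hot : 'I_k) (t m : nat)
  (ht : t = (2 ^ k.-1 - 1)%N) (hm : m = trunc_log 2 (t + 1))
  (* service time V with density f, request rates, stability *)
  (V : {RV P >-> R}) (f : R -> R) (lam lamc : R)
  (V_ge0 : forall x, 0 <= V x)
  (f_ge0 : forall v, 0 <= f v)
  (f_meas : measurable_fun setT f)
  (V_density : forall U : set R, measurable U ->
     distribution P V U = (\int[lebesgue_measure]_(v in U) (f v)%:E)%E)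
  (V_int : P.-integrable setT (EFin \o V))
  (lam_gt0 : 0 < lam) (lamc_gt0 : 0 < lamc)
  (rho_lt1 : rho V lamc < 1)
  (* cold queues: arrival epochs, service times, departure epochs *)
  (Ac Bc Dc : cold hot -> nat -> Omega -> R)
  (cold_MG1 : forall j,
     MG1_queue P lamc (fun s => fine (ccdf V s)) (Ac j) (Bc j) (Dc j))
  (cold_indep : mutually_independent P
     (fun i : (cold hot * nat) + (cold hot * nat) =>
        match i with
        | inl (j, n) => sigma_of (gap (Ac j) n)
        | inr (j, n) => sigma_of (Bc j n)
        end))
  (* hot requests: arrival epochs, service times of their copies, and the
     state of the cold servers met at launch *)
  (A D : nat -> Omega -> R)
  (svc : nat -> server k -> {RV P >-> R})
  (idle : nat -> cold hot -> set Omega)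
  (next : nat -> cold hot -> {RV P >-> R})
  (hot_arrivals : exponential_gaps P lam A)
  (svc_law : forall n v (U : set R), measurable U ->
     distribution P (svc n v) U = distribution P V U)
  (idle_meas : forall n j, measurable (idle n j))
  (hot_fifo : fifo A (fun n => hot_service_time (svc n) (idle n) (next n)) D)
  (* low traffic: each hot request independently sees time averages *)
  (sees_time_averages : forall n (I : {set cold hot}) (y : cold hot -> R),
     time_average P
       (fun u => state_event (fun j => idle_at (Bc j) (Dc j) u)
                   (fun j => no_arrival_within (Ac j) u) I y)
       (fine (P (state_event (idle n)
                   (fun j c => [set x | c < next n j x]) I y))))
  (hot_indep : mutually_independent P
     (fun i : nat + (nat * server k) + nat =>
        match i with
        | inl (inl n) => sigma_of (gap A n)
        | inl (inr (n, v)) => sigma_of (svc n v)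
        | inr n => state_sigma (idle n) (next n)
        end)) :
  MG1_queue P lam (hot_tail V f lamc t m) A
    (fun n => hot_service_time (svc n) (idle n) (next n)) D.
Proof.
pose base (i : nat + (nat * server k) + nat) : set_system Omega :=
  match i with
  | inl (inl n) => sigma_of (gap A n)
  | inl (inr (n, v)) => sigma_of (svc n v)
  | inr n => state_sigma (idle n) (next n)
  end.
have mA n : measurable_fun setT (A n) by exact: hot_arrivals.1.
have mgap n : measurable_fun setT (gap A n).
  by case: n => [|n]; [exact: mA|exact: measurable_funB (mA _) (mA _)].
have base_measurable i : base i `<=` measurable.
  case: i => [[n|[n v]]|n]; [exact: sigma_of_measurable..|].
  exact: state_sigma_measurable.
have base_setI i : setI_closed (base i).
  case: i => [[n|[n v]]|n]; [exact: sigma_of_setI_closed..|].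
  exact: state_sigma_setI_closed.
(* The probability of each state at a launch is assumed to be its time average, hence is the limit
   computed from the cold queues. *)
have state_prob n (I : {set cold hot}) y :
    P (state_event (idle n) (fun j c => [set x | c < next n j x]) I y) =
    (\prod_(j <- enum {: cold hot}) (expR (- lamc * Num.max (y j) 0) *
      (if j \in I then 1 - rho V lamc else rho V lamc)))%:E.
  rewrite -(state_law V_ge0 V_int lamc_gt0 rho_lt1 cold_MG1 cold_indep
    (sees_time_averages n I y)) fineK// fin_num_measure//.
  rewrite /state_event (_ : \bigcap_(j in _) _ = \bigcap_(j in [set` enum {: cold hot}])
    ((if j \in I then idle n j else ~` idle n j) `&` [set x | y j < next n j x])).
    apply: bigcap_seq_measurable => j _; apply: measurableI; last exact: measurable_ltset.
    by case: ifP => _ //; exact: measurableC.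
  by apply: eq_bigcapl; split=> j //= _; rewrite mem_enum.
have svc_state n : mutually_independent P (fun i : server k + unit =>
    match i with inl v => sigma_of (svc n v)
    | inr _ => state_sigma (idle n) (next n) end).
  (* Independence within one request is that of the whole system along an embedding of its
     indices. *)
  pose h (i : server k + unit) : nat + (nat * server k) + nat :=
    match i with inl v => inl (inr (n, v)) | inr _ => inr n end.
  apply: mutually_independentW (mutually_independent_comp (h := h) _ hot_indep).
    by move=> [v|u] W.
  by move=> [v|[]] [w|[]] // [->].
split => //.
- by move=> n; exact: measurable_hot_service_time.
- move=> n s; rewrite (hot_service_time_tail V_ge0 f_ge0 f_meas V_density
    (svc_law n) (idle_meas n) (state_prob n) (svc_state n) (ltW lamc_gt0)).
  (* t + 1 = 2 ^ k.-1, so the truncated logarithm is exact. *)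
  have mE : m = k.-1.
    by rewrite hm ht subnK ?expn_gt0// trunc_expnK.
  by rewrite mE ht.
(* Request [n] owns the service times of its copies and the state it meets. Its service time is
   measurable with respect to this block, so the service times are independent of one another and of
   the gaps. *)
pose owner (i : nat + (nat * server k) + nat) : nat + nat :=
  match i with inl (inl n) => inl n | inl (inr (n, _)) => inr n | inr n => inr n end.
apply: mutually_independentW
  (group_independent (g := owner) base_measurable base_setI hot_indep).
move=> [n|n].
  by move=> W HW; apply: sub_gen_smallest; exists (inl (inl n)).
apply: sigma_of_sub_group; set B := \bigcup_(i in _) _.
apply: (@measurable_hot_service_time _ (g_sigma_algebraType B)).
- by move=> v; apply: g_sigma_measurable_fun => W HW; exists (inl (inr (n, v))).
- move=> j; apply: sub_gen_smallest; exists (inr n) => //.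
  by apply: sub_gen_smallest; left; exists j.
- move=> j; apply: g_sigma_measurable_fun => W HW; exists (inr n) => //.
  by apply: sub_gen_smallest; right; exists j.
Qed.
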